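(* Let $A$ be a two-sided noetherian ring that has a dualizing complex or is commutative. If $A$ satisfies condition (AC), then every finitely generated left $A$-module $M\neq 0$ with $\operatorname{Ext}_A^{i}(M,A)=0$ for all $i\geq 1$ is of G-dimension $0$.
   Context: Modules are left modules; right $A$-modules are identified with left modules over the opposite ring $A^{\circ}$. A left-noetherian ring $A$ satisfies condition (AC) if for every finitely generated left $A$-module $M$ there exists an integer $b_M\geq 0$ such that for every finitely generated left $A$-module $N$ one has: if $\operatorname{Ext}_A^{i}(M,N)=0$ for all $i\gg 0$, then $\operatorname{Ext}_A^{i}(M,N)=0$ for all $i>b_M$. A finitely generated left module $M\neq 0$ over a two-sided noetherian ring $A$ is of G-dimension $0$ if it is reflexive (i.e. the canonical map $M\to\operatorname{Hom}_{A^\circ}(\operatorname{Hom}_A(M,A),A)$ is an isomorphism) and $\operatorname{Ext}_A^i(M,A)=0=\operatorname{Ext}_{A^{\circ}}^i(\operatorname{Hom}_A(M,A),A)$ for all $i\geq 1$. Rings are algebras over some commutative ring $\Bbbk$ (e.g. $\Bbbk=\mathbb Z$), and $\Bbbk$ acts centrally on bimodules. Complexes are graded homologically; a complex $X$ is right-bounded if $X_v=0$ for $v\ll 0$ and bounded if $X_v=0$ for $|v|\gg 0$. Dualizing complex: for a two-sided noetherian ring $A$, a dualizing complex for $A$ is a complex $D$ of $A$-$A$-bimodules such that: (1) $D$ has bounded homology, and each homology module of $D$ is finitely generated over $A$ and over $A^{\circ}$; (2) there is a quasi-isomorphism of complexes of bimodules $P\to D$, where $P$ is right-bounded and consists of bimodules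 that are projective over $A$ and over $A^{\circ}$; (3) there is a quasi-isomorphism of complexes of bimodules $D\to I$, where $I$ is bounded and consists of bimodules that are injective over $A$ and over $A^{\circ}$; (4) the homothety morphisms $A\to \mathbf{R}\mathrm{Hom}_{A^{\circ}}(D,D)$ and $A\to\mathbf{R}\mathrm{Hom}_A(D,D)$ are isomorphisms in homology. *)

(* Defs.v *)
From HB Require Import structures.
From mathcomp Require Import all_boot all_order all_algebra.
From mathcomp Require Import boolp.

Set Implicit Arguments.
Unset Strict Implicit.
Unset Printing Implicit Defensive.

Import GRing.Theory.
Local Open Scope ring_scope.

(** Modules are left modules; a right [R]-module is a left module over the
    converse ring [R^c], and [R^o] is the regular module. *)

Definition fin_gen (R : pzRingType) (M : lmodType R) : Prop :=
  exists (n : nat) (g : 'I_n -> M),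
    forall x, exists c : 'I_n -> R, x = \sum_i c i *: g i.

Definition zero_module (R : pzRingType) (M : lmodType R) : Prop :=
  forall x : M, x = 0.

Definition projective (R : pzRingType) (P : lmodType R) : Prop :=
  forall (U V : lmodType R) (g : {linear U -> V}) (f : {linear P -> V}),
    (forall v, exists u, g u = v) ->
    exists h : {linear P -> U}, forall x, g (h x) = f x.

Definition injective_module (R : pzRingType) (E : lmodType R) : Prop :=
  forall (U V : lmodType R) (g : {linear U -> V}) (f : {linear U -> E}),
    injective g ->
    exists h : {linear V -> E}, forall x, h (g x) = f x.

Definition left_ideal (R : pzRingType) (J : R -> Prop) : Prop :=
  [/\ J 0, (forall x y, J x -> J y -> J (x + y)) &
      (forall a x, J x -> J (a * x))].

Definition left_noetherian (R : pzRingType) : Prop :=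
  forall J : R -> Prop, left_ideal J ->
    exists (n : nat) (g : 'I_n -> R),
      (forall i, J (g i)) /\
      (forall x, J x -> exists c : 'I_n -> R, x = \sum_i c i * g i).

Definition noetherian (R : pzRingType) : Prop :=
  left_noetherian R /\ left_noetherian R^c.

Record proj_resolution (R : pzRingType) (M : lmodType R) := ProjResolution {
  res_obj :> nat -> lmodType R;
  res_dif : forall n, {linear res_obj n.+1 -> res_obj n};
  res_aug : {linear res_obj 0%N -> M};
  res_projective : forall n, projective (res_obj n);
  res_aug_surj : forall m, exists x, res_aug x = m;
  res_exact0 : forall x, res_aug x = 0 <-> exists y, x = res_dif 0%N y;
  res_exact : forall n x,
    res_dif n x = 0 <-> exists y, x = res_dif n.+1 y }.

Section Ext.
Variables (R : pzRingType) (M : lmodType R) (P : proj_resolution M).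
Variable N : lmodType R.

Definition ext_cocycle (i : nat) (f : {linear P i -> N}) : Prop :=
  forall x, f (res_dif P i x) = 0.

Definition ext_coboundary (i : nat) : {linear P i -> N} -> Prop :=
  match i return {linear P i -> N} -> Prop with
  | 0%N => fun f => forall x, f x = 0
  | j.+1 => fun f => exists g : {linear P j -> N},
                       forall x, f x = g (res_dif P j x)
  end.

End Ext.

(** [ext_zero i M N] is [Ext_R^i(M, N) = 0], where [Ext_R^i(M, N)] is the
    [i]-th cohomology (cocycles modulo coboundaries) of [Hom_R(P, N)] for a
    projective resolution [P] of [M].  Every module has a projective
    resolution, and the cohomology does not depend on it. *)
Definition ext_zero (R : pzRingType) (i : nat) (M N : lmodType R) : Prop :=
  exists P : proj_resolution M,
    forall f : {linear P i -> N}, ext_cocycle f -> ext_coboundary f.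

Definition condition_AC (R : pzRingType) : Prop :=
  forall M : lmodType R, fin_gen M ->
    exists b : nat, forall N : lmodType R, fin_gen N ->
      (exists m : nat, forall i, (m < i)%N -> ext_zero i M N) ->
      forall i, (b < i)%N -> ext_zero i M N.

Definition dual (R : pzRingType) (M : lmodType R) : Type :=
  {linear M -> R^o}.

Section Dual.
Variables (R : pzRingType) (M : lmodType R).
Local Notation D := (dual M).

HB.instance Definition _ := gen_eqMixin D.
HB.instance Definition _ := gen_choiceMixin D.

Definition dual_app (f : D) : {linear M -> R^o} := f.

Lemma dual_ext (f g : D) : (forall x, dual_app f x = dual_app g x) -> f = g.
Proof.
rewrite /dual_app; case: f g => f cf [g cg] /= /funext fg.
move: cg; case: g / fg => cg; congr GRing.Linear.Pack.
case: cf cg => [m1 m2] [n1 n2].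
congr GRing.Linear.Class.
  case: m1 n1 => ? [?]; congr GRing.isNmodMorphism.Axioms_.
  exact: Prop_irrelevance.
case: m2 n2 => ? [?]; congr GRing.isScalable.Axioms_.
exact: Prop_irrelevance.
Qed.

Definition dual_zero : D := (\0 : {linear M -> R^o}).
Definition dual_opp (f : D) : D := (\- dual_app f : {linear M -> R^o}).
Definition dual_add (f g : D) : D :=
  (dual_app f \+ dual_app g : {linear M -> R^o}).

Fact dual_addA : associative dual_add.
Proof. by move=> f g h; apply: dual_ext => x; exact: addrA. Qed.
Fact dual_addC : commutative dual_add.
Proof. by move=> f g; apply: dual_ext => x; exact: addrC. Qed.
Fact dual_add0 : left_id dual_zero dual_add.
Proof. by move=> f; apply: dual_ext => x; exact: add0r. Qed.
Fact dual_addN : left_inverse dual_zero dual_opp dual_add.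
Proof. by move=> f; apply: dual_ext => x; exact: addNr. Qed.

HB.instance Definition _ :=
  GRing.isZmodule.Build D dual_addA dual_addC dual_add0 dual_addN.

Definition dual_scale_fun (a : R) (f : D) (x : M) : R^o :=
  (dual_app f x : R) * a.

Fact dual_scale_linear a f : linear (dual_scale_fun a f).
Proof.
move=> c x y; rewrite /dual_scale_fun linearP mulrDl.
by congr (_ + _); rewrite -mulrA.
Qed.

HB.instance Definition _ a f :=
  GRing.isLinear.Build R M R^o *:%R (dual_scale_fun a f)
    (dual_scale_linear a f).

(** The right action [(f a)(x) = f(x) a], as a left action of [R^c]. *)
Definition dual_scale (a : R^c) (f : D) : D :=
  (dual_scale_fun a f : {linear M -> R^o}).

Fact dual_scaleA a b f :
  dual_scale a (dual_scale b f) = dual_scale (a * b) f.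
Proof. by apply: dual_ext => x; rewrite /= /dual_scale_fun /= -mulrA. Qed.
Fact dual_scale1 : left_id 1 dual_scale.
Proof. by move=> f; apply: dual_ext => x; exact: mulr1. Qed.
Fact dual_scaleDr : right_distributive dual_scale +%R.
Proof. by move=> a f g; apply: dual_ext => x; exact: mulrDl. Qed.
Fact dual_scaleDl f : {morph dual_scale^~ f : a b / a + b}.
Proof. by move=> a b; apply: dual_ext => x; exact: mulrDr. Qed.

HB.instance Definition _ :=
  GRing.Zmodule_isLmodule.Build R^c D
    dual_scaleA dual_scale1 dual_scaleDr dual_scaleDl.

Definition eval_fun (x : M) (f : D) : (R^c)^o := dual_app f x.

Fact eval_fun_linear x : linear (eval_fun x).
Proof. by []. Qed.

HB.instance Definition _ x :=
  GRing.isLinear.Build R^c D (R^c)^o *:%R (eval_fun x) (eval_fun_linear x).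

End Dual.

(** The canonical map [M -> Hom_{R^c}(Hom_R(M, R), R)].  Its target is a module
    over [(R^c)^c], which has the same operations as [R]. *)
Definition biduality (R : pzRingType) (M : lmodType R) (x : M) :
  dual (dual M) := (eval_fun x : {linear dual M -> (R^c)^o}).

Definition reflexive_module (R : pzRingType) (M : lmodType R) : Prop :=
  bijective (@biduality R M).

Definition Gdim0 (R : pzRingType) (M : lmodType R) : Prop :=
  [/\ fin_gen M, ~ zero_module M, reflexive_module M &
      forall i, (1 <= i)%N ->
        ext_zero i M R^o /\ ext_zero i (dual M) (R^c)^o].

(** Complexes are graded homologically.  The differential carries both indices,
    and vanishes unless [i = j + 1], to avoid transporting along equations
    between integers. *)
Record complex (R : pzRingType) := Complex {
  cx_obj :> int -> lmodType R;
  cx_dif : forall i j, {linear cx_obj i -> cx_obj j};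
  cx_shape : forall i j, i <> j + 1 -> forall x, cx_dif i j x = 0;
  cx_difK : forall i j k x, cx_dif j k (cx_dif i j x) = 0 }.

Arguments cx_dif {R} c i j.

Section Complexes.
Variable R : pzRingType.
Implicit Types X Y : complex R.

Definition cycle X v (x : X v) : Prop := cx_dif X v (v - 1) x = 0.

Definition boundary X v (x : X v) : Prop :=
  exists y : X (v + 1), x = cx_dif X (v + 1) v y.

Definition zero_homology X (v : int) : Prop :=
  forall x : X v, cycle x -> boundary x.

Definition fin_gen_homology X (v : int) : Prop :=
  exists (n : nat) (g : 'I_n -> X v),
    (forall i, cycle (g i)) /\
    (forall x, cycle x ->
       exists c : 'I_n -> R, boundary (x - \sum_i c i *: g i)).

Definition bounded_homology X : Prop :=
  exists n : nat, forall v : int, (n < `|v|)%N -> zero_homology X v.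

Definition bounded X : Prop :=
  exists n : nat, forall v : int, (n < `|v|)%N -> zero_module (X v).

Definition right_bounded X : Prop :=
  exists n : int, forall v : int, v < n -> zero_module (X v).

(** For a chain map [f]: the induced maps in homology are injective and
    surjective. *)
Definition is_quasi_iso X Y (f : forall v, {linear X v -> Y v}) : Prop :=
  forall v : int,
    (forall x : X v, cycle x -> boundary (f v x) -> boundary x) /\
    (forall y : Y v, cycle y -> exists2 x : X v, cycle x & boundary (y - f v x)).

(** The complex [Hom_R(X, Y)]: its component of degree [n] is the product of
    the groups [Hom_R(X_i, Y_(i + n))], and its differential takes [phi] of
    degree [n] to [d phi - (-1)^n phi d]. *)
Definition hom_deg X Y (n : int) : Type :=
  forall i j : int, j = i + n -> {linear X i -> Y j}.

Definition hom_cycle X Y n (phi : hom_deg X Y n) : Prop :=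
  forall i j i' j' (e : j = i + n) (e' : j' = i' + n), i = i' + 1 ->
    forall x : X i,
      cx_dif Y j j' (phi i j e x)
      - (-1) ^+ `|n|%N *: phi i' j' e' (cx_dif X i i' x) = 0.

Definition hom_boundary X Y n (phi : hom_deg X Y n) : Prop :=
  exists psi : hom_deg X Y (n + 1),
    forall i j i' j' (e : j' = i + n) (e1 : j = i + (n + 1))
           (e2 : j' = i' + (n + 1)), i = i' + 1 ->
    forall x : X i,
      phi i j' e x = cx_dif Y j j' (psi i j e1 x)
        - (-1) ^+ `|(n + 1)%R|%N *: psi i' j' e2 (cx_dif X i i' x).

(** [h] is an additive map from a group [S] to the degree [0] cycles of
    [Hom_R(X, Y)]; the induced morphism from [S], viewed as a complex
    concentrated in degree [0], to [Hom_R(X, Y)] is an isomorphism in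
    homology. *)
Definition iso_to_hom X Y (S : zmodType) (h : S -> forall v, X v -> Y v) :
    Prop :=
  [/\ forall n : int, n <> 0 ->
        forall phi : hom_deg X Y n, hom_cycle phi -> hom_boundary phi,
      forall (a : S) (phi : hom_deg X Y 0),
        (forall v e x, phi v v e x = h a v x) -> hom_boundary phi -> a = 0 &
      forall phi : hom_deg X Y 0, hom_cycle phi ->
        exists (a : S) (beta : hom_deg X Y 0), hom_boundary beta /\
          forall v e x, phi v v e x = h a v x + beta v v e x].

End Complexes.

Record bimodule (k : comPzRingType) (A : algType k) := Bimodule {
  bimod_left :> lmodType A;
  ract : bimod_left -> A -> bimod_left;
  ractDl : forall x y a, ract (x + y) a = ract x a + ract y a;
  ractDr : forall x a b, ract x (a + b) = ract x a + ract x b;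
  ractA : forall x a b, ract x (a * b) = ract (ract x a) b;
  ract1 : forall x, ract x 1 = x;
  lractA : forall a x b, a *: ract x b = ract (a *: x) b;
  bimod_central : forall (c : k) x, (c%:A : A) *: x = ract x c%:A }.

Definition bimod_right (k : comPzRingType) (A : algType k) (B : bimodule A) :
  Type := bimod_left B.

Section BimodRight.
Variables (k : comPzRingType) (A : algType k) (B : bimodule A).
Local Notation Br := (bimod_right B).

HB.instance Definition _ := GRing.Zmodule.on Br.

Definition right_scale (a : A^c) (x : Br) : Br := ract (x : B) a.

Fact right_scaleA a b x :
  right_scale a (right_scale b x) = right_scale (a * b) x.
Proof. by rewrite /right_scale -ractA. Qed.
Fact right_scale1 : left_id 1 right_scale.
Proof. by move=> x; exact: ract1. Qed.
Fact right_scaleDr : right_distributive right_scale +%R.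
Proof. by move=> a x y; exact: ractDl. Qed.
Fact right_scaleDl x : {morph right_scale^~ x : a b / a + b}.
Proof. by move=> a b; exact: ractDr. Qed.

HB.instance Definition _ :=
  GRing.Zmodule_isLmodule.Build A^c Br
    right_scaleA right_scale1 right_scaleDr right_scaleDl.

End BimodRight.

Record bimod_hom (k : comPzRingType) (A : algType k) (B C : bimodule A) :=
  BimodHom {
    bimod_fun :> {linear B -> C};
    bimod_fun_ract : forall x a, bimod_fun (ract x a) = ract (bimod_fun x) a }.

Section BimodHomRight.
Variables (k : comPzRingType) (A : algType k) (B C : bimodule A).

Definition right_fun (f : bimod_hom B C) (x : bimod_right B) : bimod_right C :=
  f x.

Fact right_fun_linear f : linear (right_fun f).
Proof.
move=> a x y.
suff : f (ract (x : B) a + (y : B)) = ract (f x) a + f y by [].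
by rewrite -bimod_fun_ract; exact: raddfD.
Qed.

HB.instance Definition _ f :=
  GRing.isLinear.Build A^c (bimod_right B) (bimod_right C) *:%R (right_fun f)
    (right_fun_linear f).

Definition hom_right (f : bimod_hom B C) :
  {linear bimod_right B -> bimod_right C} := right_fun f.

End BimodHomRight.

Record bimod_complex (k : comPzRingType) (A : algType k) := BimodComplex {
  bc_obj :> int -> bimodule A;
  bc_dif : forall i j, bimod_hom (bc_obj i) (bc_obj j);
  bc_shape : forall i j, i <> j + 1 -> forall x, bc_dif i j x = 0;
  bc_difK : forall i j l x, bc_dif j l (bc_dif i j x) = 0 }.

Record bimod_chain_map (k : comPzRingType) (A : algType k)
    (X Y : bimod_complex A) := BimodChainMap {
  bcm_fun :> forall v, bimod_hom (X v) (Y v);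
  bcm_comm : forall i j x,
    bcm_fun j (bc_dif X i j x) = bc_dif Y i j (bcm_fun i x) }.

Section LeftRight.
Variables (k : comPzRingType) (A : algType k).
Implicit Types X Y : bimod_complex A.

Definition left_cx X : complex A :=
  @Complex A (fun v => bimod_left (X v)) (fun i j => bimod_fun (bc_dif X i j))
    (@bc_shape k A X) (@bc_difK k A X).

Definition right_cx X : complex A^c :=
  @Complex A^c (fun v => bimod_right (X v)) (fun i j => hom_right (bc_dif X i j))
    (@bc_shape k A X) (@bc_difK k A X).

(** The homology of a complex of bimodules, as an abelian group, is that of the
    underlying complex of left modules. *)
Definition bimod_quasi_iso X Y (f : bimod_chain_map X Y) : Prop :=
  @is_quasi_iso A (left_cx X) (left_cx Y) (fun v => bimod_fun (f v)).

Definition biprojective X : Prop :=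
  forall v, projective (left_cx X v) /\ projective (right_cx X v).

Definition biinjective X : Prop :=
  forall v, injective_module (left_cx X v) /\ injective_module (right_cx X v).

End LeftRight.

(** Since [dc_P] is a right-bounded complex of bimodules projective on both
    sides, [RHom_A(D, D)] is [Hom_A(dc_P, D)] and [RHom_{A^c}(D, D)] is
    [Hom_{A^c}(dc_P, D)]; the homothety morphisms send [a] to [dc_pi] followed
    by the right, respectively left, multiplication by [a]. *)
Record dualizing_complex (k : comPzRingType) (A : algType k) :=
  DualizingComplex {
    dc_D :> bimod_complex A;
    dc_bounded : bounded_homology (left_cx dc_D);
    dc_fin_gen : forall v, fin_gen_homology (left_cx dc_D) v /\
                           fin_gen_homology (right_cx dc_D) v;
    dc_P : bimod_complex A;
    dc_pi : bimod_chain_map dc_P dc_D;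
    dc_pi_qis : bimod_quasi_iso dc_pi;
    dc_P_bounded : right_bounded (left_cx dc_P);
    dc_P_proj : biprojective dc_P;
    dc_I : bimod_complex A;
    dc_iota : bimod_chain_map dc_D dc_I;
    dc_iota_qis : bimod_quasi_iso dc_iota;
    dc_I_bounded : bounded (left_cx dc_I);
    dc_I_inj : biinjective dc_I;
    dc_homothety_right :
      @iso_to_hom A^c (right_cx dc_P) (right_cx dc_D) A
        (fun a v x => a *: dc_pi v x);
    dc_homothety_left :
      @iso_to_hom A (left_cx dc_P) (left_cx dc_D) A
        (fun a v x => ract (dc_pi v x) a) }.

(* Main.v *)
From HB Require Import structures.
Require Import Defs.
From mathcomp Require Import all_boot all_order all_algebra zify.
From mathcomp Require Import boolp classical_sets.

Set Implicit Arguments.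
Unset Strict Implicit.
Unset Printing Implicit Defensive.

Import GRing.Theory Num.Theory.
Local Open Scope ring_scope.

(** Let [M] satisfy [Ext^i(M, A) = 0] for [i > 0].  It is enough to show that
    every such [M] is torsionless: if [e : M -> G] is given by generators of
    [M*], then [e] is injective and its cokernel satisfies the same hypothesis,
    so reflexivity and the vanishing of [Ext^i(M*, A)] follow by iterating.

    Passing to syzygies of [N], condition (AC) says that [Ext^i(M, N) = 0] for
    [i >> 0] implies [Ext^i(M, N) = 0] for all [i > 0].  Hence if [P -> I] is a
    quasi-isomorphism from a right-bounded complex of projectives to a bounded
    complex of injectives, with finitely generated homology, then [Hom(M, P)] is
    exact in large degrees, uniformly in [M].  An element [t] killed by all maps
    [M -> A] is also killed by all maps [M -> P_v].

    If [A] has a dualizing complex, take [P] and [I] from its definition: duality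
    with respect to [D] makes evaluation identify [M] with the classes of chain
    maps [Hom(M, P) -> I], and evaluation at [t] is zero, so [t = 0].

    If [A] is commutative, let [m] be a maximal ideal containing the annihilator
    of [t], and [E] the injective hull of [A/m].  Some [f : M -> E] has [f t]
    nonzero, and [f M] is killed by powers [x_i^c] of generators of [m].  The
    complex [Hom(K, E)], with [K] the Koszul complex of the [x_i^c], consists of
    injectives, has finitely generated cohomology, and its [0]-cocycles are the
    elements of [E] killed by all [x_i^c].  So [f] lifts through a free module,
    whence [f t = 0], a contradiction. *)

(** * Modules *)

(** The obstacle is finiteness: (AC) tests finitely generated modules only, while the terms of [P],
    of [I] and of [Hom(K, E)] need not be finitely generated; only their homology is. The cone of
    [P -> I] is acyclic with terms injective plus projective, so dimension shifting gives
    [Ext^i(M, Z) = 0] for large [i] on its cycles [Z]; above the range of [I] these are the cycles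
    of [P]. They come within reach of (AC) by being embedded in a projective module with finitely
    generated cokernel: (AC) acts on the cokernel, and the vanishing returns to the cycles one
    degree higher.

    The bound obtained depends only on [P] and [I], not on [M]. This matters because evaluation is
    shown to be surjective by passing repeatedly to syzygies: in very negative degrees [I] vanishes
    wherever [Hom(M, P)] may fail to be exact, so all chain maps are null-homotopic there, and
    degree [n] for [M] follows from degree [n - 1] for a syzygy.

    For commutative [A] no dualizing complex is given. The complex [Hom(K, E)] is adapted to one
    element [t] and one map [f], and is just large enough to contain the image of [f] as
    cocycles. *)

Section Lin.
Variables (R : pzRingType) (U V : lmodType R) (f : U -> V).

(** The ignored argument is the proof of linearity; it lets a linear structure be attached to an
    arbitrary function. *)
Definition lin_fun (_ : linear f) : U -> V := f.

HB.instance Definition _ (fL : linear f) :=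
  GRing.isLinear.Build R U V *:%R (lin_fun fL) fL.

Definition lin (fL : linear f) : {linear U -> V} := lin_fun fL.
End Lin.

Section PairLin.
Variables (R : pzRingType) (U V W : lmodType R).

Fact pair_linear (f : {linear U -> V}) (g : {linear U -> W}) :
  linear (fun x => (f x, g x)).
Proof. by move=> a x y; rewrite !linearP. Qed.

Definition pairl f g : {linear U -> (V * W)%type} := lin (pair_linear f g).

Fact copair_linear (f : {linear U -> W}) (g : {linear V -> W}) :
  linear (fun x : U * V => f x.1 + g x.2).
Proof.
by move=> a x y; rewrite !linearP scalerDr !addrA; congr (_ + _); rewrite addrAC.
Qed.

Definition copairl f g : {linear (U * V)%type -> W} := lin (copair_linear f g).
End PairLin.

(** Submodules are predicates; [smT S] is the submodule [S] as a module. *)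
Record submod (R : pzRingType) (M : lmodType R) := Submod {
  sm_mem :> M -> Prop;
  sm0 : sm_mem 0;
  smD : forall x y, sm_mem x -> sm_mem y -> sm_mem (x + y);
  smZ : forall a x, sm_mem x -> sm_mem (a *: x) }.

Section Submodule.
Variables (R : pzRingType) (M : lmodType R).
Implicit Type S : submod M.

Lemma smN S x : S x -> S (- x).
Proof. by move=> Sx; rewrite -scaleN1r; apply: smZ. Qed.

Lemma smB S x y : S x -> S y -> S (x - y).
Proof. by move=> Sx Sy; apply/smD/smN. Qed.

Lemma sm_sum S n (F : 'I_n -> M) : (forall i, S (F i)) -> S (\sum_i F i).
Proof.
by move=> SF; elim/big_ind: _ => //; [exact: sm0 | exact: smD].
Qed.

Definition smpred S : {pred M} := fun x => `[< S x >].

Fact smpred_closed S : submod_closed (smpred S).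
Proof.
split; first exact/asboolP/sm0.
by move=> a x y /asboolP Sx /asboolP Sy; apply/asboolP/smD => //; apply: smZ.
Qed.

HB.instance Definition _ S :=
  GRing.isSubmodClosed.Build R M (smpred S) (smpred_closed S).

Definition smT S : Type := {x | x \in smpred S}.
HB.instance Definition _ S := SubChoice.on (smT S).
HB.instance Definition _ S := [SubChoice_isSubLmodule of smT S by <:].

Fact smval_linear S : linear (fun x : smT S => \val x).
Proof. by move=> a x y; rewrite linearP. Qed.

Definition smval S : {linear smT S -> M} := lin (@smval_linear S).

Lemma smvalP S (x : smT S) : S (smval S x).
Proof. exact/asboolP/(valP x). Qed.

Lemma smval_inj S : injective (smval S).
Proof. exact: val_inj. Qed.

Lemma smvalK S x : S x -> exists y : smT S, x = smval S y.
Proof. by move=> /asboolP Sx; exists (exist _ x Sx). Qed.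

Definition smfull : submod M := @Submod R M (fun=> True) I (fun _ _ _ _ => I) (fun _ _ _ => I).

End Submodule.

Section KerIm.
Variables (R : pzRingType) (U V : lmodType R) (f : {linear U -> V}).

Definition ker : submod U.
Proof.
refine (@Submod R U (fun x => f x = 0) _ _ _).
- exact: linear0.
- by move=> x y fx fy; rewrite linearD fx fy addr0.
- by move=> a x fx; rewrite linearZ /= fx scaler0.
Defined.

Definition im (S : submod U) : submod V.
Proof.
refine (@Submod R V (fun y => exists2 x, S x & y = f x) _ _ _).
- by exists 0; [exact: sm0 | rewrite linear0].
- move=> _ _ [x Sx ->] [y Sy ->]; exists (x + y); last by rewrite linearD.
  exact: smD.
- move=> a _ [x Sx ->]; exists (a *: x); last by rewrite linearZ.
  exact: smZ.
Defined.

Definition smpreim (S : submod V) : submod U.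
Proof.
refine (@Submod R U (fun x => S (f x)) _ _ _).
- by rewrite linear0; apply: sm0.
- by move=> x y fx fy; rewrite linearD; apply: smD.
- by move=> a x fx; rewrite linearZ; apply: smZ.
Defined.

End KerIm.

(** * Quotient modules *)

Section Quotient.
Variables (R : pzRingType) (M : lmodType R) (S : submod M).

(** Congruent elements define the same set by extensionality, hence the same chosen representative.
    The quotient can therefore be realised as the set of fixed points of [qrep]. *)
Definition qrep (x : M) : M := xget 0 [set y | S (x - y)]%classic.

Lemma qrepP x : S (x - qrep x).
Proof.
rewrite /qrep; case: xgetP => //= /(_ x); rewrite subrr; case; exact: sm0.
Qed.

Lemma qrep_eq x y : qrep x = qrep y <-> S (x - y).
Proof.
split=> [e | Sxy].
  rewrite -(subrK (qrep x) x) {2}e -addrA -(opprB y); apply: smB; exact: qrepP.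
rewrite /qrep; congr xget; apply/funext => z; apply/propext; split=> /= Sz.
  by rewrite -(subrK x y) -addrA; apply: smD => //; rewrite -opprB; apply: smN.
by rewrite -(subrK y x) -addrA; apply: smD.
Qed.

Lemma qrepK x : qrep (qrep x) = qrep x.
Proof. by apply/qrep_eq; rewrite -opprB; apply/smN/qrepP. Qed.

Record quot := Quot { qval : M; _ : qval == qrep qval }.
HB.instance Definition _ := [isSub for qval].
HB.instance Definition _ := [Choice of quot by <:].

Fact qclass_subproof x : qrep x == qrep (qrep x).
Proof. by rewrite qrepK. Qed.
Definition qclass x : quot := Quot (qclass_subproof x).

Lemma qclass_eq x y : qclass x = qclass y <-> S (x - y).
Proof.
rewrite -qrep_eq; split=> [/(congr1 qval) //| e].
exact: val_inj.
Qed.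

Lemma qvalK u : qclass (qval u) = u.
Proof. by apply: val_inj => /=; case: u => x /= /eqP. Qed.

Definition qadd u v := qclass (qval u + qval v).
Definition qopp u := qclass (- qval u).
Definition qscale a u := qclass (a *: qval u).

Lemma qaddE x y : qadd (qclass x) (qclass y) = qclass (x + y).
Proof.
apply/qclass_eq => /=.
rewrite -opprB; apply: smN; rewrite opprD addrACA.
by apply: smD; apply: qrepP.
Qed.
Lemma qoppE x : qopp (qclass x) = qclass (- x).
Proof. by apply/qclass_eq => /=; rewrite opprK addrC; apply: qrepP. Qed.
Lemma qscaleE a x : qscale a (qclass x) = qclass (a *: x).
Proof.
apply/qclass_eq => /=; rewrite -scalerBr -opprB scalerN.
exact/smN/smZ/qrepP.
Qed.

Fact qaddA : associative qadd.
Proof.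
by move=> u v w; rewrite -(qvalK u) -(qvalK v) -(qvalK w) !qaddE addrA.
Qed.
Fact qaddC : commutative qadd.
Proof. by move=> u v; rewrite /qadd addrC. Qed.
Fact qadd0 : left_id (qclass 0) qadd.
Proof. by move=> u; rewrite -(qvalK u) qaddE add0r. Qed.
Fact qaddN : left_inverse (qclass 0) qopp qadd.
Proof. by move=> u; rewrite -(qvalK u) qoppE qaddE addNr. Qed.
HB.instance Definition _ := GRing.isZmodule.Build quot qaddA qaddC qadd0 qaddN.

Lemma qclassD x y : qclass x + qclass y = qclass (x + y).
Proof. exact: qaddE. Qed.

Fact qscaleA a b u : qscale a (qscale b u) = qscale (a * b) u.
Proof. by rewrite -(qvalK u) !qscaleE scalerA. Qed.
Fact qscale1 : left_id 1 qscale.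
Proof. by move=> u; rewrite -(qvalK u) qscaleE scale1r. Qed.
Fact qscaleDr : right_distributive qscale +%R.
Proof.
by move=> a u v; rewrite -(qvalK u) -(qvalK v) qclassD !qscaleE qclassD scalerDr.
Qed.
Fact qscaleDl u : {morph qscale^~ u : a b / a + b}.
Proof. by move=> a b; rewrite -(qvalK u) !qscaleE qclassD scalerDl. Qed.
HB.instance Definition _ :=
  GRing.Zmodule_isLmodule.Build R quot qscaleA qscale1 qscaleDr qscaleDl.

Fact qclass_linear : linear qclass.
Proof. by move=> a x y; rewrite -qclassD -qscaleE. Qed.
Definition qproj : {linear M -> quot} := lin qclass_linear.

Lemma qproj_eq0 x : qproj x = 0 <-> S x.
Proof. by rewrite -[X in S X]subr0; apply: qclass_eq. Qed.

Lemma qproj_surj u : exists x, qproj x = u.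
Proof. by exists (qval u); apply: qvalK. Qed.
End Quotient.

(** * Factoring linear maps; projective and injective modules *)

Section Factor.
Variable R : pzRingType.

Lemma fac_inj (X U V : lmodType R) (j : {linear U -> V}) (f : {linear X -> V}) :
  injective j -> (forall x, exists u, f x = j u) ->
  exists k : {linear X -> U}, forall x, j (k x) = f x.
Proof.
move=> jI /choice[k kE].
have kL : linear k by move=> a x y; apply: jI; rewrite linearP -!kE linearP.
by exists (lin kL) => x; rewrite kE.
Qed.

Lemma fac_surj (U V W : lmodType R) (q : {linear U -> V}) (f : {linear U -> W}) :
  (forall v, exists u, q u = v) -> (forall x, q x = 0 -> f x = 0) ->
  exists g : {linear V -> W}, forall x, g (q x) = f x.
Proof.
move=> /choice[s sK] qf.
have gE x y : q x = q y -> f x = f y.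
  by move=> e; apply/subr0_eq; rewrite -linearB qf // linearB e subrr.
have gL : linear (f \o s).
  by move=> a x y /=; rewrite -linearP; apply: gE; rewrite linearP !sK.
by exists (lin gL) => x; apply: gE; rewrite sK.
Qed.

(** [q] need only reach the image of [f]: corestricting both maps to the image of [q] produces a
    genuine surjection. *)
Lemma proj_fac (P U V : lmodType R) (q : {linear U -> V}) (f : {linear P -> V}) :
  projective P -> (forall x, exists u, q u = f x) ->
  exists h : {linear P -> U}, forall x, q (h x) = f x.
Proof.
move=> Pproj qf; pose S := im q (smfull U).
have [q' q'E] : exists q' : {linear U -> smT S}, forall x, smval S (q' x) = q x.
  by apply: fac_inj; [exact: smval_inj | move=> x; apply: smvalK; exists x].
have [f' f'E] : exists f' : {linear P -> smT S}, forall x, smval S (f' x) = f x.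
  apply: fac_inj; first exact: smval_inj.
  by move=> x; apply: smvalK; have [u <-] := qf x; exists u.
have [|h hE] := Pproj _ _ q' f'.
  move=> v; have [u _ e] := smvalP v.
  by exists u; apply: smval_inj; rewrite q'E e.
by exists h => x; rewrite -q'E hE.
Qed.

(** [u] need not be injective: [f] descends to the image of [u], which does embed in [Y]. *)
Lemma inj_fac (X Y E : lmodType R) (u : {linear X -> Y}) (f : {linear X -> E}) :
  injective_module E -> (forall x, u x = 0 -> f x = 0) ->
  exists h : {linear Y -> E}, forall x, h (u x) = f x.
Proof.
move=> Einj uf; pose S := im u (smfull X).
have [u' u'E] : exists u' : {linear X -> smT S}, forall x, smval S (u' x) = u x.
  by apply: fac_inj; [exact: smval_inj | move=> x; apply: smvalK; exists x].
have [||f' f'E] := @fac_surj _ _ _ u' f.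
- move=> v; have [x _ e] := smvalP v.
  by exists x; apply: smval_inj; rewrite u'E e.
- by move=> x e; apply: uf; rewrite -u'E e linear0.
have [h hE] := Einj _ _ (smval S) f' (@smval_inj _ _ S).
by exists h => x; rewrite -u'E hE f'E.
Qed.

Lemma retract_injective (E J : lmodType R) (i : {linear E -> J})
    (r : {linear J -> E}) :
  cancel i r -> injective_module J -> injective_module E.
Proof.
move=> iK Jinj U V g f gI.
have [h hE] := Jinj _ _ g (i \o f) gI.
by exists (r \o h) => x; rewrite /= hE /= iK.
Qed.

Lemma retract_projective (P Q : lmodType R) (i : {linear P -> Q})
    (r : {linear Q -> P}) :
  cancel i r -> projective Q -> projective P.
Proof.
move=> iK Qproj U V g f gS.
have [h hE] := Qproj _ _ g (f \o r) gS.
by exists (h \o i) => x; rewrite /= hE /= iK.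
Qed.

Lemma prod_injective (E F : lmodType R) :
  injective_module E -> injective_module F -> injective_module (E * F)%type.
Proof.
move=> Einj Finj U V g f gI.
have [h hE] := Einj _ _ g (fst \o f) gI.
have [k kE] := Finj _ _ g (snd \o f) gI.
by exists (pairl h k) => x /=; rewrite /lin_fun hE kE /=; case: (f x).
Qed.

Lemma prod_projective (P Q : lmodType R) :
  projective P -> projective Q -> projective (P * Q)%type.
Proof.
move=> Pproj Qproj U V g f gS.
have fE x : f x = f (x.1, 0) + f (0, x.2).
  by rewrite -linearD; congr (f _); case: x => x y /=; congr pair; rewrite ?addr0 ?add0r.
have i1L : linear (fun x : P => (x, 0 : Q)).
  by move=> a x y; congr pair => /=; rewrite scaler0 addr0.
have i2L : linear (fun x : Q => (0 : P, x)).
  by move=> a x y; congr pair => /=; rewrite scaler0 addr0.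
have [h hE] := Pproj _ _ g (f \o lin i1L) gS.
have [k kE] := Qproj _ _ g (f \o lin i2L) gS.
by exists (copairl h k) => x; rewrite fE linearD /= hE kE.
Qed.

Lemma zero_injective (E : lmodType R) : zero_module E -> injective_module E.
Proof. by move=> E0 U V g f _; exists \0 => x; rewrite [RHS]E0. Qed.

End Factor.

(** * Finite generation *)

Section Rows.
Variables (R : pzRingType) (M : lmodType R).

Fact rowl_linear n (g : 'I_n -> M) :
  linear (fun v : 'rV[R]_n => \sum_i v 0 i *: g i).
Proof.
move=> a x y; rewrite scaler_sumr -big_split; apply: eq_bigr => i _ /=.
by rewrite !mxE scalerDl scalerA.
Qed.

Definition rowl n (g : 'I_n -> M) : {linear 'rV[R]_n -> M} := lin (rowl_linear g).

Lemma rowlE n (f : {linear 'rV[R]_n -> M}) v :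
  f v = rowl (fun i => f (delta_mx 0 i)) v.
Proof.
rewrite {1}(row_sum_delta v) linear_sum; apply: eq_bigr => i _.
by rewrite linearZ.
Qed.

Lemma rowl_delta n (g : 'I_n -> M) i : rowl g (delta_mx 0 i) = g i.
Proof.
rewrite /= /lin_fun (bigD1 i) //= mxE !eqxx scale1r big1 ?addr0 // => j ji.
by rewrite mxE eqxx (negPf ji) scale0r.
Qed.
End Rows.

Lemma row_projective (R : pzRingType) n : projective 'rV[R]_n.
Proof.
move=> U V g f gS.
have [u uE] := choice (fun i => gS (f (delta_mx 0 i))).
exists (rowl u) => v; rewrite (rowlE f) linear_sum; apply: eq_bigr => i _.
by rewrite linearZ uE.
Qed.

Section Span.
Variable R : pzRingType.

(** Recursion on the list replaces indexed sums, so that inductions peel off one generator at a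
    time. *)
Fixpoint lspan (M : lmodType R) (l : seq M) (x : M) : Prop :=
  if l is a :: l' then exists c : R, lspan l' (x - c *: a) else x = 0.

Variable M : lmodType R.
Implicit Types (l : seq M) (S : submod M).

Definition lspan_sm l : submod M.
Proof.
refine (@Submod R M (lspan l) _ _ _).
- by elim: l => //= a l IH; exists 0; rewrite scale0r subr0.
- elim: l => [|a l IH] x y /=; first by move=> -> ->; rewrite addr0.
  move=> [c xc] [d yd]; exists (c + d).
  by rewrite scalerDl opprD addrACA; apply: IH.
- move=> b x; elim: l x => [|a l IH] x /=; first by move=> ->; rewrite scaler0.
  by move=> [c /IH xc]; exists (b * c); rewrite -scalerA -scalerBr.
Defined.

Lemma lspan_cons a l x : lspan l x -> lspan (a :: l) x.
Proof. by exists 0; rewrite scale0r subr0. Qed.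

Lemma mem_lspan l a : a \in l -> lspan l a.
Proof.
elim: l => // b l IH; rewrite inE => /predU1P[-> | /IH]; last exact: lspan_cons.
by exists 1; rewrite scale1r subrr; apply: (sm0 (lspan_sm l)).
Qed.

Lemma lspan_sub S l x : (forall a, a \in l -> S a) -> lspan l x -> S x.
Proof.
elim: l x => [|a l IH] x lS /=; first by move=> ->; apply: sm0.
move=> [c xc]; rewrite -(subrK (c *: a) x); apply: smD.
  by apply: IH xc => b bl; apply: lS; rewrite inE bl orbT.
by apply/smZ/lS; rewrite inE eqxx.
Qed.

Lemma lspan_cat l1 l2 x y : lspan l1 y -> lspan l2 (x - y) -> lspan (l1 ++ l2) x.
Proof.
move=> l1y l2xy; rewrite -(subrK y x); apply: (smD (s := lspan_sm _)).
  by apply: (lspan_sub (S := lspan_sm _)) l2xy => a al; apply: mem_lspan; rewrite mem_cat al orbT.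
by apply: (lspan_sub (S := lspan_sm _)) l1y => a al; apply: mem_lspan; rewrite mem_cat al.
Qed.

Lemma lspan_row l x : lspan l x <-> exists v, x = rowl (fun i : 'I_(size l) => l`_i) v.
Proof.
split=> [|[v ->]]; last first.
  apply: (@sm_sum _ _ (lspan_sm l)) => i.
  by apply/smZ/mem_lspan/mem_nth.
elim: l x => [|a l IH] x /=.
  by move=> ->; exists 0; rewrite [RHS]big_ord0.
move=> [c /IH[v e]]; exists (row_mx c%:M v : 'rV_(1 + size l)).
rewrite /= /lin_fun big_ord_recl -(subrK (c *: a) x) e addrC /=; congr (_ + _).
  by rewrite mxE; case: splitP => [j _|j //]; rewrite ord1 mxE eqxx.
apply: eq_bigr => i _; congr (_ *: _); rewrite mxE.
case: splitP => [j /= e0|j /= [/val_inj ->] //].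
by have := ltn_ord j; rewrite -e0.
Qed.

Definition fg S := exists l, (forall a, a \in l -> S a) /\ forall x, S x -> lspan l x.

(** With [S] the cycles and [B] the boundaries this is finitely generated homology; with [S]
    everything and [B] an image, a finitely generated cokernel. *)
Definition fgm (S B : M -> Prop) := exists l,
  (forall a, a \in l -> S a) /\ forall x, S x -> exists y, lspan l y /\ B (x - y).

Lemma span_codom n (g : 'I_n -> M) (c : 'I_n -> R) :
  lspan (codom g) (\sum_i c i *: g i).
Proof.
by apply: (@sm_sum _ _ (lspan_sm _)) => i; apply/smZ/mem_lspan/codom_f.
Qed.

Lemma lspan_sumE l x : lspan l x -> exists c : 'I_(size l) -> R, x = \sum_i c i *: l`_i.
Proof. by move=> /lspan_row[v ->]; exists (fun i => v 0 i). Qed.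

Lemma fin_genE : fin_gen M <-> fg (smfull M).
Proof.
split=> [[n [g gE]] | [l [_ lE]]].
  exists (codom g); split=> // x _; have [c ->] := gE x; exact: span_codom.
exists (size l), (fun i => l`_i) => x; exact/lspan_sumE/lE.
Qed.

End Span.

Lemma lspan_map (R : pzRingType) (M N : lmodType R) (f : {linear M -> N}) l x :
  lspan l x -> lspan (map f l) (f x).
Proof.
elim: l x => [|a l IH] x /=; first by move=> ->; rewrite linear0.
by move=> [c /IH xc]; exists c; rewrite -linearZ -linearB.
Qed.

Lemma lspan_mapE (R : pzRingType) (M N : lmodType R) (f : {linear M -> N}) l y :
  lspan (map f l) y -> exists2 x, lspan l x & y = f x.
Proof.
elim: l y => [|a l IH] y /=; first by move=> ->; exists 0; rewrite ?linear0.
move=> [c /IH[x lx e]]; exists (x + c *: a).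
  by exists c; rewrite addrK.
by rewrite linearD linearZ /= -e subrK.
Qed.

Lemma seq_choice (X Y : eqType) (y0 : Y) (P : X -> Y -> Prop) (l : seq X) :
  (forall a, a \in l -> exists b, P a b) ->
  exists f : X -> Y, forall a, a \in l -> P a (f a).
Proof.
move=> H; have /choice[f fE] : forall a, exists b, a \in l -> P a b.
  move=> a; case: (boolP (a \in l)) => [/H[b]|_]; first by exists b.
  by exists y0.
by exists f.
Qed.

Section Noetherian.
Variable R : pzRingType.

Definition noeth (M : lmodType R) := forall S : submod M, fg S.

Lemma left_noetherianE : left_noetherian R -> noeth R^o.
Proof.
move=> Rn S; have [|n [g [gS gE]]] := Rn (sm_mem S).
  by split; [exact: sm0 | exact: (smD (s := S)) | exact: (smZ (s := S))].
exists (codom g : seq R^o); split; first by move=> a /codomP[i ->].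
by move=> x /gE[c ->]; exact: (@span_codom R R^o).
Qed.

Hypothesis Rn : noeth R^o.

(** Induction on [l]. The coefficients of the head [a] in elements of [S] form a left ideal [J].
    Elements of [S] realising generators of [J], together with generators of the part of [S] inside
    the span of the tail, generate [S]. *)
Lemma noeth_span (M : lmodType R) (l : seq M) (S : submod M) :
  (forall x, S x -> lspan l x) -> fg S.
Proof.
elim: l S => [|a l IH] S Sl.
  by exists [::]; split=> // x /Sl.
have [J JE] : exists J : submod R^o, forall c : R, J c <-> exists2 s, S s & lspan l (s - c *: a).
  unshelve eexists (@Submod R R^o (fun c : R => exists2 s, S s & lspan l (s - c *: a)) _ _ _) => //.
  - by exists 0; [exact: sm0 | rewrite scale0r subr0; exact: (sm0 (lspan_sm l))].
  - move=> c d [s Ss sc] [t St td]; exists (s + t); first exact: smD.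
    by rewrite scalerDl opprD addrACA; exact: (smD (s := lspan_sm l)).
  move=> b c [s Ss sc]; exists (b *: s); first exact: smZ.
  by rewrite -scalerA -scalerBr; exact: (smZ (s := lspan_sm l)).
have [m [mJ mE]] := Rn J.
have [s sE] : exists s : R^o -> M, forall c : R, c \in m -> S (s c) /\ lspan l (s c - c *: a).
  apply: (@seq_choice R^o M 0 (fun c t => S t /\ lspan l (t - (c : R) *: a))).
  by move=> c /mJ/JE[t St tc]; exists t.
pose S' := @Submod R M (fun x => S x /\ lspan l x)
  (conj (sm0 S) (sm0 (lspan_sm l)))
  (fun x y Sx Sy => conj (smD Sx.1 Sy.1) (smD (s := lspan_sm l) Sx.2 Sy.2))
  (fun b x Sx => conj (smZ b Sx.1) (smZ (s := lspan_sm l) b Sx.2)).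
have [l' [l'S l'E]] := IH S' (fun x Sx => Sx.2).
have sS b : b \in map s m -> S b by move=> /mapP[c /sE[? _] ->].
exists (map s m ++ l'); split.
  by move=> b; rewrite mem_cat => /orP[/sS //|/l'S[]].
move=> x Sx; have /= [c xc] := Sl x Sx.
(* The combination of [m] that produces [c], transported to the chosen elements of [S]. *)
have [y my yc] : exists2 y, lspan (map s m) y & lspan l (y - c *: a).
  have : lspan m (c : R^o) by apply/mE/JE; exists x.
  elim: (m) (c : R^o) sE => [|d m' IHm] {xc}c sE' /=.
    by move=> ->; exists 0 => //; rewrite scale0r subr0; exact: (sm0 (lspan_sm l)).
  move=> [e]; set c' : R := c - e *: d => /IHm[|y my yc].
    by move=> b bm; apply: sE'; rewrite inE bm orbT.
  exists (y + e *: s d); first by exists e; rewrite addrK.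
  have -> : y + e *: s d - (c : R) *: a = (y - c' *: a) + e *: (s d - (d : R) *: a).
    have -> : (c : R) = c' + e * d by rewrite /c' subrK.
    by rewrite scalerDl scalerBr scalerA opprD addrACA.
  apply: (smD (s := lspan_sm l)) => //; apply: (smZ (s := lspan_sm l)).
  by case: (sE' d); rewrite ?inE ?eqxx.
apply: (lspan_cat my); apply: l'E; split.
  by apply: smB => //; apply: lspan_sub my.
have -> : x - y = (x - c *: a) - (y - c *: a) by rewrite opprB addrA subrK.
by apply: (smB (S := lspan_sm l)).
Qed.

Lemma fin_gen_noeth (M : lmodType R) : fin_gen M -> noeth M.
Proof.
move=> /fin_genE[l [_ lE]] S; apply: (@noeth_span _ l) => x _; exact: lE.
Qed.

Lemma fg_sub (M : lmodType R) (S T : submod M) :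
  fg T -> (forall x, S x -> T x) -> fg S.
Proof. by move=> [l [_ lE]] ST; apply: (@noeth_span _ l) => x /ST/lE. Qed.

Lemma fg_smT (M : lmodType R) (S : submod M) : fg S <-> fin_gen (smT S).
Proof.
split=> [[l [lS lE]] | /fin_genE[l [_ lE]]].
  have [g gE] : exists g : M -> smT S, forall a, a \in l -> smval S (g a) = a.
    apply: (@seq_choice M (smT S) 0 (fun a b => smval S b = a)).
    by move=> a /lS /smvalK[y ->]; exists y.
  apply/fin_genE; exists (map g l); split=> // x _.
  have /lE : S (smval S x) by apply: smvalP.
  have {1}-> : l = map (smval S) (map g l).
    by rewrite -map_comp map_id_in // => a /gE.
  by move=> /lspan_mapE[y ly /smval_inj ->].
exists (map (smval S) l); split; first by move=> _ /mapP[y _ ->]; apply: smvalP.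
move=> x /smvalK[y ->]; exact/lspan_map/lE.
Qed.

(** Containment in finitely generated [K] and [T] is enough, since their submodules are again
    finitely generated. *)
Lemma fg_ext (M N : lmodType R) (f : {linear M -> N}) (S K : submod M) (T : submod N) :
  (forall x, S x -> f x = 0 -> K x) -> fg K ->
  (forall x, S x -> T (f x)) -> fg T -> fg S.
Proof.
move=> SK Kfg ST Tfg.
have [l [lT lE]] : fg (im f S) by apply: fg_sub Tfg _ => _ [x Sx ->]; apply: ST.
have [g gE] : exists g : N -> M, forall a, a \in l -> S (g a) /\ f (g a) = a.
  apply: (@seq_choice N M 0 (fun a b => S b /\ f b = a)).
  by move=> a /lT [x Sx ->]; exists x.
pose S0 := @Submod R M (fun x => S x /\ f x = 0)
  (conj (sm0 S) (sm0 (ker f)))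
  (fun x y Sx Sy => conj (smD Sx.1 Sy.1) (smD (s := ker f) Sx.2 Sy.2))
  (fun b x Sx => conj (smZ b Sx.1) (smZ (s := ker f) b Sx.2)).
have [m [mS mE]] : fg S0 by apply: fg_sub Kfg _ => x [/SK]; apply.
have gS a : a \in map g l -> S a by move=> /mapP[b /gE[? _] ->].
exists (map g l ++ m); split=> [a|x Sx].
  by rewrite mem_cat => /orP[/gS|/mS[]].
have : lspan l (f x) by apply: lE; exists x.
have {1}-> : l = map f (map g l).
  by rewrite -map_comp map_id_in // => a /gE[].
move=> /lspan_mapE[y ly e].
apply: (lspan_cat ly); apply: mE; split; last by rewrite linearB e subrr.
by apply: smB => //; apply: lspan_sub ly.
Qed.

End Noetherian.

(** * Projective resolutions and Ext *)

Section Resolutions.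
Variable R : pzRingType.

Lemma fin_gen_cover (M : lmodType R) : fin_gen M ->
  exists n (p : {linear 'rV[R]_n -> M}), forall x, exists v, p v = x.
Proof.
move=> [n [g gE]]; exists n, (rowl g) => x; have [c ->] := gE x.
by exists (\row_i c i); apply: eq_bigr => i _; rewrite mxE.
Qed.

Definition fg_module := {M : lmodType R | fin_gen M}.

Section FreeResolution.
Hypothesis Rn : noeth R^o.

Definition cover_rank (K : fg_module) : nat := projT1 (cid (fin_gen_cover (projT2 K))).
Definition cover_map (K : fg_module) : {linear 'rV[R]_(cover_rank K) -> projT1 K} :=
  projT1 (cid (projT2 (cid (fin_gen_cover (projT2 K))))).
Lemma cover_surj (K : fg_module) x : exists v, cover_map K v = x.
Proof. exact: (projT2 (cid (projT2 (cid (fin_gen_cover (projT2 K)))))). Qed.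

Lemma row_fin_gen n : @fin_gen R 'rV[R]_n.
Proof.
exists n, (fun i => delta_mx 0 i) => v; exists (fun i => v 0 i).
exact: row_sum_delta.
Qed.

Definition next_syzygy (K : fg_module) : fg_module :=
  exist _ (smT (ker (cover_map K)) : lmodType R)
    ((fg_smT (ker (cover_map K))).1 (fin_gen_noeth Rn (row_fin_gen _) (ker (cover_map K)))).

Variable M : lmodType R.
Hypothesis Mfg : fin_gen M.

Definition syzygy (i : nat) : fg_module := iter i next_syzygy (exist _ M Mfg).

Definition free_dif (i : nat) :
    {linear 'rV[R]_(cover_rank (syzygy i.+1)) -> 'rV[R]_(cover_rank (syzygy i))} :=
  smval (ker (cover_map (syzygy i))) \o cover_map (syzygy i.+1).

Definition free_resolution : proj_resolution M.
Proof.
refine (@ProjResolution R M (fun i => 'rV[R]_(cover_rank (syzygy i)) : lmodType R)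
  free_dif (cover_map (syzygy 0)) _ _ _ _).
- by move=> n; apply: row_projective.
- exact: cover_surj (syzygy 0).
- move=> x; split=> [|[y ->]]; last exact: smvalP (cover_map (syzygy 1) y).
  move=> /(smvalK (S := ker (cover_map (syzygy 0))))[y ->].
  by have [v <-] := @cover_surj (syzygy 1) y; exists v.
- move=> n x; split=> [|[y ->]]; last first.
    by have := smvalP (cover_map (syzygy n.+2) y); rewrite /= => ->; rewrite linear0.
  rewrite -[X in _ = X](linear0 (smval (ker (cover_map (syzygy n))))).
  move=> /smval_inj /(smvalK (S := ker (cover_map (syzygy n.+1))))[y ->].
  by have [v <-] := @cover_surj (syzygy n.+2) y; exists v.
Defined.

Lemma free_resolution_fin_gen i : fin_gen (free_resolution i).
Proof. exact: row_fin_gen. Qed.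
End FreeResolution.

Section Splice.
Variables (K F M : lmodType R) (j : {linear K -> F}) (p : {linear F -> M}).
Hypotheses (Fproj : projective F) (j_inj : injective j)
  (p_surj : forall m, exists x, p x = m)
  (jp_exact : forall x, p x = 0 <-> exists y, x = j y).
Variable P : proj_resolution K.

Definition splice_obj (i : nat) : lmodType R := if i is i'.+1 then P i' else F.
Definition splice_dif (i : nat) : {linear splice_obj i.+1 -> splice_obj i} :=
  match i with
  | 0 => j \o res_aug P
  | i'.+1 => res_dif P i'
  end.

(** Dimension shifting: with this resolution, cocycles and coboundaries of [M] in degree [i.+2] are
    literally those of [K] in degree [i.+1]. *)
Definition splice : proj_resolution M.
Proof.
refine (@ProjResolution R M splice_obj splice_dif p _ p_surj _ _).
- by case=> [|n] //=; apply: res_projective.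
- move=> x; split=> [/jp_exact[y ->]|[y ->]]; last by apply/jp_exact; exists (res_aug P y).
  by have [z <-] := res_aug_surj P y; exists z.
- case=> [|n] x /=; last exact: res_exact.
  rewrite -[X in _ = X](linear0 j); split=> [/j_inj/res_exact0 //|].
  by move=> /res_exact0 ->.
Defined.
End Splice.

Lemma res_difK (M : lmodType R) (P : proj_resolution M) i x :
  res_dif P i (res_dif P i.+1 x) = 0.
Proof. by apply/res_exact; exists x. Qed.

Lemma res_aug_dif (M : lmodType R) (P : proj_resolution M) x :
  res_aug P (res_dif P 0 x) = 0.
Proof. by apply/res_exact0; exists x. Qed.

(** * Independence of Ext from the resolution *)

Section Comparison.
Variables (M : lmodType R) (P Q : proj_resolution M).

Definition liftable i (a : {linear P i -> Q i}) :=
  forall x, exists y, a (res_dif P i x) = res_dif Q i y.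

Lemma comparison : exists a : forall i, {linear P i -> Q i},
  (forall x, res_aug Q (a 0 x) = res_aug P x) /\
  forall i x, res_dif Q i (a i.+1 x) = a i (res_dif P i x).
Proof.
have [a0 a0E] := proj_fac (@res_projective _ _ P 0) (fun x => res_aug_surj Q (res_aug P x)).
have a0L : liftable a0.
  by move=> x; apply/res_exact0; rewrite a0E; apply: res_aug_dif.
have step i (a : {a : {linear P i -> Q i} | liftable a}) :
    {b : {linear P i.+1 -> Q i.+1} | liftable b /\
       forall x, res_dif Q i (b x) = projT1 a (res_dif P i x)}.
  apply: cid; case: a => a aL /=.
  have aL' (x : P i.+1) : exists y, res_dif Q i y = (a \o res_dif P i) x.
    by have [y /= ->] := aL x; exists y.
  have [b bE] := proj_fac (@res_projective _ _ P i.+1) aL'.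
  exists b; split=> // x; apply/res_exact; rewrite bE /= res_difK.
  exact: linear0.
pose g := nat_rect (fun i => {a : {linear P i -> Q i} | liftable a}) (exist _ a0 a0L)
  (fun i a => exist _ (projT1 (step i a)) (projT2 (step i a)).1).
exists (fun i => projT1 (g i)); split=> // i x.
exact: (projT2 (step i (g i))).2.
Qed.
End Comparison.

(** The pairs [h], [k] for different [i] need not be related: comparing Ext in a positive degree
    looks at one degree at a time. *)
Lemma homotopy (M : lmodType R) (P : proj_resolution M)
    (c : forall i, {linear P i -> P i}) :
  (forall x, res_aug P (c 0 x) = 0) ->
  (forall i x, res_dif P i (c i.+1 x) = c i (res_dif P i x)) ->
  forall i, exists (h : {linear P i.+1 -> P i.+2}) (k : {linear P i -> P i.+1}),
    forall x, c i.+1 x = res_dif P i.+1 (h x) + k (res_dif P i x).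
Proof.
move=> c0 cd i; suff : exists k : {linear P i -> P i.+1},
    forall x, res_dif P i (c i.+1 x - k (res_dif P i x)) = 0.
  move=> [k kE]; have kE' x : exists y, res_dif P i.+1 y = (c i.+1 \- (k \o res_dif P i)) x.
    by have /res_exact[y e] := kE x; exists y.
  have [h hE] := proj_fac (@res_projective _ _ P i.+1) kE'.
  by exists h, k => x; rewrite hE /= subrK.
elim: i => [|i [k kE]].
  have c0' x : exists y, res_dif P 0 y = c 0 x.
    by have /res_exact0[y e] := c0 x; exists y.
  have [k kE] := proj_fac (@res_projective _ _ P 0) c0'.
  by exists k => x; rewrite linearB kE cd subrr.
have kE' x : exists y, res_dif P i.+1 y = (c i.+1 \- (k \o res_dif P i)) x.
  by have /res_exact[y e] := kE x; exists y.
have [h hE] := proj_fac (@res_projective _ _ P i.+1) kE'.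
exists h => x; rewrite linearB cd hE /= res_difK linear0 subr0.
exact: subrr.
Qed.

(** Vanishing tested on a given resolution, where [ext_zero] asks for some resolution; [ext_zeroE]
    identifies the two in positive degrees. *)
Definition ext_van (M : lmodType R) (P : proj_resolution M) i (N : lmodType R) :=
  forall f : {linear P i -> N}, ext_cocycle f -> ext_coboundary f.

Lemma ext_van_indep (M : lmodType R) (P Q : proj_resolution M) i (N : lmodType R) :
  ext_van P i.+1 N -> ext_van Q i.+1 N.
Proof.
move=> PN f fc.
have [a [a0 ad]] := comparison P Q; have [b [b0 bd]] := comparison Q P.
have [|g gE] := PN (f \o a i.+1).
  by move=> x /=; rewrite -ad; apply: fc.
(* Both [a \o b] and the identity of [Q] lift the identity of [M], so they differ by a homotopy; the
   cocycle [f] kills its part through [h]. *)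
have [||h [k hkE]] := @homotopy M Q (fun i => idfun \- (a i \o b i)) _ _ i.
- by move=> x; rewrite /= linearB a0 b0 subrr.
- by move=> n x; rewrite /= linearB ad bd.
exists ((f \o k) \+ (g \o b i)) => x /=.
have := hkE x => /(congr1 f) /=.
rewrite linearB linearD fc add0r => /eqP; rewrite subr_eq => /eqP ->.
by congr (_ + _); have /= -> := gE (b i.+1 x); rewrite bd.
Qed.

Lemma ext_zeroE (M : lmodType R) (P : proj_resolution M) i (N : lmodType R) :
  ext_zero i.+1 M N <-> ext_van P i.+1 N.
Proof.
by split=> [[Q]|PN]; [exact: ext_van_indep | exists P].
Qed.

Definition sexact (N' N N'' : lmodType R) (j : {linear N' -> N}) (q : {linear N -> N''}) :=
  [/\ injective j, forall y, exists x, q x = y &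
      forall x, q x = 0 <-> exists y, x = j y].

Lemma sexact_ker (U V : lmodType R) (q : {linear U -> V}) :
  (forall y, exists x, q x = y) -> sexact (smval (ker q)) q.
Proof.
move=> qS; split=> //; first exact: smval_inj.
by move=> x; split=> [/(smvalK (S := ker q)) //|[y ->]]; exact: smvalP y.
Qed.

(** * The long exact sequence in the second argument *)

Section LongExact.
Variables (M : lmodType R) (P : proj_resolution M).
Variables (N' N N'' : lmodType R) (j : {linear N' -> N}) (q : {linear N -> N''}).
Hypothesis jq : sexact j q.
Local Notation E := (ext_van P).

Let fac_j (X : lmodType R) (f : {linear X -> N}) : (forall x, q (f x) = 0) ->
  exists k : {linear X -> N'}, forall x, j (k x) = f x.
Proof. by case: jq => jI _ jE qf; apply: fac_inj => // x; apply/jE. Qed.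

Let lift_q i (f : {linear P i -> N''}) : exists g : {linear P i -> N}, forall x, q (g x) = f x.
Proof. by case: jq => _ qS _; apply: proj_fac => //; apply: res_projective. Qed.

Let qj0 x : q (j x) = 0.
Proof. by case: jq => _ _ jE; apply/jE; exists x. Qed.

Let jI : injective j.
Proof. by case: jq. Qed.

Lemma ext_right i : E i.+1 N -> E i.+2 N' -> E i.+1 N''.
Proof.
move=> E0 E' f fc; have [F FE] := lift_q f.
have [|g' g'E] := fac_j (f := F \o res_dif P i.+1).
  by move=> x /=; rewrite FE fc.
have [|k kE] := E' g'.
  by move=> x; apply: jI; rewrite g'E /= res_difK !linear0.
have [|l lE] := E0 (F \- (j \o k)).
  by move=> x /=; rewrite -kE g'E subrr.
exists (q \o l) => x /=; rewrite -lE /= linearB FE qj0 subr0 //.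
Qed.

Lemma ext_left i : E i.+1 N'' -> E i.+2 N -> E i.+2 N'.
Proof.
move=> E'' E0 f fc.
have [|g gE] := E0 (j \o f); first by move=> x /=; rewrite fc linear0.
have [|l lE] := E'' (q \o g).
  by move=> x /=; rewrite -gE /= qj0.
have [L LE] := lift_q l.
have [|k kE] := fac_j (f := g \- (L \o res_dif P i)).
  by move=> x /=; rewrite linearB LE -lE /= subrr.
exists k => x; apply: jI; rewrite kE /= res_difK linear0 subr0.
exact: gE.
Qed.

(** A lift [G] of [f] to [P 0] fails to descend to [M] by a cocycle with values in [N']; subtracting
    a primitive of that cocycle repairs it. *)
Lemma ext1_lift (f : {linear M -> N''}) : E 1 N' ->
  exists g : {linear M -> N}, forall x, q (g x) = f x.
Proof.
move=> E'; have [G GE] := lift_q (f \o res_aug P).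
have [|k kE] := fac_j (f := G \o res_dif P 0).
  by move=> x /=; rewrite GE /= res_aug_dif linear0.
have [|l lE] := E' k.
  by move=> x; apply: jI; rewrite kE /= res_difK !linear0.
have [||g gE] := @fac_surj _ _ _ _ (res_aug P) (G \- (j \o l)).
- exact: res_aug_surj.
- by move=> _ /res_exact0[x ->] /=; rewrite -lE kE subrr.
exists g => x; have [y <-] := res_aug_surj P x.
by rewrite gE /= linearB GE qj0 subr0.
Qed.

End LongExact.

Section Vanishing.
Variables (M : lmodType R) (P : proj_resolution M).
Local Notation E := (ext_van P).

Lemma ext_injective i (N : lmodType R) : injective_module N -> E i.+1 N.
Proof.
move=> Ninj f fc; have [|g gE] := inj_fac (u := res_dif P i) (f := f) Ninj.
  by move=> _ /res_exact[x ->]; apply: fc.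
by exists g => x; rewrite gE.
Qed.

Lemma ext_retract i (N L : lmodType R) (s : {linear N -> L}) (r : {linear L -> N}) :
  cancel s r -> E i.+1 L -> E i.+1 N.
Proof.
move=> sK EL f fc; have [|g gE] := EL (s \o f).
  by move=> x /=; rewrite fc linear0.
by exists (r \o g) => x /=; rewrite -gE /= sK.
Qed.

Lemma ext_prod i (N L : lmodType R) : E i.+1 N -> E i.+1 L -> E i.+1 (N * L)%type.
Proof.
move=> EN EL f fc.
have [|g gE] := EN (fst \o f); first by move=> x /=; rewrite fc.
have [|h hE] := EL (snd \o f); first by move=> x /=; rewrite fc.
exists (pairl g h) => x; rewrite [LHS]surjective_pairing.
by congr pair; [apply: gE | apply: hE].
Qed.

Lemma ext_zero_module i (N : lmodType R) : zero_module N -> E i N.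
Proof.
move=> N0 f _; case: i f => [|i] f /=; first by move=> x; apply: N0.
by exists \0 => x; apply: N0.
Qed.

Lemma ext_row i n : E i.+1 R^o -> E i.+1 'rV[R]_n.
Proof.
move=> ER f fc.
have cL j : linear (fun v : 'rV[R]_n => v 0 j : R^o) by move=> a x y; rewrite !mxE.
have /choice[g gE] (j : 'I_n) : exists g : {linear P i -> R^o},
    forall x, (f x) 0 j = g (res_dif P i x).
  have [|g gE] := ER (lin (cL j) \o f); last by exists g.
  by move=> x /=; rewrite fc linear0.
have gL : linear (fun x => \row_j (g j x : R)).
  by move=> a x y; apply/rowP => j; rewrite !mxE linearP.
by exists (lin gL) => x; apply/rowP => j; rewrite mxE gE.
Qed.

End Vanishing.

End Resolutions.

(** * Maps into projective modules *)

Section FreeModule.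
Variables (R : pzRingType) (X : choiceType).

(** All functions, because their operations are pointwise; the free module on [X] is the submodule
    [finsupp] below. *)
Definition ffree : Type := X -> R.
HB.instance Definition _ := gen_eqMixin ffree.
HB.instance Definition _ := gen_choiceMixin ffree.

Fact ffree_addA : associative (fun (f g : ffree) x => f x + g x : R).
Proof. by move=> f g h; apply/funext => x; apply: addrA. Qed.
Fact ffree_addC : commutative (fun (f g : ffree) x => f x + g x : R).
Proof. by move=> f g; apply/funext => x; apply: addrC. Qed.
Fact ffree_add0 : left_id (fun=> 0 : R) (fun (f g : ffree) x => f x + g x : R).
Proof. by move=> f; apply/funext => x; apply: add0r. Qed.
Fact ffree_addN : left_inverse (fun=> 0 : R) (fun (f : ffree) x => - f x : R)
  (fun (f g : ffree) x => f x + g x : R).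
Proof. by move=> f; apply/funext => x; apply: addNr. Qed.
HB.instance Definition _ :=
  GRing.isZmodule.Build ffree ffree_addA ffree_addC ffree_add0 ffree_addN.

Definition ffree_scale (a : R) (f : ffree) : ffree := fun x => a * f x.
Fact ffree_scaleA a b f : ffree_scale a (ffree_scale b f) = ffree_scale (a * b) f.
Proof. by apply/funext => x; apply: mulrA. Qed.
Fact ffree_scale1 : left_id 1 ffree_scale.
Proof. by move=> f; apply/funext => x; apply: mul1r. Qed.
Fact ffree_scaleDr : right_distributive ffree_scale +%R.
Proof. by move=> a f g; apply/funext => x; apply: mulrDr. Qed.
Fact ffree_scaleDl f : {morph ffree_scale^~ f : a b / a + b}.
Proof. by move=> a b; apply/funext => x; apply: mulrDl. Qed.
HB.instance Definition _ :=
  GRing.Zmodule_isLmodule.Build R ffree ffree_scaleA ffree_scale1 ffree_scaleDr ffree_scaleDl.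

Definition supported (s : seq X) : submod ffree.
Proof.
refine (@Submod R ffree (fun f => forall x, x \notin s -> f x = 0) _ _ _) => //.
- by move=> f g f0 g0 x xs; rewrite -[LHS]/(f x + g x) f0 ?g0 ?addr0.
- by move=> a f f0 x xs; rewrite -[LHS]/(a * f x) f0 ?mulr0.
Defined.

Lemma supported_sub s t f : {subset s <= t} -> supported s f -> supported t f.
Proof. by move=> st sf x xt; apply: sf; apply: contra xt => /st. Qed.

Definition finsupp : submod ffree.
Proof.
refine (@Submod R ffree (fun f => exists s, supported s f) _ _ _).
- by exists [::].
- move=> f g [s sf] [t tg]; exists (s ++ t); apply: smD.
    by apply: supported_sub sf => x xs; rewrite mem_cat xs.
  by apply: supported_sub tg => x xs; rewrite mem_cat xs orbT.
- by move=> a f [s sf]; exists s; apply: smZ.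
Defined.
End FreeModule.
Arguments supported {R X} s.

Section ProjectiveFactor.
Variables (R : pzRingType) (M : lmodType R).
Local Notation Phi := (ffree R M).

Definition evalsum (s : seq M) (f : Phi) : M := \sum_(x <- s) f x *: x.

Lemma evalsum_sub s t (f : Phi) : uniq s -> uniq t -> {subset s <= t} ->
  supported s f -> evalsum s f = evalsum t f.
Proof.
move=> us ut st sf; rewrite /evalsum.
rewrite [RHS](bigID (mem s)) /= [X in _ + X]big1 ?addr0; last first.
  by move=> x /sf ->; rewrite scale0r.
rewrite -[RHS]big_filter; apply: perm_big; apply: uniq_perm => //.
  exact: filter_uniq.
move=> x; rewrite mem_filter; apply/idP/andP => [xs|[]] //.
by split=> //; apply: st.
Qed.

Lemma evalsum_eq s t (f : Phi) : uniq s -> uniq t ->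
  supported s f -> supported t f -> evalsum s f = evalsum t f.
Proof.
move=> us ut sf tf; pose w := undup (s ++ t).
rewrite (@evalsum_sub s w) ?(@evalsum_sub t w) ?undup_uniq // => x xs;
  by rewrite mem_undup mem_cat xs ?orbT.
Qed.

Lemma free_cover : exists e : {linear smT (finsupp R M) -> M},
  (forall x, exists f, e f = x) /\
  forall s f, uniq s -> supported s (smval _ f) -> e f = evalsum s (smval _ f).
Proof.
have H (f : smT (finsupp R M)) : exists s, uniq s /\ supported s (smval _ f).
  have [s sf] := smvalP f; exists (undup s); split; first exact: undup_uniq.
  by apply: supported_sub sf => x; rewrite mem_undup.
have [s sE] := choice H.
have eL : linear (fun f => evalsum (s f) (smval _ f)).
  move=> a f g; pose w := undup (s f ++ s g ++ s (a *: f + g)).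
  have wu : uniq w by apply: undup_uniq.
  have E (h : smT (finsupp R M)) : {subset s h <= w} ->
      evalsum (s h) (smval _ h) = evalsum w (smval _ h).
    by move=> hw; have [us sh] := sE h; apply: evalsum_sub.
  rewrite !E; first last.
  - by move=> x xs; rewrite mem_undup !mem_cat xs !orbT.
  - by move=> x xs; rewrite mem_undup !mem_cat xs.
  - by move=> x xs; rewrite mem_undup !mem_cat xs !orbT.
  rewrite /evalsum scaler_sumr -big_split; apply: eq_bigr => x _ /=.
  by rewrite linearP -[(_ + _ : Phi) x]/(a * smval _ f x + smval _ g x) scalerDl scalerA.
exists (lin eL); split; last first.
  by move=> t f ut tf; have [us sf] := sE f; apply: evalsum_eq.
move=> x; have fS : finsupp R M (fun y => (y == x)%:R : R).
  by exists [:: x] => y; rewrite inE => /negPf ->.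
have [f fE] := smvalK fS; exists f; have [us sf] := sE f.
have fx : supported [:: x] (smval _ f).
  by rewrite -fE => y; rewrite inE => /negPf ->.
change (evalsum (s f) (smval _ f) = x).
rewrite (@evalsum_eq _ [:: x]) // /evalsum big_seq1 -fE.
by rewrite eqxx scale1r.
Qed.

(** A section of the free cover of [M] sends the finitely generated image of [f] to functions
    supported on one finite list, which span a free module of finite rank. As [f1 x] is computed
    from [f x], it vanishes with it. *)
Lemma projective_factor (L : lmodType R) (f : {linear L -> M}) :
  projective M -> fin_gen L ->
  exists n (f1 : {linear L -> 'rV[R]_n}) (f2 : {linear 'rV[R]_n -> M}),
    (forall x, f x = f2 (f1 x)) /\ (forall x, f x = 0 -> f1 x = 0).
Proof.
move=> Mproj /fin_genE[l [_ lE]]; have [e [eS eE]] := free_cover.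
have [t tE] := proj_fac (f := idfun) Mproj eS.
have [s [us sl]] : exists s, uniq s /\ forall x, x \in l -> supported s (smval _ (t (f x))).
  elim: (l) => [|a l' [s [us sl]]]; first by exists [::].
  have [s' s'a] := smvalP (t (f a)); exists (undup (s' ++ s)); split.
    exact: undup_uniq.
  move=> x; rewrite inE => /predU1P[->|/sl xs]; [apply: supported_sub s'a | apply: supported_sub xs];
    by move=> y ys; rewrite mem_undup mem_cat ys ?orbT.
have sx x : supported s (smval _ (t (f x))).
  have /= := lspan_sub (l := l) (x := x)
    (S := smpreim (smval (finsupp R M) \o (t \o f)) (supported (R := R) s)).
  by apply => //; apply: lE.
have f1L : linear (fun x => \row_(i < size s) smval _ (t (f x)) s`_i).
  move=> a x y; apply/rowP => i; rewrite !mxE !linearP.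
  by rewrite -[(_ + _ : Phi) _]/(a * smval _ (t (f x)) _ + smval _ (t (f y)) _).
exists (size s), (lin f1L), (rowl (fun i : 'I_(size s) => s`_i)); split=> x; last first.
  by move=> fx0; apply/rowP => i; rewrite !mxE fx0 !linear0.
rewrite -[LHS]tE (eE s) // /evalsum (big_nth 0) big_mkord.
by apply: eq_bigr => i _; rewrite mxE.
Qed.
End ProjectiveFactor.

Section ExtProjective.
Variables (R : pzRingType) (M : lmodType R) (P : proj_resolution M).
Hypothesis Pfg : forall i, fin_gen (P i).

(** [N] may be infinitely generated: the cocycle factors through a finite free module, and [f1] is
    again a cocycle because it vanishes where [f] does. *)
Lemma ext_projective i (N : lmodType R) :
  ext_van P i.+1 R^o -> projective N -> ext_van P i.+1 N.
Proof.
move=> ER Nproj f fc.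
have [n [f1 [f2 [fE f1E]]]] := projective_factor f Nproj (Pfg i.+1).
have [|g gE] := ext_row (n := n) ER (f := f1).
  by move=> x; apply: f1E; apply: fc.
by exists (f2 \o g) => x; rewrite fE gE.
Qed.
End ExtProjective.

(** * Condition (AC) *)

Section Ladder.
Variable R : pzRingType.
Hypothesis Rn : noeth R^o.
Variables (C2 C1 C0 N : lmodType R).
Variables (d1 : {linear C2 -> C1}) (d0 : {linear C1 -> C0}) (u : {linear C1 -> N}).

(** Iterated along a complex with finitely generated homology, this step replaces
    a possibly large term of the complex by a finitely generated module, to which
    (AC) can be applied. *)
Lemma ladder_step :
  (forall x, u x = 0 <-> d0 x = 0) ->
  fgm (fun _ => True) (fun y => exists x, y = u x) ->
  (forall x, d0 (d1 x) = 0) ->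
  fgm (fun x => d0 x = 0) (fun y => exists x, y = d1 x) ->
  exists n (N' : lmodType R) (j : {linear N' -> ('rV[R]_n * C1)%type})
         (q : {linear ('rV[R]_n * C1)%type -> N}) (u' : {linear C2 -> N'}),
  [/\ sexact j q, forall x, u' x = 0 <-> d1 x = 0,
      fgm (fun _ => True) (fun y => exists x, y = u' x) &
      forall (L : lmodType R) (f : {linear L -> C1}), (forall x, d0 (f x) = 0) ->
        exists f' : {linear L -> N'}, forall x, f' x = 0 -> f x = 0].
Proof.
move=> ud [l [_ lE]] d01 [z [z0 zE]].
(* Adding a finite free module makes [u] surjective; [N'] is the kernel of the result. It contains
   [(0, c)] exactly when [c] is a cycle. *)
pose g := rowl (fun i : 'I_(size l) => l`_i); pose q := copairl g u.
have qS : forall y, exists x, q x = y.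
  move=> y; have [y' [/lspan_row[v ->] [c e]]] := lE y I.
  by exists (v, c); rewrite /= /lin_fun /= -e addrC subrK.
have ker0 c : ker q (0, c) <-> d0 c = 0.
  by rewrite -ud -[ker q _]/(g 0 + u c = 0) linear0 add0r.
have lift (L : lmodType R) (f : {linear L -> C1}) : (forall x, d0 (f x) = 0) ->
    exists f' : {linear L -> smT (ker q)}, forall x, smval _ (f' x) = (0, f x).
  move=> f0; have [||f' f'E] := @fac_inj _ L _ _ (smval (ker q)) (pairl \0 f).
  - exact: smval_inj.
  - by move=> x; apply: smvalK; apply/ker0.
  by exists f'.
have [u' u'E] := lift _ d1 d01.
exists (size l), (smT (ker q)), (smval (ker q)), q, u'; split.
- exact: sexact_ker.
- move=> x; split=> [e|e]; last first.
    by apply: smval_inj; rewrite u'E e linear0.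
  by have := u'E x; rewrite e linear0 => -[].
(* Generators of [N'] modulo the image of [u']: lifts of generators of its projection to the free
   summand, and then, for elements with first component zero, generators of the homology at [C1]. *)
- pose S := im (fst : {linear ('rV[R]_(size l) * C1)%type -> 'rV[R]_(size l)}) (ker q).
  have [m [mS mE]] := fin_gen_noeth Rn (@row_fin_gen R (size l)) S.
  have [h hE] : exists h : 'rV[R]_(size l) -> smT (ker q),
      forall a, a \in m -> (smval _ (h a)).1 = a.
    apply: (@seq_choice _ (smT (ker q)) 0 (fun a b => (smval _ b).1 = a)).
    by move=> a /mS[x /smvalK[y ->] ->]; exists y.
  have [k kE] : exists k : C1 -> smT (ker q), forall a, a \in z -> smval _ (k a) = (0, a).
    apply: (@seq_choice _ (smT (ker q)) 0 (fun a b => smval _ b = (0, a))).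
    by move=> a /z0 /ker0 /smvalK[y ->]; exists y.
  exists (map h m ++ map k z); split=> // x _.
  have : lspan m (smval _ x).1 by apply: mE; exists (smval _ x) => //; apply: smvalP.
  have {1}-> : m = map (fst \o smval (ker q)) (map h m).
    by rewrite -map_comp map_id_in // => a /hE.
  move=> /lspan_mapE[y hy e]; have := smvalP (x - y).
  have yE : smval _ (x - y) = (0, (smval _ (x - y)).2).
    rewrite [LHS]surjective_pairing; congr pair.
    by rewrite linearB /= in e *; rewrite e subrr.
  rewrite yE => /ker0 /zE [c [zc [b cb]]].
  have [w kw wE] : exists2 w, lspan (map k z) w & smval _ w = (0, c).
    elim: (z) c kE zc {cb} => [|a z' IH] c kE' /=.
      by move=> ->; exists 0 => //; rewrite linear0.
    move=> [s /IH[|w kw we]]; first by move=> a' az; apply: kE'; rewrite inE az orbT.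
    exists (w + s *: k a); first by exists s; rewrite addrK.
    rewrite linearD linearZ /= we kE' ?inE ?eqxx //; congr pair => /=.
      by rewrite scaler0 addr0.
    by rewrite subrK.
  exists (y + w); split.
    by apply: (lspan_cat hy); rewrite addrC addKr.
  exists b; apply: smval_inj; rewrite u'E opprD addrA linearB yE wE -cb.
  by congr pair; rewrite /= subrr.
- move=> L f f0; have [f' f'E] := lift _ f f0; exists f' => x e.
  by have := f'E x; rewrite e linear0 => -[].
Qed.
End Ladder.

Section Shift.
Variable R : pzRingType.
Hypotheses (Rn : noeth R^o) (AC : condition_AC R).
Variables (M : lmodType R) (P : proj_resolution M).
Hypotheses (Mfg : fin_gen M) (MR : forall i, ext_van P i.+1 R^o).

Definition ext_eventually (N : lmodType R) :=
  exists m, forall i, (m <= i)%N -> ext_van P i.+1 N.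

(** Replacing [N] by its [b]-th syzygy turns the bound [b] of (AC) into [0]. *)
Lemma AC_shift (N : lmodType R) :
  fin_gen N -> ext_eventually N -> forall i, ext_van P i.+1 N.
Proof.
move=> Nfg Nev i; have [b bE] := AC Mfg.
(* [k] bounds how far [i] lies below [b]; each syzygy raises [i] by one and lowers [k] by one. *)
suff : forall k N, fin_gen N -> ext_eventually N ->
    forall i, (b <= i + k)%N -> ext_van P i.+1 N.
  by apply; [exact: Nfg | exact: Nev | exact: leq_addl].
elim=> [|k IH] {Nfg Nev i} N Nfg [m Nev] i.
  rewrite addn0 => bi; apply/ext_zeroE/bE => //.
  by exists m.+1; case=> // j mj; apply/ext_zeroE/Nev; lia.
move=> bik; have [n [p pS]] := fin_gen_cover Nfg.
have ex := sexact_ker pS.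
apply: (ext_right ex); first exact: ext_row.
apply: IH; last by lia.
  by apply/fg_smT/fin_gen_noeth => //; apply: row_fin_gen.
exists m.+1; case=> // j mj; apply: (ext_left ex); last exact: ext_row.
by apply: Nev; lia.
Qed.
End Shift.

(** * Reduction to torsionless modules *)

Section Reflexive.
Variable R : pzRingType.
Hypotheses (Rn : noeth R^o) (Rcn : noeth (R^c)^o).

Definition ext_orth (M : lmodType R) :=
  fin_gen M /\ forall i, ext_zero i.+1 M R^o.

Definition torsionless (M : lmodType R) :=
  forall t : M, (forall f : {linear M -> R^o}, f t = 0) -> t = 0.

Lemma dual_sumE (M : lmodType R) n (F : 'I_n -> dual M) x :
  dual_app (\sum_i F i) x = \sum_i dual_app (F i) x.
Proof.
apply: (big_rec2 (fun (f : dual M) y => dual_app f x = y)) => //.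
by move=> i f y _ <-.
Qed.

(** Evaluation at generators of [M] embeds the dual in a finite free right module. *)
Lemma dual_fin_gen (M : lmodType R) : fin_gen M -> fin_gen (dual M).
Proof.
move=> [n [g gE]]; apply/fin_genE.
have vL : linear (fun f : dual M => \row_i dual_app f (g i) : 'rV[R^c]_n).
  by move=> a x y; apply/rowP => i; rewrite !mxE.
have K0 : fg (@Submod R^c (dual M) (fun f => f = 0) (erefl _)
   (fun x y x0 y0 => etrans (congr2 +%R x0 y0) (addr0 0))
   (fun a x x0 => etrans (congr1 (GRing.scale a) x0) (scaler0 _ a))).
  by exists [::].
apply: (fg_ext Rcn (f := lin vL) (T := smfull _)) K0 _ _ => //.
  move=> f _ /rowP f0; apply: dual_ext => x /=.
  have [c ->] := gE x; rewrite linear_sum; apply: big1 => i _.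
  by have := f0 i; rewrite !mxE linearZ /= => ->; rewrite scaler0.
exact/fin_genE/row_fin_gen.
Qed.

Section Approximation.
Variables (M : lmodType R) (r : nat) (e : {linear M -> 'rV[R]_r}).
Hypothesis e_approx : forall f : {linear M -> R^o},
  exists phi : {linear 'rV[R]_r -> R^o}, forall x, f x = phi (e x).

Definition coker_mod : submod 'rV[R]_r := im e (smfull M).
Local Notation N := (quot coker_mod : lmodType R).

Fact coord_linear (i : 'I_r) : linear (fun x : M => e x 0 i : R^o).
Proof. by move=> a x y; rewrite linearP !mxE. Qed.
Definition coord_dual i : dual M := lin (coord_linear i).

Definition row_dual : {linear 'rV[R^c]_r -> dual M} := rowl coord_dual.

Lemma row_dualE (v : 'rV[R^c]_r) x :
  dual_app (row_dual v) x = \sum_i (e x 0 i : R) * v 0 i.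
Proof. exact: dual_sumE. Qed.

Lemma row_formE (phi : {linear 'rV[R]_r -> R^o}) (w : 'rV[R]_r) :
  phi w = \sum_i (w 0 i : R) * phi (delta_mx 0 i).
Proof. by rewrite rowlE. Qed.

Lemma row_dual_surj f : exists v, row_dual v = f.
Proof.
have [phi phiE] := e_approx (dual_app f).
exists (\row_i (phi (delta_mx 0 i) : R)); apply: dual_ext => x.
rewrite row_dualE phiE row_formE; apply: eq_bigr => i _.
by rewrite mxE.
Qed.

Fact dual_row_linear : linear (fun h : dual N =>
  \row_i dual_app h (qproj coker_mod (delta_mx 0 i)) : 'rV[R^c]_r).
Proof. by move=> a x y; apply/rowP => i; rewrite !mxE. Qed.
Definition dual_row : {linear dual N -> 'rV[R^c]_r} := lin dual_row_linear.

Lemma dual_rowE h (b : 'rV[R]_r) :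
  dual_app h (qproj coker_mod b) = \sum_i (b 0 i : R) * dual_row h 0 i.
Proof.
rewrite -[LHS]/((dual_app h \o qproj coker_mod) b) row_formE.
by apply: eq_bigr => i _; rewrite mxE.
Qed.

(** Surjectivity is the approximation property of [e]. A vector killed by [row_dual] is a form on
    the free module vanishing on the image of [e], that is a form on [N]. *)
Lemma dual_sexact : sexact dual_row row_dual.
Proof.
split; [|exact: row_dual_surj|] => [h k hk|v].
  apply: dual_ext => y; have [b <-] := qproj_surj y.
  by rewrite !dual_rowE hk.
split=> [v0|[h ->]]; last first.
  apply: dual_ext => x; rewrite row_dualE -dual_rowE.
  have -> : qproj coker_mod (e x) = 0 by apply/qproj_eq0; exists x.
  exact: linear0.
pose phi := rowl (fun i => v 0 i : R^o).
have [||h hE] := @fac_surj _ _ _ _ (qproj coker_mod) phi.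
- exact: qproj_surj.
- move=> _ /qproj_eq0 [x _ ->].
  by rewrite -[RHS]/(dual_app (0 : dual M) x) -v0 row_dualE.
exists (h : dual N); apply/rowP => i; rewrite mxE.
by rewrite -[RHS]/(h _) hE rowl_delta.
Qed.

Hypothesis M_torsionless : torsionless M.

Lemma approx_inj : injective e.
Proof.
move=> x y /eqP; rewrite -subr_eq0 -linearB => /eqP exy; apply/subr0_eq.
by apply: M_torsionless => f; have [phi ->] := e_approx f; rewrite exy linear0.
Qed.

Lemma coker_sexact : sexact e (qproj coker_mod).
Proof.
split; [exact: approx_inj | exact: qproj_surj | move=> b].
split=> [/qproj_eq0[x _ ->]|[x ->]]; first by exists x.
by apply/qproj_eq0; exists x.
Qed.

(** In degree one the approximation enters: forms on [M] extend along [e]. Higher degrees shift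
    along the exact sequence of [e] and its cokernel. *)
Lemma coker_ext_orth : ext_orth M -> ext_orth N.
Proof.
move=> [Mfg M0]; split.
  apply/fin_genE; exists (map (qproj coker_mod) (codom (fun i => delta_mx 0 i))).
  split=> // y _; have [b <-] := qproj_surj y.
  by apply: lspan_map; rewrite (row_sum_delta b); apply: span_codom.
move=> i; have [P PE] := M0 i; have [_ eS eE] := coker_sexact.
exists (splice (@row_projective R r) approx_inj eS eE P).
case: i PE => [|i] /= PE; last first.
  by apply/ext_zeroE; apply: M0.
move=> f fc; have [||g gE] := @fac_surj _ _ _ _ (res_aug P) f.
- exact: res_aug_surj.
- by move=> _ /res_exact0[x ->]; apply: fc.
have [phi phiE] := e_approx g.
by exists phi => x /=; rewrite -phiE gE.
Qed.

(** A functional [xi] on the dual of [M] pulls back along [row_dual] to a vector [b]. All forms on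
    [N] kill the class of [b]; as [N] is torsionless, [b] comes from [M]. *)
Lemma approx_reflexive : torsionless N -> reflexive_module M.
Proof.
move=> Ntl.
have bI : injective (@biduality R M).
  move=> x y exy; apply/subr0_eq/M_torsionless => f.
  rewrite linearB; apply/eqP; rewrite subr_eq0; apply/eqP.
  exact: (congr1 (fun g => dual_app g (f : dual M)) exy).
have bS (xi : dual (dual M)) : exists x, biduality x = xi.
  pose b : 'rV[R]_r := \row_i dual_app xi (coord_dual i).
  have [x _ bx] : coker_mod b.
    apply/qproj_eq0/Ntl => h; rewrite -[h _]/(dual_app (h : dual N) _) dual_rowE.
    transitivity (dual_app xi (row_dual (dual_row (h : dual N)))).
      rewrite [in RHS]/row_dual /= /lin_fun linear_sum; apply: eq_bigr => i _.
      by rewrite linearZ mxE.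
    have [_ _ /(_ (dual_row (h : dual N)))[_ ->]] := dual_sexact; first exact: linear0.
    by exists (h : dual N).
  exists x; apply: dual_ext => f; have [v <-] := row_dual_surj f.
  rewrite -[LHS]/(dual_app (row_dual v) x) row_dualE -bx.
  rewrite /row_dual /= /lin_fun linear_sum; apply: eq_bigr => i _.
  by rewrite linearZ mxE.
have [g gE] := choice bS; exists g => // x.
by apply: bI; rewrite gE.
Qed.

End Approximation.

Lemma approx_exists (M : lmodType R) : fin_gen M ->
  exists r (e : {linear M -> 'rV[R]_r}), forall f : {linear M -> R^o},
    exists phi : {linear 'rV[R]_r -> R^o}, forall x, f x = phi (e x).
Proof.
move=> Mfg; have [r [g gE]] := dual_fin_gen Mfg.
have eL : linear (fun x : M => \row_i (dual_app (g i) x : R)).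
  by move=> a x y; apply/rowP => i; rewrite !mxE linearP.
exists r, (lin eL) => f; have [c cE] := gE (f : dual M).
exists (rowl (fun i => c i : R^o)) => x.
rewrite -[f x]/(dual_app (f : dual M) x) cE dual_sumE.
by apply: eq_bigr => i _; rewrite mxE.
Qed.

Hypothesis torsionless_orth : forall M, ext_orth M -> torsionless M.

Lemma ext_orth_reflexive M : ext_orth M -> reflexive_module M.
Proof.
move=> MO; have [r [e eE]] := approx_exists MO.1.
apply: (approx_reflexive eE (torsionless_orth MO)).
exact/torsionless_orth/(coker_ext_orth eE (torsionless_orth MO)).
Qed.

(** The sequence of [dual_sexact] shifts degree [i.+2] for [M] to degree [i.+1] for the cokernel
    [N]. In degree one, a functional on the dual of [N] is evaluation at some [y] by reflexivity,
    and a lift of [y] to the free module extends it. *)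
Lemma ext_orth_dual i M : ext_orth M -> ext_zero i.+1 (dual M) (R^c)^o.
Proof.
elim: i M => [|i IH] M MO; have [r [e eE]] := approx_exists MO.1;
  have NO := coker_ext_orth eE (torsionless_orth MO) MO;
  have [jI pS jp] := dual_sexact eE.
  pose P := free_resolution Rcn (dual_fin_gen NO.1).
  exists (splice (@row_projective R^c r) jI pS jp P) => f fc.
  have [||g gE] := @fac_surj _ _ _ _ (res_aug P) f.
  - exact: res_aug_surj.
  - by move=> _ /res_exact0[x ->]; apply: fc.
  have [bi _ biK] := ext_orth_reflexive NO.
  pose y := bi (g : dual (dual (quot (coker_mod e)))).
  have [b by_] := qproj_surj y.
  exists (rowl (fun i => b 0 i : (R^c)^o)) => x.
  rewrite -gE -[g _]/(dual_app (g : dual (dual _)) _).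
  rewrite -[(g : dual (dual _)) in LHS]biK -/y -by_.
  by rewrite -[LHS]/(dual_app (res_aug P x) _) dual_rowE.
have [P PE] := IH _ NO.
by exists (splice (@row_projective R^c r) jI pS jp P).
Qed.

Lemma Gdim0_ext_orth M : ext_orth M -> ~ zero_module M -> Gdim0 M.
Proof.
move=> MO M0; split=> //; [exact: MO.1 | exact: ext_orth_reflexive | case=> // i _].
by split; [exact: MO.2 | exact: ext_orth_dual].
Qed.

End Reflexive.

(** * Injective hulls *)

Section Zorn.
Variables (R : pzRingType) (M : lmodType R).

(** Zorn's lemma is applied to sets whose union with [S0] is a submodule satisfying [Q], so that the
    empty chain has the upper bound [S0]. A chain enters [Q] only through its union [U] being a
    submodule. *)
Lemma zorn_submod (S0 : submod M) (Q : submod M -> Prop) :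
  Q S0 ->
  (forall (F : submod M -> Prop) (U : submod M),
     (exists S, F S) -> (forall S, F S -> Q S) ->
     (forall x, U x <-> exists2 S, F S & S x) -> Q U) ->
  exists S, [/\ Q S, forall x, S0 x -> S x &
    forall T, Q T -> (forall x, S x -> T x) -> forall x, T x -> S x].
Proof.
move=> Q0 Qchain.
pose P : set (set M) := fun X => exists2 S : submod M, Q S &
  (forall x, S x <-> X x \/ S0 x).
have [F FP Ftot|X [[S QS SX] Xmax]] := @Zorn_bigcup M P.
  have [[X0 FX0]|F0] := pselect (exists X, F X); last first.
    exists S0 => // x; split; [by right | case=> // -[X FX _]].
    by case: F0; exists X.
  pose UF x := exists2 X, F X & X x \/ S0 x.
  have UD x y : UF x -> UF y -> UF (x + y).
    move=> [X FX Xx] [Y FY Yy].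
    have [XY|YX] := Ftot _ _ FX FY.
      have [S _ SE] := FP _ FY; exists Y => //; apply/SE/smD; apply/SE => //.
      by case: Xx; [left; apply: XY | right].
    have [S _ SE] := FP _ FX; exists X => //; apply/SE/smD; apply/SE => //.
    by case: Yy; [left; apply: YX | right].
  have UZ a x : UF x -> UF (a *: x).
    move=> [X FX Xx]; have [S _ SE] := FP _ FX; exists X => //.
    by apply/SE/smZ/SE.
  have U0 : UF 0 by exists X0 => //; right; apply: sm0.
  pose U := Submod U0 UD UZ.
  exists U => [|x].
    apply: (Qchain (fun S => Q S /\ exists2 X, F X & forall x, S x <-> X x \/ S0 x)).
    - by have [S QS SE] := FP _ FX0; exists S; split=> //; exists X0.
    - by move=> S [].
    - move=> x; split=> [[X FX Xx]|[S [QS [X FX SE]] /SE Xx]]; last by exists X.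
      by have [S QS SE] := FP _ FX; exists S; [split=> //; exists X | apply/SE].
  split=> [[X FX [Xx|]]|[[X FX Xx]|Sx]]; [by left; exists X|by right| |].
    by exists X => //; left.
  by exists X0 => //; right.
exists S; split=> // [x Sx|T QT ST x Tx]; first by apply/SX; right.
apply: contrapT => Sx; apply: (Xmax (fun y => T y)).
  split=> [y Xy|TX]; first by apply/ST/SX; left.
  by apply: Sx; apply/SX; left; apply: TX.
by exists T => // y; split=> [Ty|[//|Sy]]; [left | apply/ST/SX; right].
Qed.
End Zorn.

(** * Divisible groups *)

Section Divisible.
Variables (V D : lmodType int).
Hypothesis Ddiv : forall n (d : D), (0 < n)%N -> exists d', d' *+ n = d.

Lemma zscale (W : lmodType int) (m : int) (w : W) : m *: w = w *~ m.
Proof. by rewrite -[m in LHS]intz scaler_int. Qed.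

(** Injectivity of divisible groups, with the partial map given by its graph [G], so that no domain
    has to be named. A maximal graph is total, since it can always be extended by one more [v]. *)
Lemma divisible_extend (G : submod (V * D)%type) :
  (forall d, G (0, d) -> d = 0) ->
  exists psi : {linear V -> D}, forall v d, G (v, d) -> psi v = d.
Proof.
move=> G0.
have [|F U [S FS] FQ UE d|X [X0 GX Xmax]] :=
  @zorn_submod int _ G (fun X => forall d, X (0, d) -> d = 0) => //.
  by move=> /UE[T /FQ]; apply.
have Xfun v d e : X (v, d) -> X (v, e) -> d = e.
  move=> Xd Xe; apply/subr0_eq/X0; have := smB Xd Xe.
  by congr (X (_, _)); apply: subrr.
suff Xtot v : exists d, X (v, d).
  have [psi psiE] := choice Xtot.
  have psiL : linear psi.
    move=> a x y; apply: (Xfun (a *: x + y)) => //.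
    exact: (smD (smZ a (psiE x)) (psiE y)).
  by exists (lin psiL) => v d /GX; apply: Xfun.
(* [d1] is the value to give to [v]: the value at [n v] divided by [n], for the least positive [n]
   with [n v] in the domain, and 0 if there is no such [n]. *)
have [d1 d1E] : exists d1, forall m e, X (v *~ m, e) -> e = d1 *~ m.
  have [[n n0]|none] := pselect (exists n : nat, (0 < n)%N && `[< exists d, X (v *+ n, d) >]).
    have ex : exists n : nat, (0 < n)%N && `[< exists d, X (v *+ n, d) >] by exists n.
    case: (ex_minnP ex) => {n0 ex}{}n /andP[n0 /asboolP[d Xd]] nmin.
    have [d1 d1E] := Ddiv d n0; exists d1 => m e Xe.
    have Xq : X (v *~ m - (v *+ n) *~ (m %/ n)%Z, e - d *~ (m %/ n)%Z).
      by have := smB Xe (smZ (m %/ n)%Z Xd); rewrite -!zscale.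
    have mE : v *~ m - (v *+ n) *~ (m %/ n)%Z = v *+ `|(m %% n)%Z|%N.
      rewrite {1}(divz_eq m n) mulrzDr mulrC mulrzA -pmulrn addrC addKr.
      by rewrite -{1}[(m %% n)%Z]gez0_abs // modz_ge0 //; lia.
    have r0 : `|(m %% n)%Z|%N = 0%N.
      apply/eqP; rewrite -leqn0 leqNgt; apply/negP => r0.
      have : (n <= `|(m %% n)%Z|)%N.
        by apply: nmin; rewrite r0; apply/asboolP; eexists; rewrite -mE; exact: Xq.
      rewrite leqNgt => /negP; apply.
      have : (0 < n%:Z)%R by lia.
      by move=> /(ltz_pmod m); have := @modz_ge0 m n; lia.
    have : e - d *~ (m %/ n)%Z = 0 by apply: X0; move: Xq; rewrite mE r0.
    move=> /subr0_eq ->; rewrite [in RHS](divz_eq m n).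
    have -> : (m %% n)%Z = 0 by lia.
    by rewrite addr0 mulrC mulrzA -pmulrn d1E.
  exists 0 => m e Xe; rewrite mul0rz; case: (posnP `|m|%N) => [/eqP|m0].
    by rewrite absz_eq0 => /eqP m0; apply: X0; move: Xe; rewrite m0.
  case: none; exists `|m|%N; rewrite m0; apply/asboolP.
  case: (intP m) Xe => [|n Xe|n Xe]; first by exists e.
    by exists e.
  exists (- e); have := smN Xe.
  by congr (X (_, _)); rewrite -[LHS]/(- (v *~ _)) mulrNz opprK abszN.
have [Y YE] : exists Y : submod (V * D)%type,
    forall p, Y p <-> exists w m, X w /\ p = w + (v *~ m, d1 *~ m).
  unshelve eexists (@Submod int (V * D)%type
    (fun p => exists w m, X w /\ p = w + (v *~ m, d1 *~ m)) _ _ _) => //.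
  - by exists 0, 0; split; [exact: sm0 | rewrite !mulr0z addr0].
  - move=> _ _ [w [m [Xw ->]]] [z [n [Xz ->]]]; exists (w + z), (m + n).
    split; first exact: smD.
    by rewrite !mulrzDr addrACA.
  - move=> a _ [w [m [Xw ->]]]; exists (a *: w), (m * a); split; first exact: smZ.
    rewrite scalerDr; congr (_ + _); rewrite !mulrzA -!zscale.
    by congr pair; rewrite zscale.
exists d1; apply: (Xmax Y).
- move=> d /YE[[w e] [m [Xw [wv ->]]]].
  have : X (v *~ m, - e).
    have := smN Xw; congr (X (_, _)).
    by rewrite -[LHS]/(- w); apply/eqP; rewrite eqr_oppLR -addr_eq0 -wv.
  by move=> /d1E <-; rewrite addrN.
- by move=> p Xp; apply/YE; exists p, 0; rewrite !mulr0z addr0.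
- by apply/YE; exists 0, 1; split; [exact: sm0 | rewrite !mulr1z add0r].
Qed.
End Divisible.

Section Coinduced.
Variables (R : pzRingType) (D : lmodType int).

(** [R] acts on [Hom_Z(R, D)] by [(a f)(x) = f(x a)]. *)
Definition coind : Type := {f : R -> D | `[< {morph f : x y / x - y} >]}.
HB.instance Definition _ := gen_eqMixin coind.
HB.instance Definition _ := gen_choiceMixin coind.

Definition coind_app (f : coind) : R -> D := sval f.

Lemma coind_ext f g : (forall x, coind_app f x = coind_app g x) -> f = g.
Proof. by move=> fg; apply: val_inj; apply/funext. Qed.

Lemma coindB f : {morph coind_app f : x y / x - y}.
Proof. exact/asboolP/(svalP f). Qed.

Definition mkcoind (f : R -> D) (fB : {morph f : x y / x - y}) : coind :=
  exist _ f (asboolT fB).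

Lemma coind0 f : coind_app f 0 = 0.
Proof. by rewrite -(subrr 0) coindB subrr. Qed.

Lemma coindD f : {morph coind_app f : x y / x + y}.
Proof. by move=> x y; rewrite -{1}(opprK y) coindB -sub0r coindB coind0 sub0r opprK. Qed.

Fact coind_zero_subproof : {morph (fun _ : R => 0 : D) : x y / x - y}.
Proof. by move=> x y; rewrite subrr. Qed.
Fact coind_opp_subproof f : {morph (fun x : R => - coind_app f x) : x y / x - y}.
Proof. by move=> x y; rewrite coindB opprD. Qed.
Fact coind_add_subproof f g :
  {morph (fun x : R => coind_app f x + coind_app g x) : x y / x - y}.
Proof. by move=> x y; rewrite !coindB opprD addrACA. Qed.
Fact coind_scale_subproof a f : {morph (fun x : R => coind_app f (x * a)) : x y / x - y}.
Proof. by move=> x y; rewrite mulrBl coindB. Qed.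

Definition coind_zero := mkcoind coind_zero_subproof.
Definition coind_opp f := mkcoind (coind_opp_subproof f).
Definition coind_add f g := mkcoind (coind_add_subproof f g).
Definition coind_scale a f := mkcoind (coind_scale_subproof a f).

Fact coind_addA : associative coind_add.
Proof. by move=> f g h; apply: coind_ext => x; apply: addrA. Qed.
Fact coind_addC : commutative coind_add.
Proof. by move=> f g; apply: coind_ext => x; apply: addrC. Qed.
Fact coind_add0 : left_id coind_zero coind_add.
Proof. by move=> f; apply: coind_ext => x; apply: add0r. Qed.
Fact coind_addN : left_inverse coind_zero coind_opp coind_add.
Proof. by move=> f; apply: coind_ext => x; apply: addNr. Qed.
HB.instance Definition _ :=
  GRing.isZmodule.Build coind coind_addA coind_addC coind_add0 coind_addN.

Fact coind_scaleA a b f : coind_scale a (coind_scale b f) = coind_scale (a * b) f.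
Proof. by apply: coind_ext => x; rewrite /= /coind_app /= mulrA. Qed.
Fact coind_scale1 : left_id 1 coind_scale.
Proof. by move=> f; apply: coind_ext => x; rewrite /coind_app /= mulr1. Qed.
Fact coind_scaleDr : right_distributive coind_scale +%R.
Proof. by move=> a f g; apply: coind_ext. Qed.
Fact coind_scaleDl f : {morph coind_scale^~ f : a b / a + b}.
Proof. by move=> a b; apply: coind_ext => x; rewrite /coind_app /= mulrDr coindD. Qed.
HB.instance Definition _ :=
  GRing.Zmodule_isLmodule.Build R coind coind_scaleA coind_scale1 coind_scaleDr coind_scaleDl.

Hypothesis Ddiv : forall n (d : D), (0 < n)%N -> exists d', d' *+ n = d.

(** Maps [U -> coind] correspond to additive maps [U -> D] by evaluation at 1. Such a map extends to
    [psi] on [V], and [psi] corresponds to [v] mapping to the function [a] to [psi (a *: v)]. *)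
Lemma coind_injective : injective_module coind.
Proof.
move=> U V g f gI.
have gL : linear (fun u : zmodule U => (g u, coind_app (f u) 1) : (zmodule V * D)%type).
  move=> a x y; rewrite [a *: x]zscale; congr pair.
    rewrite -[RHS]/(a *: (g x : zmodule V) + g y) zscale.
    by rewrite -[LHS]/(g ((x : U) *~ a + y)) raddfD raddfMz.
  rewrite -[RHS]/(a *: coind_app (f x) 1 + coind_app (f y) 1) zscale.
  rewrite -[LHS]/(coind_app (f ((x : U) *~ a + y)) 1) raddfD raddfMz.
  rewrite -[LHS]/(coind_app (f x *~ a) 1 + coind_app (f y) 1); congr (_ + _).
  have F : {morph (fun h : coind => coind_app h 1) : h k / h - k} by [].
  pose Fa := GRing.isZmodMorphism.Build coind D _ F.
  pose F' : {additive coind -> D} := HB.pack (fun h : coind => coind_app h 1) Fa.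
  exact: (raddfMz F').
have [|psi psiE] := @divisible_extend (zmodule V : lmodType int) D Ddiv (im (lin gL) (smfull _)).
  move=> d [u _ [gu ->]]; have -> : u = 0 by apply: gI; rewrite linear0 -gu.
  by rewrite linear0.
have hB v : {morph (fun a : R => psi (a *: v)) : x y / x - y}.
  by move=> x y; rewrite scalerBl; apply: (linearB psi).
have hL : linear (fun v : V => mkcoind (hB v)).
  move=> c v w; apply: coind_ext => a; rewrite /coind_app /=.
  by rewrite scalerDr scalerA; apply: (linearD psi).
exists (lin hL) => u; apply: coind_ext => a.
rewrite /= /lin_fun /coind_app /= -linearZ (psiE _ (coind_app (f (a *: u)) 1)).
  by rewrite linearZ /= /coind_app /= mul1r.
by exists (a *: u).
Qed.
End Coinduced.

Section RationalQuotient.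

Definition intsub : submod (zmodule rat).
Proof.
refine (@Submod int (zmodule rat) (fun x : rat => x \is a Num.int) _ _ _).
- exact: rpred0.
- by move=> x y; apply: rpredD.
- by move=> a x xi; rewrite zscale -[_ *~ a]/((x : rat) *~ a) rpredMz.
Defined.

Definition rat_mod_int : lmodType int := quot intsub.

Lemma rat_mod_int_div n (d : rat_mod_int) : (0 < n)%N -> exists d', d' *+ n = d.
Proof.
move=> n0; have [x <-] := qproj_surj d.
exists (qproj intsub ((x : rat) / n%:R : rat)); rewrite -raddfMn; congr (qproj _ _).
by rewrite -[_ *+ n]/((x : rat) / n%:R *+ n) -mulr_natr divfK // pnatr_eq0; lia.
Qed.

Lemma rat_mod_int_torsion n : (1 < n)%N -> exists d : rat_mod_int, d != 0 /\ d *+ n = 0.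
Proof.
move=> n1; exists (qproj intsub (n%:R^-1 : rat)); split.
  apply/eqP => /qproj_eq0; rewrite -[intsub _]/(is_true (n%:R^-1 \is a Num.int)).
  move=> /intrP[m e].
  have : (m%:~R * n%:R = 1 :> rat) by rewrite -e mulVf // pnatr_eq0; lia.
  have -> : n%:R = (n%:Z)%:~R :> rat by [].
  rewrite -intrM => /eqP; rewrite -[1]/(1%:~R) eqr_int => /eqP mn.
  move/(congr1 absz)/eqP: mn; rewrite abszM absz1 muln_eq1 => /andP[_].
  by rewrite absz_nat; lia.
rewrite -raddfMn; apply/qproj_eq0.
rewrite -[intsub _]/(is_true (n%:R^-1 *+ n \is a Num.int)).
have -> : (n%:R^-1 *+ n = 1 :> rat); last exact: rpred1.
by rewrite -[LHS]mulr_natr mulVf // pnatr_eq0; lia.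
Qed.

End RationalQuotient.

(** * Injective hull of a simple module *)

Section InjectiveHull.
Variable R : pzRingType.

Definition maximal_ideal (m : submod R^o) :=
  ~ m (1 : R) /\ forall x : R, ~ m x -> exists a : R, m (1 - a * x).

Lemma maximal_ideal_exists (I : submod R^o) : ~ I (1 : R) ->
  exists m, maximal_ideal m /\ forall x, I x -> m x.
Proof.
move=> I1.
have [//|F U [S FS] FQ UE|m [m1 Im mmax]] :=
  @zorn_submod R R^o I (fun m => ~ m (1 : R)).
  by move=> /UE[T /FQ].
exists m; split=> //; split=> // x mx; apply: contrapT => no.
pose T := im (copairl (smval m) (lin (@smval_linear R R^o (lspan_sm [:: x : R^o])))) (smfull _).
have TE (y : R) : T y <-> exists a : R, m (y - a * x).
  split=> [[[u v] _ ->]|[a ma]].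
    have [a va] := smvalP v; exists a.
    rewrite /= /lin_fun /= -addrA.
    have -> : \val v - a * x = 0 by exact: va.
    by rewrite addr0; apply: smvalP.
  have [u uE] := smvalK ma.
  have [v vE] : exists v, (a * x : R^o) = smval (lspan_sm [:: x : R^o]) v.
    by apply: smvalK; exists a; rewrite subrr.
  exists (u, v) => //.
  by rewrite -[RHS]/(smval _ u + smval _ v) -uE -vE subrK.
apply: mx; apply: (mmax T).
- by move=> /TE.
- by move=> y my; apply/TE; exists 0; rewrite mul0r subr0.
- by apply/TE; exists 1; rewrite mul1r subrr; apply: sm0.
Qed.

(** [y] is a nonzero character of the additive group [R / m]. As [(a y)(x) = y(x a)] and [m] is a
    left ideal, [m] kills [y]; maximality of [m] gives the converse. *)
Lemma residue_embedding (m : submod R^o) : maximal_ideal m ->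
  exists (J : lmodType R) (y : J), injective_module J /\
    forall a : R, a *: y = 0 <-> m a.
Proof.
move=> [m1 mmax]; exists (coind R rat_mod_int : lmodType R).
(* [d] is to be the value of the character at 1, so every integer lying in [m] must kill it: take
   [1/n] for the least positive [n] in [m], or [1/2] if there is none. *)
have [d [d0 dm]] : exists d : rat_mod_int, d != 0 /\ forall n : int, m (n%:~R : R) -> d *~ n = 0.
  have [[n n0]|none] := pselect (exists n : nat, (0 < n)%N && `[< m (n%:R : R) >]).
    have ex : exists n : nat, (0 < n)%N && `[< m (n%:R : R) >] by exists n.
    case: (ex_minnP ex) => {n0 ex}{}n /andP[n0 /asboolP mn] nmin.
    have n1 : (1 < n)%N by case: n n0 mn {nmin} => [|[|n]].
    have [d [d0 dn]] := rat_mod_int_torsion n1; exists d; split=> // k mk.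
    have r0 : `|(k %% n)%Z|%N = 0%N.
      apply/eqP; rewrite -leqn0 leqNgt; apply/negP => r0.
      have : (n <= `|(k %% n)%Z|)%N.
        apply: nmin; rewrite r0; apply/asboolP.
        have -> : `|(k %% n)%Z|%N%:R = k%:~R - (k %/ n)%Z%:~R * n%:R :> R.
          rewrite {2}(divz_eq k n) intrD intrM -pmulrn addrC addKr pmulrn gez0_abs //.
          by rewrite modz_ge0 //; lia.
        by apply: smB => //; apply: (smZ (s := m)).
      rewrite leqNgt => /negP; apply.
      have : (0 < n%:Z)%R by lia.
      by move=> /(ltz_pmod k); have := @modz_ge0 k n; lia.
    rewrite (divz_eq k n); have -> : (k %% n)%Z = 0 by lia.
    by rewrite addr0 mulrC mulrzA -pmulrn dn mul0rz.
  have [d [d0 _]] := @rat_mod_int_torsion 2 isT; exists d; split=> // n mn.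
  case: (posnP `|n|%N) => [/eqP|n0]; first by rewrite absz_eq0 => /eqP ->.
  case: none; exists `|n|%N; rewrite n0; apply/asboolP.
  by case: (intP n) mn => [|k|k] //; rewrite mulrNz abszN => /smN; rewrite opprK.
(* The graph of the character on [m + Z]: an element congruent to [n] modulo [m] goes to
   [d *~ n]. *)
have [G GE] : exists G : submod ((zmodule R : lmodType int) * rat_mod_int)%type,
    forall p, G p <-> exists n : int, m (p.1 - n%:~R) /\ p.2 = d *~ n.
  unshelve eexists (@Submod int ((zmodule R : lmodType int) * rat_mod_int)%type
    (fun p => exists n : int, m ((p.1 : R) - n%:~R) /\ p.2 = d *~ n) _ _ _) => //.
  - by exists 0; rewrite subr0 mulr0z; split=> //; exact: (sm0 m).
  - move=> p q [n [mn pn]] [k [mk qk]]; exists (n + k); split.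
  2: by rewrite mulrzDr -pn -qk.
    rewrite intrD opprD.
    have -> : ((p + q).1 : R) + (- n%:~R - k%:~R) = (p.1 - n%:~R) + (q.1 - k%:~R).
      by rewrite addrACA.
    exact: (smD (s := m)).
  - move=> a p [n [mn pn]]; exists (n * a); split.
  2: by rewrite mulrzA -pn; exact: zscale.
    have -> : ((a *: p).1 : R) - (n * a)%:~R = a%:~R * ((p.1 : R) - n%:~R).
      by rewrite mulrBr -intrM mulrC mulrzl; congr (_ - _); exact: zscale.
    exact: (smZ (s := m)).
have [|psi psiE] := @divisible_extend (zmodule R : lmodType int) rat_mod_int
    rat_mod_int_div G.
  move=> e /GE[n [/= mn ->]]; apply: dm.
  by move: mn; rewrite sub0r => /smN; rewrite opprK.
have yB : {morph (fun a : R => psi a) : x y / x - y}.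
  by move=> a b; apply: (linearB psi).
pose y : coind R rat_mod_int := mkcoind yB.
have y1 : coind_app y 1 = d.
  by apply: psiE; apply/GE; exists 1; rewrite subrr mulr1z; split=> //; apply: sm0.
exists y; split; first exact/coind_injective/rat_mod_int_div.
have my (a : R) : m a -> a *: y = 0.
  move=> ma; apply: coind_ext => x; apply: (psiE (x * a) 0).
  apply/GE; exists 0; rewrite subr0 mulr0z; split=> //.
  exact: (smZ (s := m)).
move=> a; split=> [ay|]; last exact: my.
apply: contrapT => /mmax[b /my mb].
have : coind_app ((1 - b * a) *: y) 1 = d.
  by rewrite scalerBl scale1r -scalerA ay scaler0 subr0.
by rewrite mb -[coind_app 0 1]/0 => /esym/eqP; rewrite (negPf d0).
Qed.

(** [E] is a maximal essential extension, inside an injective [J], of a copy of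
    [R / m]; a maximal [C] with [C :&: E = 0] yields a retraction of [J] onto [E]. *)
Lemma injective_hull (m : submod R^o) : maximal_ideal m ->
  exists (E : lmodType R) (y : E), [/\ injective_module E,
    forall a : R, a *: y = 0 <-> m a &
    forall e : E, e <> 0 -> exists a b, a *: e <> 0 /\ a *: e = b *: y].
Proof.
move=> mmax; have [J [y [Jinj ym]]] := residue_embedding mmax.
pose S := lspan_sm [:: y].
have SE x : S x <-> exists b, x = b *: y.
  by split=> [[b /= /subr0_eq ->]|[b ->]]; exists b; rewrite ?subrr.
pose ess (E : submod J) := (forall x, S x -> E x) /\
  forall e, E e -> e <> 0 -> exists a b, a *: e <> 0 /\ a *: e = b *: y.
have [||E [[SubE Eess] _ Emax]] := @zorn_submod R J S ess.
- split=> // e /SE[b ->] by0; exists 1, b; by rewrite scale1r.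
- move=> F U [T FT] FQ UE; split=> [x Sx|e /UE[T' /FQ[_]]]; last exact.
  by apply/UE; exists T => //; apply: (FQ _ FT).1.
have [||C [C0 _ Cmax]] :=
    @zorn_submod R J (lspan_sm [::]) (fun C => forall x, C x -> E x -> x = 0).
- by move=> x.
- by move=> F U _ FQ UE x /UE[T /FQ]; apply.
(* [E + C] is direct, so its projection to [E] extends to an endomorphism of [J]. *)
have [|psi psiE] := inj_fac (u := copairl (smval E) (smval C)) (f := smval E \o fst) Jinj.
  move=> [e c] ec; have eE : smval E e = - smval C c.
    by apply/eqP; rewrite -addr_eq0; apply/eqP; exact: ec.
  change (smval E e = 0); apply: C0; last exact: smvalP.
  by rewrite eE; apply/smN/smvalP.
have psi_id e : E e -> psi e = e.
  move=> /smvalK[x ->]; have := psiE (x, 0).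
  by rewrite -[copairl _ _ _]/(smval E x + smval C 0) (linear0 (smval C)) addr0.
have psi_C c : C c -> psi c = 0.
  move=> /smvalK[x ->]; have := psiE (0, x).
  rewrite -[copairl _ _ _]/(smval E 0 + smval C x) (linear0 (smval E)) add0r => ->.
  exact: (linear0 (smval E)).
(* If [psi z] is nonzero then [z] is outside [C], so [C + R z] meets [E] by maximality of [C], which
   yields a nonzero multiple of [psi z] in [E]. Thus the image of [psi] is essential over [S], and
   maximality of [E] applies. *)
have psiM : forall z, E (psi z).
  suff Q : ess (im psi (smfull J)).
    move=> z; apply: (Emax _ Q); last by exists z.
    by move=> e Ee; exists e; rewrite ?psi_id.
  split=> [x Sx|w [z _ ->] w0].
    by exists x => //; rewrite psi_id //; apply: SubE.
  pose C' := im (copairl (smval C) (smval (lspan_sm [:: z]))) (smfull _).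
  have C'E x : C' x <-> exists a, C (x - a *: z).
    split=> [[[c v] _ ->]|[a /smvalK[c cE]]].
      have [a va] := smvalP v; exists a.
      have vE : smval (lspan_sm [:: z]) v = a *: z by apply/subr0_eq.
      rewrite -[copairl _ _ _]/(smval C c + smval (lspan_sm [:: z]) v) vE addrK.
      exact: smvalP.
    have [v vE] : exists v, a *: z = smval (lspan_sm [:: z]) v.
      by apply: smvalK; exists a; rewrite subrr.
    exists (c, v) => //; rewrite -[RHS]/(smval C c + smval (lspan_sm [:: z]) v).
    by rewrite -vE -cE subrK.
  have [x [C'x Ex x0]] : exists x, [/\ C' x, E x & x <> 0].
    apply: contrapT => no; apply/w0/psi_C/(Cmax C').
    - by move=> x C'x Ex; apply: contrapT => x0; apply: no; exists x.
    - by move=> x Cx; apply/C'E; exists 0; rewrite scale0r subr0.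
    - by apply/C'E; exists 1; rewrite scale1r subrr; apply: sm0.
  have [a Ca] := (C'E x).1 C'x.
  have xE : x = a *: psi z.
    by apply/subr0_eq; rewrite -linearZ -{1}(psi_id x Ex) -linearB psi_C.
  have [b [c [bx0 bx]]] := Eess x Ex x0.
  by exists (b * a), c; rewrite -scalerA -xE.
have [r rE] : exists r : {linear J -> smT E}, forall x, smval E (r x) = psi x.
  by apply: fac_inj; [exact: smval_inj | move=> x; apply/smvalK/psiM].
have [y' y'E] : exists y', y = smval E y'.
  by apply/smvalK/SubE/SE; exists 1; rewrite scale1r.
exists (smT E), y'; split.
- apply: (@retract_injective _ _ _ (smval E) r) => // x.
  by apply: smval_inj; rewrite rE psi_id //; apply: smvalP.
- move=> a; rewrite -ym y'E -linearZ; split=> [->|]; first exact: linear0.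
  by rewrite -[X in _ = X](linear0 (smval E)) => /smval_inj.
- move=> e e0; have [|a [b [ae0 ae]]] := Eess _ (smvalP e).
    by move=> e0'; apply: e0; apply: smval_inj; rewrite e0' linear0.
  exists a, b; split; last by apply: smval_inj; rewrite !linearZ /= ae y'E.
  by move=> h; apply: ae0; rewrite -linearZ h linear0.
Qed.
End InjectiveHull.

(** * Modules of homomorphisms *)

(** An action of [S] on the [R]-module [B] commuting with that of [R]; it makes
    [Hom_R(M, B)] an [S]-module. *)
Record raction (R S : pzRingType) (B : lmodType R) := RAction {
  ra_act :> S -> B -> B;
  ra_linear : forall s, linear (ra_act s);
  raDl : forall s t x, ra_act (s + t) x = ra_act s x + ra_act t x;
  raA : forall s t x, ra_act (s * t) x = ra_act s (ra_act t x);
  ra1 : forall x, ra_act 1 x = x }.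

Section HomModule.
Variables (R S : pzRingType) (B : lmodType R) (act : raction S B) (M : lmodType R).

Definition homm (_ : raction S B) (M : lmodType R) : Type := {linear M -> B}.
Local Notation H := (homm act M).
HB.instance Definition _ := gen_eqMixin H.
HB.instance Definition _ := gen_choiceMixin H.

Definition hom_app (f : H) : {linear M -> B} := f.

Lemma linear_ext (f g : {linear M -> B}) : (forall x, f x = g x) -> f = g.
Proof.
case: f g => f cf [g cg] /= /funext fg.
move: cg; case: g / fg => cg; congr GRing.Linear.Pack.
case: cf cg => [m1 m2] [n1 n2].
congr GRing.Linear.Class.
  case: m1 n1 => ? [?]; congr GRing.isNmodMorphism.Axioms_.
  exact: Prop_irrelevance.
case: m2 n2 => ? [?]; congr GRing.isScalable.Axioms_.
exact: Prop_irrelevance.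
Qed.

Lemma hom_ext (f g : H) : (forall x, hom_app f x = hom_app g x) -> f = g.
Proof. exact: linear_ext. Qed.

Definition hom_zero : H := (\0 : {linear M -> B}).
Definition hom_opp (f : H) : H := (\- hom_app f : {linear M -> B}).
Definition hom_add (f g : H) : H := (hom_app f \+ hom_app g : {linear M -> B}).

Fact hom_addA : associative hom_add.
Proof. by move=> f g h; apply: hom_ext => x; exact: addrA. Qed.
Fact hom_addC : commutative hom_add.
Proof. by move=> f g; apply: hom_ext => x; exact: addrC. Qed.
Fact hom_add0 : left_id hom_zero hom_add.
Proof. by move=> f; apply: hom_ext => x; exact: add0r. Qed.
Fact hom_addN : left_inverse hom_zero hom_opp hom_add.
Proof. by move=> f; apply: hom_ext => x; exact: addNr. Qed.
HB.instance Definition _ :=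
  GRing.isZmodule.Build H hom_addA hom_addC hom_add0 hom_addN.

Definition hom_scale (s : S) (f : H) : H := lin (ra_linear act s) \o hom_app f.

Fact hom_scaleA a b f : hom_scale a (hom_scale b f) = hom_scale (a * b) f.
Proof. by apply: hom_ext => x; apply: esym; apply: raA. Qed.
Fact hom_scale1 : left_id 1 hom_scale.
Proof. by move=> f; apply: hom_ext => x; apply: ra1. Qed.
Fact hom_scaleDr : right_distributive hom_scale +%R.
Proof. by move=> a f g; apply: hom_ext => x; apply: (linearD (lin (ra_linear act a))). Qed.
Fact hom_scaleDl f : {morph hom_scale^~ f : a b / a + b}.
Proof. by move=> a b; apply: hom_ext => x; apply: raDl. Qed.
HB.instance Definition _ :=
  GRing.Zmodule_isLmodule.Build S H hom_scaleA hom_scale1 hom_scaleDr hom_scaleDl.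

Lemma homDE (f g : H) x : hom_app (f + g) x = hom_app f x + hom_app g x.
Proof. by []. Qed.
Lemma homZE (s : S) (f : H) x : hom_app (s *: f) x = act s (hom_app f x).
Proof. by []. Qed.

Fact heval_linear (C : lmodType S) (b : B -> C) (x : M) :
  (forall y z, b (y + z) = b y + b z) -> (forall s y, b (act s y) = s *: b y) ->
  linear (fun f : H => b (hom_app f x)).
Proof. by move=> bD bZ s f g; rewrite homDE homZE bD bZ. Qed.
End HomModule.

Section HomFunctor.
Variables (R S : pzRingType) (B : lmodType R) (act : raction S B).

Fact precomp_linear (L M : lmodType R) (p : {linear L -> M}) :
  linear (fun f : homm act M => (hom_app f \o p : homm act L)).
Proof. by move=> s f g; apply: hom_ext. Qed.
Definition precomp (L M : lmodType R) (p : {linear L -> M}) : {linear homm act M -> homm act L} :=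
  lin (@precomp_linear L M p).

Variables (C : lmodType R) (bct : raction S C).
Fact postcomp_linear (M : lmodType R) (b : {linear B -> C}) :
  (forall s y, b (act s y) = bct s (b y)) ->
  linear (fun f : homm act M => (b \o hom_app f : homm bct M)).
Proof.
move=> bZ s f g; apply: hom_ext => x.
rewrite -[LHS]/(b (act s (hom_app f x) + hom_app g x)) linearD bZ.
by [].
Qed.
Definition postcomp (M : lmodType R) (b : {linear B -> C})
    (bZ : forall s y, b (act s y) = bct s (b y)) : {linear homm act M -> homm bct M} :=
  lin (@postcomp_linear M b bZ).
End HomFunctor.

(** * Scalar multiplication as a linear map *)

Section Commutative.
Variable R : pzRingType.
Hypothesis mulC : forall x y : R, x * y = y * x.

Fact cscale_linear (M : lmodType R) (a : R) : linear (fun x : M => a *: x).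
Proof. by move=> b x y; rewrite scalerDr !scalerA mulC. Qed.
Definition cscale (M : lmodType R) (a : R) : {linear M -> M} := lin (@cscale_linear M a).

Definition cact (M : lmodType R) : raction R M :=
  RAction (@cscale_linear M) (fun a b x => scalerDl x a b)
    (fun a b x => esym (scalerA a b x)) (@scale1r R M).

(** * Koszul complexes *)

Record ncomplex := NComplex {
  nc_ob :> nat -> lmodType R;
  nc_dif : forall n, {linear nc_ob n.+1 -> nc_ob n};
  nc_difK : forall n x, nc_dif n (nc_dif n.+1 x) = 0 }.

Section Cone.
Variables (K : ncomplex) (x : R).

(** The mapping cone of multiplication by [x] on [K]. In degree 0 the summand [K_(-1)] is zero and
    is left out, whence the case distinctions. *)
Definition kcone_ob (n : nat) : lmodType R :=
  if n is m.+1 then (K m.+1 * K m)%type else K 0.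

Definition kcone_dif (n : nat) : {linear kcone_ob n.+1 -> kcone_ob n} :=
  match n with
  | 0 => copairl (nc_dif K 0) (cscale (K 0) x)
  | m.+1 => pairl (copairl (nc_dif K m.+1) (cscale (K m.+1) x))
                  (copairl \0 (\- nc_dif K m))
  end.

Fact kcone_difK n z : kcone_dif n (kcone_dif n.+1 z) = 0.
Proof.
case: n z => [|n] [a b].
  rewrite -[LHS]/(nc_dif K 0 (nc_dif K 1 a + x *: b) + x *: (0 - nc_dif K 0 b)).
  by rewrite linearD nc_difK add0r sub0r linearZ /= scalerN subrr.
rewrite -[LHS]/(nc_dif K n.+1 (nc_dif K n.+2 a + x *: b) + x *: (0 - nc_dif K n.+1 b),
  0 - nc_dif K n (0 - nc_dif K n.+1 b)).
congr pair; last by rewrite !sub0r linearN nc_difK !oppr0.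
by rewrite linearD nc_difK add0r sub0r linearZ /= scalerN subrr.
Qed.
Definition kcone : ncomplex := NComplex kcone_difK.
End Cone.

Section KoszulDual.
Variable E : lmodType R.
Hypothesis Einj : injective_module E.

Definition dual_E (K : lmodType R) : lmodType R := homm (cact E) K.

Definition nullhomotopic (K : ncomplex) (x : R) :=
  exists h : forall n, {linear K n -> K n.+1},
    (forall z : K 0, x *: z = nc_dif K 0 (h 0 z)) /\
    forall n (z : K n.+1), x *: z = nc_dif K n.+1 (h n.+1 z) + h n (nc_dif K n z).

(** The last clause says that [E] sees the image of [K 1 -> K 0 = R] as contained in
    the ideal generated by [l]. *)
Definition koszul_like (l : seq R) (K : ncomplex) :=
  [/\ forall n, fin_gen (K n) /\ injective_module (dual_E (K n)),
      exists N, forall n, (N <= n)%N -> zero_module (K n),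
      forall x, x \in l -> nullhomotopic K x &
      exists (i : {linear R^o -> K 0}) (r : {linear K 0 -> R^o}),
        [/\ cancel i r, cancel r i &
         forall (z : K 1) (e : E), (forall x, x \in l -> x *: e = 0) ->
           (r (nc_dif K 0 z) : R) *: e = 0]].

Lemma fin_gen_prod (U V : lmodType R) : fin_gen U -> fin_gen V -> fin_gen (U * V)%type.
Proof.
move=> /fin_genE[l [_ lE]] /fin_genE[m [_ mE]]; apply/fin_genE.
have iL : linear (fun x : U => (x, 0 : V)).
  by move=> a x y; congr pair => /=; rewrite scaler0 addr0.
have jL : linear (fun x : V => (0 : U, x)).
  by move=> a x y; congr pair => /=; rewrite scaler0 addr0.
exists (map (lin iL) l ++ map (lin jL) m); split=> // -[x y] _.
apply: (lspan_cat (y := (x, 0))); first exact: (lspan_map (lin iL) (lE x I)).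
have -> : (x, y) - (x, 0) = (0, y) by congr pair => /=; rewrite ?subrr ?subr0.
exact: (lspan_map (lin jL) (mE y I)).
Qed.

Lemma dual_E_prod (U V : lmodType R) :
  injective_module (dual_E U) -> injective_module (dual_E V) ->
  injective_module (dual_E (U * V)%type).
Proof.
move=> Ui Vi.
have iL : linear (fun x : U => (x, 0 : V)).
  by move=> a x y; congr pair => /=; rewrite scaler0 addr0.
have jL : linear (fun x : V => (0 : U, x)).
  by move=> a x y; congr pair => /=; rewrite scaler0 addr0.
have rL : linear (fun fg : dual_E U * dual_E V =>
    copairl (hom_app fg.1) (hom_app fg.2) : dual_E (U * V)%type).
  move=> a f g; apply: hom_ext => z.
  rewrite -[LHS]/((a *: hom_app f.1 z.1 + hom_app g.1 z.1) +
     (a *: hom_app f.2 z.2 + hom_app g.2 z.2)).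
  rewrite -[RHS]/(a *: (hom_app f.1 z.1 + hom_app f.2 z.2) +
     (hom_app g.1 z.1 + hom_app g.2 z.2)).
  by rewrite scalerDr addrACA.
pose s := pairl (precomp (cact E) (lin iL)) (precomp (cact E) (lin jL)).
apply: (@retract_injective _ _ _ s (lin rL)); last exact: prod_injective.
move=> f; apply: hom_ext => -[x y].
rewrite -[LHS]/(hom_app f (x, 0) + hom_app f (0, y)) -linearD.
by congr (hom_app f _); congr pair => /=; rewrite ?addr0 ?add0r.
Qed.

Lemma dual_E_regular : injective_module (dual_E R^o).
Proof.
have sL : linear (fun f : dual_E R^o => hom_app f (1 : R)) by [].
have oL (e : E) : linear (fun a : R^o => (a : R) *: e).
  by move=> a x y; rewrite scalerDl scalerA.
have rL : linear (fun e : E => lin (oL e) : dual_E R^o).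
  move=> a e f; apply: hom_ext => x.
  rewrite -[LHS]/((x : R) *: (a *: e + f)).
  rewrite -[RHS]/(a *: ((x : R) *: e) + (x : R) *: f).
  by rewrite scalerDr !scalerA mulC.
apply: (@retract_injective _ _ _ (lin sL) (lin rL)) => // f.
apply: hom_ext => x; rewrite -[LHS]/((x : R) *: hom_app f (1 : R)) -linearZ.
by congr (hom_app f _); rewrite -[LHS]/((x : R) * 1) mulr1.
Qed.

Lemma dual_E_zero (U : lmodType R) : zero_module U -> injective_module (dual_E U).
Proof.
move=> U0; apply: zero_injective => f; apply: hom_ext => x.
by rewrite (U0 x) !linear0.
Qed.

(** Iterated cones, starting from [R] in degree 0. The new [x] is null-homotopic by moving the first
    summand to the second. *)
Lemma koszul_exists l : exists K, koszul_like l K.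
Proof.
elim: l => [|x l [K [Kfg [N KN] Kh [i [r [iK rK rE]]]]]].
  pose ob n : lmodType R := if n is _.+1 then 'rV[R]_0 else R^o.
  pose df n : {linear ob n.+1 -> ob n} := \0.
  have dfK n z : df n (df n.+1 z) = 0 by [].
  have z0 : zero_module 'rV[R]_0 by move=> v; apply/rowP => -[].
  exists (NComplex dfK); split=> //.
  - case=> [|n]; split.
    + by exists 1%N, (fun _ => 1) => a; exists (fun _ => a); rewrite big_ord1 -[RHS]/(_ * _) mulr1.
    + exact: dual_E_regular.
    + exact: row_fin_gen.
    + exact: dual_E_zero.
  - by exists 1%N; case.
  - exists idfun, idfun; split=> // z e _.
    exact: scale0r.
exists (kcone K x); split.
- case=> [|n]; first exact: Kfg.
  have [a b] := Kfg n.+1; have [c d] := Kfg n.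
  by split; [exact: fin_gen_prod | exact: dual_E_prod].
- exists N.+1; case=> // n Nn [a b].
  by rewrite (KN n.+1 _ a) ?(KN n _ b) //; lia.
- move=> y; rewrite inE => /predU1P[->|/Kh[h [h0 hn]]].
    pose s n : {linear kcone_ob K n -> kcone_ob K n.+1} :=
      match n with 0 => pairl \0 idfun | m.+1 => pairl \0 fst end.
    exists s; split=> [z|[|n] [a b]].
    + by rewrite -[RHS]/(nc_dif K 0 0 + x *: z) linear0 add0r.
    + rewrite -[RHS]/(nc_dif K 1 0 + x *: a + 0,
        0 - nc_dif K 0 a + (nc_dif K 0 a + x *: b)).
      by rewrite linear0 add0r addr0 sub0r addKr.
    + rewrite -[RHS]/(nc_dif K n.+2 0 + x *: a + 0,
        0 - nc_dif K n.+1 a + (nc_dif K n.+1 a + x *: b)).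
      by rewrite linear0 add0r addr0 sub0r addKr.
  (* The old homotopy on both summands, with the sign of the shift on the second. *)
  pose s n : {linear kcone_ob K n -> kcone_ob K n.+1} :=
    match n with
    | 0 => pairl (h 0) \0
    | m.+1 => pairl (h m.+1 \o fst) (\- (h m \o snd))
    end.
  exists s; split=> [z|[|n] [a b]].
  + by rewrite -[RHS]/(nc_dif K 0 (h 0 z) + x *: 0) scaler0 addr0 h0.
  + rewrite -[RHS]/(nc_dif K 1 (h 1 a) + x *: (- h 0 b) + h 0 (nc_dif K 0 a + x *: b),
      0 - nc_dif K 0 (- h 0 b) + 0).
    congr pair; last by rewrite addr0 sub0r -linearN opprK h0.
    by rewrite linearD linearZ /= scalerN addrACA addNr addr0 hn.
  + rewrite -[RHS]/(nc_dif K n.+2 (h n.+2 a) + x *: (- h n.+1 b) + h n.+1 (nc_dif K n.+1 a + x *: b),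
      0 - nc_dif K n.+1 (- h n.+1 b) - h n (0 - nc_dif K n b)).
    congr pair; last by rewrite !sub0r !linearN !opprK hn.
    by rewrite linearD linearZ /= scalerN addrACA addNr addr0 hn.
- exists i, r; split=> // -[a b] e eE.
  rewrite -[nc_dif _ _ _]/(nc_dif K 0 a + x *: b) linearD linearZ /=.
  rewrite scalerDl rE; last by move=> y yl; apply: eE; rewrite inE yl orbT.
  rewrite -[_ *: r b]/(x * (r b : R)) mulC -scalerA eE ?scaler0 ?addr0 //.
  by rewrite inE eqxx.
Qed.
End KoszulDual.
End Commutative.

(** * Commutative rings *)

Lemma uniform_bound (T : eqType) (l : seq T) (P : T -> nat -> Prop) :
  (forall a c d, (c <= d)%N -> P a c -> P a d) ->
  (forall a, a \in l -> exists c, P a c) -> exists c, forall a, a \in l -> P a c.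
Proof.
move=> Pmono; elim: l => [|a l IH] H; first by exists 0%N.
have [|c cP] := IH; first by move=> b bl; apply: H; rewrite inE bl orbT.
have [d dP] := H a (mem_head _ _); exists (maxn c d) => b.
rewrite inE => /predU1P[->|/cP]; first by apply: Pmono dP; apply: leq_maxr.
by apply: Pmono; apply: leq_maxl.
Qed.

Section CommutativeTorsionless.
Variable R : pzRingType.
Hypotheses (mulC : forall x y : R, x * y = y * x) (Rn : noeth R^o).

Definition annihilated (M : lmodType R) (l : seq R) : submod M.
Proof.
refine (@Submod R M (fun e => forall x, x \in l -> x *: e = 0) _ _ _).
- by move=> x _; rewrite scaler0.
- by move=> e f e0 f0 x xl; rewrite scalerDr e0 ?f0 ?addr0.
- by move=> a e e0 x xl; rewrite scalerA mulC -scalerA e0 ?scaler0.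
Defined.

Definition annihilator (M : lmodType R) (e : M) : submod R^o.
Proof.
refine (@Submod R R^o (fun a : R => a *: e = 0) _ _ _).
- exact: scale0r.
- by move=> a b ae be; rewrite scalerDl ae be addr0.
- by move=> a b be; rewrite -[a *: b]/(a * b) -scalerA be scaler0.
Defined.

Section Hull.
Variables (m : submod R^o) (E : lmodType R) (y : E).
Hypotheses (m_max : maximal_ideal m) (ym : forall a : R, a *: y = 0 <-> m a)
  (E_ess : forall e : E, e <> 0 -> exists a b, a *: e <> 0 /\ a *: e = b *: y).

(** The annihilators of [x ^+ c *: e] increase with [c], hence become stationary. If [x ^+ c *: e]
    were nonzero at that stage, some [a] would carry it to a nonzero multiple of [y]; this is killed
    by [x], so [a] already annihilates [x ^+ c *: e]. *)
Lemma hull_torsion (x : R) (e : E) : m x -> exists c, x ^+ c *: e = 0.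
Proof.
move=> mx.
have mono (a : R) c d : (c <= d)%N -> a *: (x ^+ c *: e) = 0 -> a *: (x ^+ d *: e) = 0.
  move=> cd ac; rewrite -(subnK cd) exprD -scalerA scalerA mulC -scalerA.
  by rewrite ac scaler0.
have [I IE] : exists I : submod R^o, forall a : R, I a <-> exists c, a *: (x ^+ c *: e) = 0.
  unshelve eexists (@Submod R R^o (fun a : R => exists c, a *: (x ^+ c *: e) = 0) _ _ _) => //.
  - by exists 0%N; rewrite scale0r.
  - move=> a b [c ac] [d bd]; exists (maxn c d); rewrite scalerDl.
    have -> := mono a c (maxn c d) (leq_maxl _ _) ac.
    have -> := mono b d (maxn c d) (leq_maxr _ _) bd.
    exact: addr0.
  - by move=> a b [c bc]; exists c; rewrite -[a *: b]/(a * b) -scalerA bc scaler0.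
have [l [lI lE]] := Rn I.
have [c cP] : exists c, forall a : R^o, a \in l -> (a : R) *: (x ^+ c *: e) = 0.
  apply: (@uniform_bound R^o l (fun (a : R) c => a *: (x ^+ c *: e) = 0)).
    by move=> a; apply: mono.
  by move=> a /lI/IE.
exists c; apply: contrapT => /E_ess[a [b [ae0 ae]]].
apply: ae0; apply: (lspan_sub (S := annihilator (x ^+ c *: e)) cP).
apply/lE/IE; exists c.+1; rewrite exprS -scalerA scalerA mulC -scalerA ae.
by rewrite scalerA mulC -scalerA (proj2 (ym x)) ?scaler0.
Qed.

(** Essentiality gives [a *: e] a nonzero multiple of [y], so [a] is not in [m]; an inverse of [a]
    modulo [m] recovers [e]. *)
Lemma hull_socle (e : E) : (forall x : R, m x -> x *: e = 0) -> exists b, e = b *: y.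
Proof.
move=> me; have [->|e0] := pselect (e = 0); first by exists 0; rewrite scale0r.
have [a [b [ae0 ae]]] := E_ess e0.
have [|c ca] := m_max.2 a; first by move=> /me.
exists (c * b); rewrite -scalerA -ae scalerA; apply/subr0_eq.
by rewrite -{1}(scale1r e) -scalerBl me.
Qed.

(** Exponents are raised for one generator at a time: those in [l1] have exponent [c], those in [l2]
    exponent 1. With all exponents 1 only the socle [R y] remains. *)
Lemma hull_annihilated_fg (xs : seq R) c :
  (forall x : R, m x -> lspan (xs : seq R^o) x) ->
  fg (annihilated E [seq x ^+ c | x <- xs]).
Proof.
move=> xsE; pose W l1 l2 := annihilated E ([seq x ^+ c | x <- l1] ++ l2).
suff H l1 l2 : {subset xs <= l1 ++ l2} -> fg (W l1 l2).
  by have := H xs [::]; rewrite /W !cats0; apply.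
elim: l1 l2 => [|x l1 IH] l2 xsl.
  apply: (fg_sub Rn (T := lspan_sm [:: y])).
    by exists [:: y]; split=> // a /mem_lspan.
  move=> e We; have [|b ->] := hull_socle (e := e); last by exists b; rewrite subrr.
  move=> x /xsE; apply: (lspan_sub (S := annihilator e)) => a /xsl.
  exact: We.
have Fg1 := IH (x :: l2).
(* From exponent [k] to [k.+1]: multiplication by [x ^+ k] has its kernel in the part for exponent
   [k] and its image in the part for exponent 1. *)
have Fg k : fg (annihilated E (x ^+ k :: ([seq x ^+ c | x <- l1] ++ l2))).
  elim: k => [|k IHk].
    apply: (fg_sub Rn (T := lspan_sm [::])); first by exists [::].
    by move=> e /(_ (x ^+ 0)); rewrite inE eqxx scale1r; apply.
  apply: (fg_ext Rn (f := cscale mulC E (x ^+ k))) IHk _ (Fg1 _).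
  - move=> e We xe z; rewrite inE => /predU1P[-> //|zl].
    by apply: We; rewrite inE zl orbT.
  - move=> e We z; rewrite -[cscale _ _ _ _]/(x ^+ k *: e) scalerA mem_cat inE orbCA -mem_cat.
    case/predU1P => [->|zl]; first by rewrite -exprS; apply: We; rewrite inE eqxx.
    by rewrite mulC -scalerA We ?scaler0 // inE zl orbT.
  - by move=> z /xsl; rewrite !mem_cat !inE orbCA orbA.
by apply: (fg_sub Rn (Fg c)) => e.
Qed.
End Hull.

(** * Finiteness of the cohomology of [Hom(K, E)] *)

Section KoszulCohomology.
Variables (E : lmodType R) (Einj : injective_module E) (l : seq R).
Hypothesis Vfg : fg (annihilated E l).
Variable K : ncomplex R.
Hypothesis KK : koszul_like mulC E l K.
Local Notation X q := (dual_E mulC E (K q)).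

Definition codif q : {linear X q -> X q.+1} := precomp (cact mulC E) (nc_dif K q).

Lemma codifK q f : codif q.+1 (codif q f) = 0.
Proof.
apply: hom_ext => z; rewrite -[LHS]/(hom_app f (nc_dif K q (nc_dif K q.+1 z))).
by rewrite nc_difK linear0.
Qed.

Lemma codif0 q f : codif q f = 0 -> forall z, hom_app f (nc_dif K q z) = 0.
Proof. by move=> f0 z; rewrite -[LHS]/(hom_app (codif q f) z) f0. Qed.

Fact eval_linear q (z : K q) : linear (fun f : X q => hom_app f z : E).
Proof. by []. Qed.

(** The values at [z] of elements of [S] vanishing on [zs] lie in a finitely generated module, so
    finitely many elements of [S] correct all of them. *)
Lemma vanishing_modulo q (S : submod (X q)) (zs : seq (K q)) :
  (forall f z, S f -> z \in zs -> annihilated E l (hom_app f z)) ->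
  exists G, (forall g, g \in G -> S g) /\
    forall f, S f -> exists2 g, lspan G g & forall z, z \in zs -> hom_app (f - g) z = 0.
Proof.
elim: zs => [|z zs IH] H.
  by exists [::]; split=> // f _; exists 0.
have [|G [GS GE]] := IH; first by move=> f w Sf wz; apply: H => //; rewrite inE wz orbT.
have [T TE] : exists T : submod (X q),
    forall f, T f <-> S f /\ forall w, w \in zs -> hom_app f w = 0.
  unshelve eexists (@Submod R (X q)
    (fun f => S f /\ forall w, w \in zs -> hom_app f w = 0) _ _ _) => //.
  - by split; [exact: sm0 |].
  - move=> f g [Sf f0] [Sg g0]; split=> [|w wz]; first exact: smD.
    by rewrite homDE f0 ?g0 ?addr0.
  - move=> a f [Sf f0]; split=> [|w wz]; first exact: smZ.
    by rewrite homZE f0 //; apply: scaler0.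
have [m [mT mE]] : fg (im (lin (eval_linear z)) T).
  apply: (fg_sub Rn Vfg) => _ [f /TE[Sf _] ->].
  by apply: H => //; rewrite inE eqxx.
have [h hE] : exists h : E -> X q, forall e, e \in m -> T (h e) /\ hom_app (h e) z = e.
  apply: (@seq_choice E (X q) 0 (fun e f => T f /\ hom_app f z = e)).
  by move=> e /mT[f Tf ->]; exists f.
have hT g : g \in map h m -> T g by move=> /mapP[e /hE[? _] ->].
exists (G ++ map h m); split.
  by move=> g; rewrite mem_cat => /orP[/GS|/hT/TE[]].
move=> f Sf; have [g Gg g0] := GE f Sf.
have Tfg : T (f - g).
  by apply/TE; split=> //; apply: smB => //; apply: lspan_sub Gg.
have : lspan m (hom_app (f - g) z) by apply: mE; exists (f - g).
have {1}-> : m = map (lin (eval_linear z)) (map h m).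
  by rewrite -map_comp map_id_in // => e /hE[].
move=> /lspan_mapE[k mk kE]; have Tk : T k by apply: lspan_sub mk.
exists (g + k); first by apply: (lspan_cat Gg); rewrite addrC addKr.
move=> w; rewrite inE opprD addrA => /predU1P[->|wz].
  by rewrite homDE kE; apply: subrr.
by have := smB Tfg Tk => /TE[_]; apply.
Qed.

(** By the null-homotopy, [x *: z] is a boundary when [z] is a cycle, and [f] vanishes on
    boundaries. *)
Lemma koszul_cocycle q f z : codif q.+1 f = 0 -> nc_dif K q z = 0 ->
  annihilated E l (hom_app f z).
Proof.
move=> f0 z0 x xl; have [_ _ Kh _] := KK; have [h [_ hn]] := Kh x xl.
by rewrite -linearZ /= hn z0 linear0 addr0 codif0.
Qed.

(** Up to finitely many cocycles, [f] vanishes on generators of the cycles of [K]; it then factors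
    through the differential, and injectivity of [E] makes it a coboundary. *)
Lemma koszul_homology_fg q :
  fgm (fun f : X q.+1 => codif q.+1 f = 0) (fun f => exists g, f = codif q g).
Proof.
have [Kfg _ _ _] := KK.
have [zs [zs0 zsE]] := fin_gen_noeth Rn (Kfg q.+1).1 (ker (nc_dif K q)).
have [|G [GS GE]] := @vanishing_modulo q.+1 (ker (codif q.+1)) zs.
  by move=> f z f0 /zs0; apply: koszul_cocycle.
exists G; split=> // f f0; have [g Gg g0] := GE f f0; exists g; split=> //.
have [|h hE] := inj_fac (u := nc_dif K q) (f := hom_app (f - g)) Einj.
  by move=> z /zsE; apply: (lspan_sub (S := ker (hom_app (f - g)))).
by exists (h : X q); apply: hom_ext => z; rewrite -hE.
Qed.

Lemma koszul_cocycle0_fg : fg (ker (codif 0)).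
Proof.
have [Kfg _ Kh [i [r [iK rK rE]]]] := KK.
apply: (fg_ext Rn (f := lin (eval_linear (i (1 : R))))
  (K := lspan_sm [::]) (T := annihilated E l)) => //.
- move=> f _ f0; apply: hom_ext => z.
  rewrite -(rK z) -[r z]mulr1 -[(_ * _ : R)]/((r z : R) *: (1 : R^o)) !linearZ.
  congr (_ *: _).
  by rewrite -[hom_app f _]/(lin (eval_linear (i (1 : R))) f) f0.
- by exists [::].
- move=> f f0 x xl; have [h [h0 _]] := Kh x xl.
  by rewrite -[lin _ _]/(hom_app f _) -linearZ /= h0 codif0.
Qed.
End KoszulCohomology.

Hypothesis AC : condition_AC R.

Lemma comm_torsionless (M : lmodType R) : ext_orth M -> torsionless M.
Proof.
move=> [Mfg M0] t tM; apply: contrapT => t0.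
pose P := free_resolution Rn Mfg.
have Pfg i : fin_gen (P i) by apply: free_resolution_fin_gen.
have PR i : ext_van P i.+1 R^o by apply/ext_zeroE.
have shift := AC_shift Rn AC Mfg PR.
have [|m [m_max tm]] := @maximal_ideal_exists R (annihilator t).
  by rewrite /= scale1r.
have [E [y [Einj ym E_ess]]] := injective_hull m_max.
(* The annihilator of [t] lies in [m], the annihilator of [y], so [t] to [y] is well defined on
   [R t] and extends to [M]. *)
have [f ft] : exists f : {linear M -> E}, f t = y.
  have tL : linear (fun a : R^o => (a : R) *: t) by move=> a b c; rewrite scalerDl scalerA.
  have yL : linear (fun a : R^o => (a : R) *: y) by move=> a b c; rewrite scalerDl scalerA.
  have [|f fE] := inj_fac (u := lin tL) (f := lin yL) Einj.
    by move=> a /tm /ym.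
  by exists f; have := fE (1 : R); rewrite /= /lin_fun !scale1r.
have [xs [xsm xsE]] := Rn m.
have [g [_ gE]] := (fin_genE M).1 Mfg.
have [c cP] : exists c, forall x : R, x \in xs -> forall e, e \in map f g -> x ^+ c *: e = 0.
  apply: (@uniform_bound R^o xs (fun (x : R) c => forall e, e \in map f g -> x ^+ c *: e = 0)).
    move=> x c d cd xc e eg.
    by rewrite -(subnK cd) exprD -scalerA xc ?scaler0.
  move=> x /xsm mx /=.
  apply: (@uniform_bound E (map f g) (fun (e : E) c => (x : R) ^+ c *: e = 0)).
    by move=> e c d cd ec; rewrite -(subnK cd) exprD -scalerA ec scaler0.
  by move=> e _; apply: (hull_torsion ym E_ess e mx).
pose l := [seq x ^+ c | x <- (xs : seq R)].
have fl u : annihilated E l (f u).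
  have : lspan (map f g) (f u) by apply/lspan_map/gE.
  apply: lspan_sub => e eg x /mapP[z zx ->]; exact: cP.
have Vfg : fg (annihilated E l) := hull_annihilated_fg m_max E_ess c xsE.
have [K KK] := koszul_exists mulC Einj l.
have [Kfg [n0 Kn0] Kh [i [r [iK rK rE]]]] := KK.
pose X q := dual_E mulC E (K q); pose d := @codif E K.
(* Descending induction from the degrees where [K] vanishes. Eventual vanishing passes to [N'], the
   kernel of a map from a free plus an injective module onto [N]. *)
have stage k q : (n0 <= q.+1 + k)%N -> exists (N : lmodType R) (u : {linear X q -> N}),
    [/\ forall f, u f = 0 <-> d q f = 0,
        fgm (fun _ => True) (fun x => exists f, x = u f) & ext_eventually P N].
  elim: k q => [|k IH] q qk.
    have X0 : zero_module (X q.+1).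
      move=> h; apply: hom_ext => z; rewrite (Kn0 _ _ z) ?linear0 //; lia.
    exists (X q.+1), (d q); split=> //.
      by exists [::]; split=> // x _; exists 0; split=> //; exists 0; rewrite [LHS]X0 linear0.
    by exists 0%N => j _; apply: ext_zero_module.
  have [|N [u [uE ufg [b Nb]]]] := IH q.+1; first by lia.
  have [n [N' [j [p [u' [ex u'E u'fg _]]]]]] :=
    ladder_step Rn uE ufg (@codifK E K q) (koszul_homology_fg Einj Vfg KK q).
  exists N', u'; split=> //; exists b.+1; case=> // s bs.
  apply: (ext_left ex); first exact: Nb.
  apply: ext_prod; first exact: ext_row.
  by apply: ext_injective; apply: (Kfg _).2.
have [|N [u [uE ufg [b Nb]]]] := stage n0 0; first by lia.
have [G [GV GE]] := koszul_cocycle0_fg Vfg KK.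
(* The last step has incoming differential zero, so [N'] is finitely generated outright and (AC)
   applies to it. *)
have [//||n [N' [j [p [u' [ex u'E u'fg N'l]]]]]] :=
  ladder_step Rn (d1 := \0 : {linear 'rV[R]_0 -> X 0}) uE ufg.
- by move=> x; apply: linear0.
- exists G; split=> // h /GE Gh; exists h; split=> //.
  by exists 0; rewrite subrr.
have N'fg : fin_gen N'.
  have [l' [_ l'E]] := u'fg; apply/fin_genE; exists l'; split=> // x _.
  have [z [l'z [w wE]]] := l'E x I; suff -> : x = z by [].
  by apply/subr0_eq; rewrite wE; apply/u'E.
have N'ext : forall s, ext_van P s.+1 N'.
  apply: shift => //; exists b.+1; case=> // s bs.
  apply: (ext_left ex); first exact: Nb.
  apply: ext_prod; first exact: ext_row.
  by apply: ext_injective; apply: (Kfg _).2.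
(* [f x], viewed through [r] as an element of [Hom(K_0, E)], is a cocycle because [l] kills it;
   cocycles embed in [N']. *)
have [f' f'E] : exists f' : {linear M -> N'}, forall x, f' x = 0 -> f x = 0.
  have FL x : linear (fun z : K 0 => (r z : R) *: f x).
    by move=> a z w; rewrite linearP scalerDl scalerA.
  have GL : linear (fun x : M => lin (FL x) : X 0).
    move=> a x z; apply: hom_ext => w.
    rewrite -[LHS]/((r w : R) *: f (a *: x + z)).
    rewrite -[RHS]/(a *: ((r w : R) *: f x) + (r w : R) *: f z).
    by rewrite linearP scalerDr !scalerA mulC.
  have [|f' f'E] := N'l _ (lin GL).
    by move=> x; apply: hom_ext => z; apply: rE; apply: fl.
  exists f' => x /f'E /(congr1 (fun h : X 0 => hom_app h (i (1 : R)))).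
  by rewrite -[hom_app (lin GL x) _]/((r (i (1 : R)) : R) *: f x) iK scale1r.
have [n1 [p1 p1S]] := fin_gen_cover N'fg.
have ex1 := sexact_ker p1S.
(* The first syzygy of [N'] also satisfies the vanishing, so [f'] lifts to a free module, where [t]
   goes to 0 coordinate by coordinate. *)
have [|f1 f1E] := ext1_lift ex1 f' (P := P).
  apply: shift.
    by apply/fg_smT/fin_gen_noeth => //; apply: row_fin_gen.
  by exists 1%N; case=> // s _; apply: (ext_left ex1) => //; exact: ext_row.
have : f t = 0.
  apply: f'E; rewrite -f1E; suff -> : f1 t = 0 by apply: linear0.
  apply/rowP => k; rewrite mxE.
  have kL : linear (fun x : M => f1 x 0 k : R^o) by move=> a x z; rewrite linearP !mxE.
  exact: (tM (lin kL)).
rewrite ft => y0; apply: m_max.1; apply/ym.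
by rewrite y0 scaler0.
Qed.
End CommutativeTorsionless.

(** * Complexes *)

(** Dependent recursion upwards from [c], carrying the invariant [Inv]; below [c] the values are
    arbitrary, so there [Q] has to hold for all of them. *)
Lemma int_rec (T : int -> Type) (Inv : forall i, T i -> Prop)
    (Q : forall i i1, T i -> T i1 -> Prop) (c : int) :
  (forall i, exists t : T i, True) ->
  (exists t : T c, Inv c t) ->
  (forall i i1 (t : T i) (t1 : T i1), i1 = i + 1 -> i < c -> Q i i1 t t1) ->
  (forall i i1 (t : T i), i1 = i + 1 -> Inv i t -> exists t1 : T i1, Q i i1 t t1 /\ Inv i1 t1) ->
  exists f : forall i, T i, forall i i1, i1 = i + 1 -> Q i i1 (f i) (f i1).
Proof.
move=> T0 [tc Ic] Qlt step.
have e0 : c + 0%N = c by rewrite addr0.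
have eS (p : nat) : c + p.+1 = c + p + 1 by lia.
have st (p : nat) (t : {t : T (c + p) | Inv _ t}) :
    {t1 : T (c + p.+1) | Q _ _ (projT1 t) t1 /\ Inv _ t1}.
  by apply: cid; case: t => t It; apply: step.
have [g gE] : exists g : forall p : nat, {t : T (c + p) | Inv _ t},
    forall p, Q _ _ (projT1 (g p)) (projT1 (g p.+1)).
  pose g0 : {t : T (c + 0%N) | Inv _ t} :=
    eq_rect_r (fun i => {t : T i | Inv _ t}) (exist _ tc Ic) e0.
  exists (nat_rect (fun p : nat => {t : T (c + p) | Inv _ t}) g0
    (fun p t => exist _ (projT1 (st p t)) (projT2 (st p t)).2)) => p.
  exact: (projT2 (st p _)).1.
have eI (i : int) : c <= i -> c + `|i - c|%N = i by lia.
pose f i : T i := match pselect (c <= i) with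
  | left ci => eq_rect _ T (projT1 (g `|i - c|%N)) _ (eI i ci)
  | right _ => projT1 (cid (T0 i)) end.
have fE i p (e : c + p%:Z = i) : f i = eq_rect _ T (projT1 (g p)) _ e.
  rewrite /f; case: pselect => [ci|]; last by lia.
  have pE : `|i - c|%N = p by lia.
  by case: p / pE e => e; rewrite (eq_irrelevance (eI i ci) e).
exists f => i i1 ii1; have [ci|ic] := lerP c i; last exact: Qlt.
have [p pE] : exists p : nat, c + p%:Z = i by exists `|i - c|%N; lia.
have e1 : c + p.+1%:Z = i1 by lia.
rewrite (fE i p pE) (fE i1 p.+1 e1).
by case: i1 / e1 ii1; case: i / pE ci.
Qed.

Section Complexes.
Variable R : pzRingType.
Implicit Types X Y : complex R.

Lemma cycleE X v j (x : X v) : Defs.cycle x -> cx_dif X v j x = 0.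
Proof.
move=> x0; have [<-|ne] := eqVneq (v - 1) j; first exact: x0.
by apply: cx_shape => e; move: ne; rewrite e addrK eqxx.
Qed.

Lemma boundaryE X v j (y : X j) : boundary (cx_dif X j v y).
Proof.
have [e|ne] := eqVneq j (v + 1); first by move: y; rewrite e => y; exists y.
by exists 0; rewrite linear0; apply: cx_shape; apply/eqP.
Qed.

(** Total in both degrees, so that equal but not convertible degrees such as [v] and [v + 1 - 1] can
    be mixed without transports in statements. *)
Definition cast2 X i j : {linear X i -> X j} :=
  match pselect (i = j) with
  | left e => eq_rect i (fun j => {linear X i -> X j}) idfun j e
  | right _ => \0
  end.

Lemma castxx X i (x : X i) : cast2 X i i x = x.
Proof.
by rewrite /cast2; case: pselect => // e; rewrite (eq_irrelevance e (erefl i)).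
Qed.

Lemma cast2_neq X i j (x : X i) : i <> j -> cast2 X i j x = 0.
Proof. by rewrite /cast2; case: pselect. Qed.

Lemma cast2K X i j (x : X i) : i = j -> cast2 X j i (cast2 X i j x) = x.
Proof. by move=> e; case: j / e; rewrite !castxx. Qed.

Lemma cx_dif_cast X i j l (x : X i) : i = j -> cx_dif X j l (cast2 X i j x) = cx_dif X i l x.
Proof. by move=> e; case: j / e; rewrite castxx. Qed.

Lemma cast_cx_dif X i j l (x : X i) : j = l -> cast2 X j l (cx_dif X i j x) = cx_dif X i l x.
Proof. by move=> e; case: l / e; rewrite castxx. Qed.

(** * Mapping cones *)

Section Cone.
Variables (X Y : complex R) (f : forall v, {linear X v -> Y v}).
Hypothesis fC : forall i j x, cx_dif Y i j (f i x) = f j (cx_dif X i j x).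

Definition cone_obj (v : int) : lmodType R := (Y v * X (v - 1)%R)%type.
Definition cone_dif i j : {linear cone_obj i -> cone_obj j} :=
  pairl (copairl (cx_dif Y i j) (f j \o cast2 X (i - 1) j))
        (copairl \0 (\- cx_dif X (i - 1) (j - 1))).

Lemma cone_difE i j y x : cone_dif i j (y, x) =
  (cx_dif Y i j y + f j (cast2 X (i - 1) j x), - cx_dif X (i - 1) (j - 1) x).
Proof. by congr pair; apply: add0r. Qed.

Fact cone_shape i j : i <> j + 1 -> forall x, cone_dif i j x = 0.
Proof.
move=> ij [y x]; rewrite cone_difE cx_shape // cast2_neq; last by lia.
by rewrite cx_shape ?linear0 ?addr0 ?oppr0 //; lia.
Qed.

Fact cone_difK i j l x : cone_dif j l (cone_dif i j x) = 0.
Proof.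
case: x => y x; rewrite !cone_difE linearD cx_difK add0r fC.
rewrite (linearN (cast2 X (j - 1) l)) (linearN (f l)).
rewrite (linearN (cx_dif X (j - 1) (l - 1))) cx_difK !oppr0.
congr pair; apply/eqP; rewrite subr_eq0; apply/eqP; congr (f l _).
have [e|ne] := eqVneq (i - 1) j; have [e'|ne'] := eqVneq (j - 1) l.
- by rewrite (cast_cx_dif _ e') (cx_dif_cast _ _ e).
- rewrite (cx_dif_cast _ _ e) (cast2_neq (i := j - 1)); last exact/eqP.
  by apply: cx_shape; move/eqP: ne'; lia.
- rewrite (cast_cx_dif _ e') (cast2_neq (i := i - 1)) ?linear0; last exact/eqP.
  by apply/esym/cx_shape; move/eqP: ne; lia.
- by rewrite !cast2_neq ?linear0 //; apply/eqP.
Qed.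

Definition cone : complex R := Complex cone_shape cone_difK.

Lemma cone_acyclic : is_quasi_iso f -> forall v, zero_homology cone v.
Proof.
move=> fq v [y x]; rewrite /Defs.cycle -[cx_dif cone _ _ _]/(cone_dif v (v - 1) (y, x)) cone_difE.
rewrite castxx => -[dy /eqP]; rewrite oppr_eq0 => /eqP dx.
have [fI _] := fq (v - 1); have [|z zx] := fI x dx.
  have -> : f (v - 1) x = - cx_dif Y v (v - 1) y by apply/eqP; rewrite -addr_eq0 [X in X == _]addrC dy.
  by rewrite -linearN; apply: boundaryE.
pose c := cast2 X (v - 1 + 1) v z.
have dc : cx_dif X v (v - 1) c = x by rewrite zx; apply: cx_dif_cast; lia.
have [_ fS] := fq v; have [|w wc [y2 yE]] := fS (y + f v c).
  by rewrite /Defs.cycle linearD fC dc.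
exists (y2, cast2 X v (v + 1 - 1) (w - c)).
rewrite -[RHS]/(cone_dif (v + 1) v (y2, cast2 X v (v + 1 - 1) (w - c))) cone_difE.
rewrite cast2K; last by lia.
congr pair; first by rewrite -yE linearB addrA subrK addrK.
by rewrite cx_dif_cast; [rewrite linearB wc sub0r opprK dc | lia].
Qed.
End Cone.

Definition sgn (e : bool) (M : lmodType R) (x : M) := if e then - x else x.

Lemma sgn_linear e (M N : lmodType R) (f : {linear M -> N}) x : f (sgn e x) = sgn e (f x).
Proof. by case: e => //=; rewrite linearN. Qed.
Lemma sgnK e (M : lmodType R) : involutive (@sgn e M).
Proof. by case: e => x //=; rewrite opprK. Qed.
Lemma sgn0 e (M : lmodType R) : sgn e (0 : M) = 0.
Proof. by case: e => //=; rewrite oppr0. Qed.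
Lemma sgnB e (M : lmodType R) (x y : M) : sgn e (x - y) = sgn e x - sgn e y.
Proof. by case: e => //=; rewrite opprD. Qed.
Lemma sgnD e (M : lmodType R) (x y : M) : sgn e (x + y) = sgn e x + sgn e y.
Proof. by case: e => //=; rewrite opprD. Qed.
Lemma sgnN e (M : lmodType R) (x : M) : sgn (~~ e) x = - sgn e x.
Proof. by case: e => //=; rewrite opprK. Qed.
Lemma sgnE n (M : lmodType R) (x : M) : (-1) ^+ n *: x = sgn (odd n) x.
Proof. by rewrite -signr_odd scaler_sign. Qed.

Fact sgnl_linear e (M : lmodType R) : linear (@sgn e M).
Proof. by case: e => // a x y /=; rewrite opprD scalerN. Qed.
Definition sgnl e (M : lmodType R) : {linear M -> M} := lin (@sgnl_linear e M).

(** Homogeneous maps of degree [n] are given by families [forall i j], whose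
    entries with [j <> i + n] are irrelevant; the sign is decoupled from [n]. *)
Definition fam X Y := forall i j : int, {linear X i -> Y j}.

Definition fam_cycle X Y (n : int) (e : bool) (chi : fam X Y) : Prop :=
  forall i j i' j', j = i + n -> i = i' + 1 -> j = j' + 1 -> forall x,
    cx_dif Y j j' (chi i j x) = sgn e (chi i' j' (cx_dif X i i' x)).

(** [h] has degree [n + 1], and the sign [- (-1) ^ (n + 1)] of its second term is again
    [(-1) ^ n]. *)
Definition fam_homotopy X Y (n : int) (e : bool) (chi h : fam X Y) : Prop :=
  forall i j i' j1, j = i + n -> i = i' + 1 -> j1 = j + 1 -> forall x,
    chi i j x = cx_dif Y j1 j (h i j1 x) + sgn e (h i' j (cx_dif X i i' x)).

Lemma fam_choice (T : int -> int -> Type) (P : forall i j, T i j -> Prop) :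
  (forall i j, exists t, P i j t) -> exists f : forall i j, T i j, forall i j, P i j (f i j).
Proof.
move=> H; exists (fun i j => projT1 (cid (H i j))) => i j.
exact: (projT2 (cid (H i j))).
Qed.

Lemma fam_cycle_projective X Y n e c (chi : fam X Y) :
  (forall i, projective (X i)) -> (forall i, i < c -> zero_module (X i)) ->
  (forall v, zero_homology Y v) -> fam_cycle n e chi -> exists h, fam_homotopy n e chi h.
Proof.
move=> Xproj Xc Yac chiC.
pose T i := forall j, {linear X i -> Y j}.
pose Inv i (t : T i) := forall i1 j1 j, i1 = i + 1 -> j1 = i1 + n -> j1 = j + 1 -> forall x,
  cx_dif Y j1 j (chi i1 j1 x - sgn e (t j1 (cx_dif X i1 i x))) = 0.
pose Q i i1 (t : T i) (t1 : T i1) := forall j j1, j = i1 + n -> j1 = j + 1 -> forall x,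
  chi i1 j x = cx_dif Y j1 j (t1 j1 x) + sgn e (t j (cx_dif X i1 i x)).
(* Start in degree [c - 1], where [X] is zero and the invariant reduces to [chi] being a cycle. *)
have [||||h hE] := @int_rec T Inv Q (c - 1).
- by move=> i; exists (fun j => \0).
- exists (fun j => \0) => i1 j1 j ei ej1 ej x.
  have x0 : cx_dif X i1 (c - 1) x = 0 by apply: Xc; lia.
  by rewrite /= sgn0 subr0 (chiC _ _ _ _ ej1 ei ej) x0 linear0 sgn0.
- move=> i i1 t t1 ei ic j j1 ej ej1 x.
  have -> : x = 0 by apply: Xc; lia.
  by rewrite !linear0 sgn0 addr0.
- move=> i i1 t ei It.
  pose P1 j1 (u : {linear X i1 -> Y j1}) := forall j, j = i1 + n -> j1 = j + 1 -> forall x,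
      cx_dif Y j1 j (u x) = chi i1 j x - sgn e (t j (cx_dif X i1 i x)).
  have H j1 : exists u, P1 j1 u.
    have [e1|ne] := eqVneq j1 (i1 + n + 1); last first.
      by exists \0 => j ej ej1; move/eqP: ne; lia.
    subst j1; pose g := chi i1 (i1 + n) \- (sgnl e _ \o (t (i1 + n) \o cx_dif X i1 i)).
    have [x|u uE] := @proj_fac R (X i1) (Y (i1 + n + 1)) (Y (i1 + n)) (cx_dif Y _ (i1 + n)) g (Xproj i1).
      have [|y yE] := Yac _ (g x); last by exists y.
      by apply: It => //; lia.
    exists u => j ej ej1 x; rewrite ej; exact: uE.
  have {H} H j1 : {u | P1 j1 u} by apply: cid.
  exists (fun j1 => projT1 (H j1)); split.
    move=> j j1 ej ej1 x; by rewrite (projT2 (H j1) j) // subrK.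
  move=> i2 j2 j ei2 ej2 ej x.
  rewrite linearB (chiC _ _ _ _ ej2 ei2 ej) sgn_linear (projT2 (H j2) j) //; last by lia.
  by rewrite cx_difK linear0 sgn0 subr0 subrr.
exists h => i j i' j1 ej ei ej1 x; exact: hE.
Qed.

(** The homotopy is built downwards in the degree of [X], hence by recursion on the negated degree.
    Below [c], where [X] may fail to be exact, [c + n <= a] makes the target zero. *)
Lemma fam_cycle_injective X Y n e a b c (chi : fam X Y) :
  (forall j, injective_module (Y j)) ->
  (forall j, j < a -> zero_module (Y j)) -> (forall j, b < j -> zero_module (Y j)) ->
  (forall i, c <= i -> zero_homology X i) -> c + n <= a ->
  fam_cycle n e chi -> exists h, fam_homotopy n e chi h.
Proof.
move=> Yinj Ya Yb Xac cna chiC.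
pose T (i : int) := forall j, {linear X (- i) -> Y j}.
pose Inv i (t : T i) := forall i1 j1 j, i1 = - i + 1 -> j = - i + n -> j1 = j + 1 -> forall x,
  chi (- i) j (cx_dif X i1 (- i) x) = cx_dif Y j1 j (t j1 (cx_dif X i1 (- i) x)).
pose Q i i1 (t : T i) (t1 : T i1) := forall j j1, j = - i + n -> j1 = j + 1 -> forall x,
  chi (- i) j x = cx_dif Y j1 j (t j1 x) + sgn e (t1 j (cx_dif X (- i) (- i1) x)).
(* Here [X] has degree [b + 1 - n], so the target has degree [b + 1] and vanishes. *)
have [||||h hE] := @int_rec T Inv Q (n - b - 1).
- by move=> i; exists (fun j => \0).
- exists (fun j => \0) => i1 j1 j ei ej ej1 x.
  have Y0 : zero_module (Y j) by apply: Yb; lia.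
  by rewrite [LHS]Y0 [RHS]Y0.
- move=> i i1 t t1 ei ib j j1 ej ej1 x.
  have Y0 : zero_module (Y j) by apply: Yb; lia.
  by rewrite [LHS]Y0 [RHS]Y0.
- move=> i i1 t ei It.
  pose P1 j (u : {linear X (- i1) -> Y j}) := j = - i + n -> forall j1 x, j1 = j + 1 ->
      u (cx_dif X (- i) (- i1) x) = sgn e (chi (- i) j x - cx_dif Y j1 j (t j1 x)).
  have H j : exists u, P1 j u.
    have [ej|ne] := eqVneq j (- i + n); last by exists \0 => ej; move/eqP: ne.
    have [ci|ic] := lerP c (- i); last first.
      have Y0 : zero_module (Y j) by apply: Ya; lia.
      by exists \0 => _ j1 x _; rewrite [LHS]Y0 [RHS]Y0.
    pose g := sgnl e _ \o (chi (- i) j \- (cx_dif Y (j + 1) j \o t (j + 1))).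
    have [x x0|u uE] := @inj_fac R _ _ _ (cx_dif X (- i) (- i1)) g (Yinj j).
      have [|y ->] := Xac _ ci x; first by rewrite /Defs.cycle (_ : - i - 1 = - i1) //; lia.
      rewrite -[LHS]/(sgn e (chi (- i) j (cx_dif X (- i + 1) (- i) y) - cx_dif Y (j + 1) j
        (t (j + 1) (cx_dif X (- i + 1) (- i) y)))).
      by rewrite -It // subrr sgn0.
    by exists u => _ j1 x ->; apply: uE.
  have {H} H j : {u | P1 j u} by apply: cid.
  exists (fun j => projT1 (H j)); split.
    by move=> j j1 ej ej1 x; rewrite (projT2 (H j) ej _ _ ej1) sgnK addrC subrK.
  move=> i2 j1 j ei2 ej ej1 x.
  have ei' : i2 = - i by lia.
  move: x; rewrite ei' => x; rewrite (projT2 (H j1) _ (j1 + 1)) //; last by lia.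
  rewrite sgn_linear linearB cx_difK subr0.
  rewrite (chiC (- i) j1 (- i1) j) ?sgnK //; lia.
exists (fun i j => h (- i) j \o cast2 X i (- - i)) => i j i' j1 ej ei ej1 x.
have [m em] : exists m, i = - m by exists (- i); lia.
have [m' em'] : exists m, i' = - m by exists (- i'); lia.
have {ei} ei : m' = m + 1 by lia.
by subst i i'; rewrite /= (opprK m) (opprK m') !castxx; apply: hE.
Qed.
End Complexes.

Section QuasiIso.
Variable R : pzRingType.

Definition chain_map (X Y : complex R) (f : forall v, {linear X v -> Y v}) :=
  forall i j x, cx_dif Y i j (f i x) = f j (cx_dif X i j x).

Lemma quasi_iso_comp (X Y Z : complex R) (f : forall v, {linear X v -> Y v})
    (g : forall v, {linear Y v -> Z v}) :
  chain_map f -> chain_map g -> is_quasi_iso f -> is_quasi_iso g ->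
  is_quasi_iso (fun v => g v \o f v : {linear X v -> Z v}).
Proof.
move=> fC gC fq gq v; have [fI fS] := fq v; have [gI gS] := gq v; split=> [x x0 gfx|z z0].
  apply: fI => //; apply: gI => //.
  by rewrite /Defs.cycle fC x0 linear0.
have [y y0 [w wE]] := gS z z0; have [x x0 [u uE]] := fS y y0.
exists x => //; exists (w + g (v + 1) u).
by rewrite linearD -wE gC -uE linearB addrA subrK.
Qed.

Lemma quasi_iso_fin_gen (X Y : complex R) (f : forall v, {linear X v -> Y v}) v :
  is_quasi_iso f -> chain_map f -> fin_gen_homology Y v -> fin_gen_homology X v.
Proof.
move=> fq fC [n [g [g0 gE]]]; have [fI fS] := fq v.
have /choice[h hE] (i : 'I_n) : exists x, Defs.cycle x /\ boundary (g i - f v x).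
  by have [x x0 b] := fS _ (g0 i); exists x.
exists n, h; split=> [i|x x0]; first exact: (hE i).1.
have [|c [w wE]] := gE (f v x); first by rewrite /Defs.cycle fC x0 linear0.
exists c; apply: fI.
  rewrite /Defs.cycle linearB x0 sub0r linear_sum big1 ?oppr0 // => i _.
  by rewrite linearZ /= (hE i).1 scaler0.
have /choice[u uE] i := (hE i).2.
exists (w + \sum_i c i *: u i); rewrite linearB linearD -wE.
have -> : cx_dif Y (v + 1) v (\sum_i c i *: u i) =
    \sum_i c i *: g i - f v (\sum_i c i *: h i).
  rewrite (linear_sum (cx_dif Y (v + 1) v)) (linear_sum (f v)) -sumrB.
  apply: eq_bigr => i _.
  by rewrite (linearZ_LR (cx_dif Y (v + 1) v)) (linearZ_LR (f v)) /= -uE scalerBr.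
by rewrite addrA subrK.
Qed.

Lemma quasi_iso_zero_homology (X Y : complex R) (f : forall v, {linear X v -> Y v}) v :
  is_quasi_iso f -> chain_map f -> zero_homology Y v -> zero_homology X v.
Proof.
move=> fq fC Y0 x x0; apply: (fq v).1 => //; apply: Y0.
by rewrite /Defs.cycle fC x0 linear0.
Qed.
End QuasiIso.

(** * Exactness of [Hom(M, X)] in large degrees *)

Section Exactness.
Variable R : pzRingType.

Definition cyc (X : complex R) (v : int) : lmodType R := smT (ker (cx_dif X v (v - 1))).

Lemma cycP (X : complex R) v (x : cyc X v) j : cx_dif X v j (smval _ x) = 0.
Proof. exact: (cycleE j (smvalP x)). Qed.

Lemma cyc_sexact (X : complex R) v : zero_homology X v ->
  exists q : {linear X (v + 1) -> cyc X v},
    sexact (smval (ker (cx_dif X (v + 1) (v + 1 - 1)))) q /\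
    forall x, smval _ (q x) = cx_dif X (v + 1) v x.
Proof.
move=> X0.
have [||q qE] := @fac_inj _ (X (v + 1)) _ _ (smval (ker (cx_dif X v (v - 1))))
    (cx_dif X (v + 1) v).
- exact: smval_inj.
- by move=> x; apply: smvalK; apply: cx_difK.
exists q; split=> //; split; first exact: smval_inj.
  move=> y; have [x e] := X0 _ (smvalP y); exists x.
  by apply: smval_inj; rewrite qE e.
move=> x; split=> [qx|[y ->]].
  by apply: smvalK; apply: cycleE; rewrite /Defs.cycle addrK -qE qx linear0.
by apply: smval_inj; rewrite qE linear0 cycP.
Qed.

Hypotheses (Rn : noeth R^o) (AC : condition_AC R).
Variables (X Y : complex R) (f : forall v, {linear X v -> Y v}).
Hypotheses (fC : chain_map f) (fq : is_quasi_iso f).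
Variables (c b : int).
Hypotheses (Xc : forall v, v < c -> zero_module (X v))
  (Yc : forall v, v < c -> zero_module (Y v))
  (Yb : forall v, b < v -> zero_module (Y v))
  (Xb : forall v, b < v -> zero_homology X v)
  (Xfg : forall v, fin_gen_homology X v)
  (Xproj : forall v, projective (X v)) (Yinj : forall v, injective_module (Y v)).

(** The ladder climbs from below [c], where [X] is zero. It stays among projective modules: the
    surjection onto the projective [N] splits, so the next module is a summand of a free module plus
    a term of [X]. *)
Lemma ladder_projective v : exists (N : lmodType R) (u : {linear X (v + 1) -> N}),
  [/\ projective N, forall x, u x = 0 <-> cx_dif X (v + 1) v x = 0 &
      fgm (fun _ => True) (fun y => exists x, y = u x)].
Proof.
have base w : w < c -> exists (N : lmodType R) (u : {linear X (w + 1) -> N}),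
  [/\ projective N, forall x, u x = 0 <-> cx_dif X (w + 1) w x = 0 &
      fgm (fun _ => True) (fun y => exists x, y = u x)].
  move=> wc; exists (X w), (cx_dif X (w + 1) w); split=> //.
  exists [::]; split=> // x _; exists 0; split=> //; exists 0.
  by rewrite linear0 subr0; apply: Xc.
have [vc|cv] := ltrP v c; first exact: base.
have [p ->] : exists p : nat, v = c - 1 + p%:Z by exists (absz (v - (c - 1))%R); lia.
elim: p {v cv} => [|p [N [u [Nproj uE ufg]]]]; first by apply: base; lia.
have -> : c - 1 + p.+1%:Z = c - 1 + p%:Z + 1 by lia.
move: (c - 1 + p%:Z) u uE ufg => v u uE ufg.
have [||n [N' [j [q [u' [[jI qS jE] u'E u'fg _]]]]]] :=
    ladder_step Rn (d1 := cx_dif X (v + 1 + 1) (v + 1)) uE ufg.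
- by move=> x; apply: cx_difK.
- have [n [g [g0 gE]]] := Xfg (v + 1); exists (codom g); split.
    by move=> _ /codomP[i ->]; apply: cycleE.
  move=> x x0; have [|d [y yE]] := gE x; first by apply: cycleE; rewrite /Defs.cycle addrK.
  by exists (\sum_i d i *: g i); split; [exact: span_codom | exists y].
exists N', u'; split=> //.
have [s sE] := proj_fac (f := idfun) Nproj qS.
have [|r rE] := fac_inj (f := idfun \- (s \o q)) jI.
  by move=> x /=; apply/jE; rewrite linearB sE subrr.
apply: (@retract_projective _ _ _ j r).
  move=> x; apply: jI; rewrite rE /=.
  have -> : q (j x) = 0 by apply/jE; exists x.
  by rewrite linear0 subr0.
by apply: prod_projective; [exact: row_projective | exact: Xproj].
Qed.

Variables (M : lmodType R) (P : proj_resolution M).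
Hypotheses (Mfg : fin_gen M) (MR : forall i, ext_van P i.+1 R^o)
  (Pfg : forall i, fin_gen (P i)).
Local Notation ev := (ext_eventually P).

Lemma ext_X i v : ext_van P i.+1 (X v).
Proof. exact: ext_projective. Qed.

(** Terms of the cone are injective plus projective, hence without higher Ext from [M]. Climbing the
    acyclic cone from zero cycles, the threshold grows by one with each degree. *)
Lemma cone_cycles_eventually v : ev (cyc (cone fC) v).
Proof.
have base w : w < c -> ev (cyc (cone fC) w).
  move=> wc; exists 0%N => i _; apply: ext_zero_module => -[[y x] yx].
  apply: val_inj => /=; congr pair; first exact: Yc.
  by apply: Xc; lia.
have [vc|cv] := ltrP v c; first exact: base.
have [p ->] : exists p : nat, v = c - 1 + p%:Z by exists (absz (v - (c - 1))%R); lia.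
elim: p {v cv} => [|p [m mE]]; first by apply: base; lia.
have -> : c - 1 + p.+1%:Z = c - 1 + p%:Z + 1 by lia.
have [q [ex _]] := cyc_sexact (@cone_acyclic _ _ _ f fC fq (c - 1 + p%:Z)).
exists m.+1; case=> // i mi; apply: (ext_left ex); first exact: mE.
apply: ext_prod; last exact: ext_X.
exact: ext_injective.
Qed.

(** Above [b] the complex [Y] is zero, so the cone is [X] shifted by one. *)
Lemma cycles_eventually v : b < v -> ev (cyc X v).
Proof.
move=> bv; have [m mE] := cone_cycles_eventually (v + 1); exists m => i /mE.
have sL : linear (fun x : cyc X v => (0, cast2 X v (v + 1 - 1) (smval _ x)) : cone fC (v + 1)).
  move=> a x y; rewrite !linearP; congr pair.
  by rewrite -[RHS]/(a *: 0 + 0) scaler0 addr0.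
have rL : linear (fun x : cone fC (v + 1) => cast2 X (v + 1 - 1) v x.2).
  by move=> a x y; rewrite -linearP.
have e : v = v + 1 - 1 by lia.
have [||s sE] := @fac_inj _ _ _ _ (smval (ker (cx_dif (cone fC) (v + 1) (v + 1 - 1)))) (lin sL).
- exact: smval_inj.
- move=> x; apply: smvalK.
  rewrite -[ker _ _]/(cone_dif f (v + 1) (v + 1 - 1) (0, cast2 X v (v + 1 - 1) (smval _ x)) = 0).
  rewrite cone_difE linear0 add0r (cx_dif_cast _ _ e) cycP oppr0; congr pair.
  by apply: Yb; lia.
have [||r rE] := @fac_inj _ _ _ _ (smval (ker (cx_dif X v (v - 1))))
    (lin rL \o smval (ker (cx_dif (cone fC) (v + 1) (v + 1 - 1)))).
- exact: smval_inj.
- move=> x; apply: smvalK; have := smvalP x.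
  rewrite -[ker _ _]/(cone_dif f (v + 1) (v + 1 - 1) (smval _ x) = 0).
  rewrite -[ker _ _]/(cx_dif X v (v - 1) (cast2 X (v + 1 - 1) v (smval _ x).2) = 0).
  case: (smval _ x) => y z; rewrite cone_difE => -[_ /eqP].
  rewrite oppr_eq0 => /eqP z0; rewrite (cx_dif_cast _ _ (esym e)).
  by apply: cycleE; exact: z0.
apply: (@ext_retract _ _ _ _ _ _ s r) => x.
apply: smval_inj; rewrite rE -[LHS]/(cast2 X (v + 1 - 1) v (smval _ (s x)).2) sE.
by rewrite -[LHS]/(cast2 X (v + 1 - 1) v (cast2 X v (v + 1 - 1) (smval _ x))) cast2K.
Qed.

(** The boundaries [B_v = Z_v] embed in the projective module [N] with finitely
    generated cokernel. *)
Lemma cycles_ext2 v i : b < v -> ext_van P i.+2 (cyc X v).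
Proof.
move=> bv; have [N [u [Nproj uE [l [_ lE]]]]] := ladder_projective v.
have [q [[_ qS _] qE]] := cyc_sexact (Xb bv).
have q0 x : q x = 0 <-> cx_dif X (v + 1) v x = 0.
  rewrite -qE; split=> [->|]; first exact: linear0.
  by rewrite -[X in _ = X](linear0 (smval (ker (cx_dif X v (v - 1))))) => /smval_inj.
have [|beta bE] := fac_surj (f := u) qS; first by move=> x /q0 /uE.
pose S := im u (smfull _).
have ex : sexact beta (qproj S).
  split; last first.
  - move=> x; split=> [/qproj_eq0[z _ ->]|[y ->]]; first by exists (q z).
    have [z <-] := qS y; apply/qproj_eq0; exists z => //.
  - exact: qproj_surj.
  move=> x y xy; apply/subr0_eq; have [z zE] := qS (x - y).
  rewrite -zE; apply/q0/uE; rewrite -bE zE linearB xy subrr //.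
have Lfg : fin_gen (quot S).
  apply/fin_genE; exists (map (qproj S) l); split=> // x _.
  have [y <-] := qproj_surj x; have [z [lz [w wE]]] := lE y I.
  suff -> : qproj S y = qproj S z by apply: lspan_map.
  by apply/subr0_eq; rewrite -linearB; apply/qproj_eq0; exists w.
have NE j : ext_van P j.+1 N by apply: ext_projective.
(* Eventual vanishing passes from the cycles to the cokernel, becomes vanishing in all positive
   degrees by (AC), and returns to the cycles with the degree raised by one. *)
have [m mE] := cycles_eventually bv.
apply: (ext_left ex) => //.
apply: (AC_shift Rn AC Mfg MR Lfg); exists m => j mj.
by apply: (ext_right ex) => //; apply: mE; lia.
Qed.

(** Moving up one degree in the exact part of [X] trades [Ext^1] of these cycles for [Ext^2] of the
    next ones. *)
Lemma cycles_ext1 v : b < v -> ext_van P 1 (cyc X v).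
Proof.
move=> bv; have [q [ex _]] := cyc_sexact (Xb bv).
by apply: (ext_right ex); [exact: ext_X | apply: cycles_ext2; lia].
Qed.

Lemma hom_exact v (g : {linear M -> X v}) : b < v ->
  (forall x, cx_dif X v (v - 1) (g x) = 0) ->
  exists g' : {linear M -> X (v + 1)}, forall x, g x = cx_dif X (v + 1) v (g' x).
Proof.
move=> bv g0; have [q [ex qE]] := cyc_sexact (Xb bv).
have [||h hE] := @fac_inj _ _ _ _ (smval (ker (cx_dif X v (v - 1)))) g.
- exact: smval_inj.
- by move=> x; apply/smvalK/g0.
have [|g' g'E] := ext1_lift ex h (P := P); first by apply: cycles_ext1; lia.
by exists g' => x; rewrite -qE g'E hE.
Qed.
End Exactness.

(** * Lifting chain maps along a quasi-isomorphism *)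

Section QuasiIsoLift.
Variables (R : pzRingType) (X D Y : complex R) (f : forall v, {linear D v -> Y v}).
Hypotheses (fC : chain_map f) (fq : is_quasi_iso f) (c : int).
Hypotheses (Xproj : forall i, projective (X i)) (Xc : forall i, i < c -> zero_module (X i)).

Lemma cast_fam (g : fam X D) i j l x : j = l -> cast2 D j l (g i j x) = g i l x.
Proof. by move=> e; case: l / e; rewrite castxx. Qed.

(** The pair [(chi, 0)] is a cycle of maps into the acyclic cone, hence null-homotopic; the two
    components of the homotopy are [h] and [g]. *)
Lemma quasi_iso_lift n e (chi : fam X Y) : fam_cycle n e chi ->
  exists (g : fam X D) (h : fam X Y), fam_cycle n e g /\
    fam_homotopy n e (fun i j => chi i j \- (f j \o g i j)) h.
Proof.
move=> chiC.
have [||H HE] := @fam_cycle_projective R X (cone fC) n e c (fun i j => pairl (chi i j) \0) Xproj Xc.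
- exact: cone_acyclic.
- move=> i j i' j' ej ei ej' x.
  rewrite -[LHS]/(cone_dif f j j' (chi i j x, 0)) cone_difE !linear0 addr0 ?oppr0 (chiC _ _ _ _ ej ei ej').
  by case: (e) => //=; rewrite -[RHS]/(- chi i' j' _, - 0) oppr0.
have HE1 i j i' j1 : j = i + n -> i = i' + 1 -> j1 = j + 1 -> forall x,
    chi i j x = cx_dif Y j1 j (H i j1 x).1 + f j (cast2 D (j1 - 1) j (H i j1 x).2)
      + sgn e (H i' j (cx_dif X i i' x)).1 /\
    cx_dif D (j1 - 1) (j - 1) (H i j1 x).2 = sgn e (H i' j (cx_dif X i i' x)).2.
  move=> ej ei ej1 x; have := HE _ _ _ _ ej ei ej1 x.
  rewrite -[LHS]/(chi i j x, 0) -[cx_dif (cone fC) _ _ _]/(cone_dif f j1 j (H i j1 x)).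
  case: (H i j1 x) => y z; rewrite cone_difE; case: (H i' j _) => y' z' e0.
  have := congr1 fst e0; have := congr1 snd e0; case: (e) => /= [e2 e1|e2 e1]; split=> //.
  - by apply/eqP; rewrite -addr_eq0 -oppr_eq0 opprD; apply/eqP/esym.
  - by apply/eqP; rewrite eq_sym -subr_eq0 [X in X == _]addrC; apply/eqP/esym.
exists (fun i j => cast2 D (j + 1 - 1) j \o (snd \o H i (j + 1))), (fun i j => fst \o H i j).
split=> [i j i' j' ej ei ej' x | i j i' j1 ej ei ej1 x] /=.
  have ej0 : j + 1 - 1 = j by lia.
  rewrite (cx_dif_cast _ _ ej0) -ej'.
  have [_ H2] := HE1 i j i' (j + 1) ej ei erefl x.
  rewrite -sgn_linear -H2 cast_cx_dif //; lia.
subst j1; have [-> _] := HE1 i j i' (j + 1) ej ei erefl x.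
by rewrite addrAC addrK.
Qed.

(** Now [(h, - g)], of degree [n + 1], is the cycle of maps into the cone; its null-homotopy has
    [h'] as second component. *)
Lemma quasi_iso_lift_homotopy n e (g : fam X D) (h : fam X Y) : fam_cycle n e g ->
  fam_homotopy n e (fun i j => f j \o g i j) h -> exists h', fam_homotopy n e g h'.
Proof.
move=> gC hE.
have [||H HE] := @fam_cycle_projective R X (cone fC) (n + 1) (~~ e) c
   (fun i j => pairl (h i j) (\- g i (j - 1))) Xproj Xc.
- exact: cone_acyclic.
- move=> i j i' j' ej ei ej' x; rewrite ej' in ej *.
  rewrite -[LHS]/(cone_dif f (j' + 1) j' (h i (j' + 1) x, - g i (j' + 1 - 1) x)) cone_difE.
  have ej0 : j' + 1 - 1 = j' by lia.
  have ej1 : j' = i + n by lia.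
  have h1 := hE i j' i' (j' + 1) ej1 ei erefl x.
  rewrite linearN linearN (cast_fam _ _ ej0) -[f j' (g i j' x)]/((f j' \o g i j') x) h1.
  rewrite opprD addNKr; have -> : cx_dif D (j' + 1 - 1) (j' - 1) (- g i (j' + 1 - 1) x) =
      - sgn e (g i' (j' - 1) (cx_dif X i i' x)).
    by rewrite linearN (gC i _ i' (j' - 1)) //; lia.
  rewrite opprK -[RHS]/(sgn (~~ e) (_, _)).
  by case: (e) => /=; rewrite ?opprK -?[RHS]/(- _, - - _) ?opprK.
exists (fun i j => cast2 D (j + 1 - 1) j \o (snd \o H i (j + 1))) => i j i' j1 ej ei ej1 x.
subst j1; have ej0 : j + 1 - 1 = j by lia.
have := HE i (j + 1) i' (j + 1 + 1) _ ei erefl x => /(_ ltac:(lia)).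
rewrite -[LHS]/(h i (j + 1) x, - g i (j + 1 - 1) x).
rewrite -[cx_dif (cone fC) _ _ _]/(cone_dif f (j + 1 + 1) (j + 1) (H i (j + 1 + 1) x)) /=.
case: (H i (j + 1 + 1) x) => y z; rewrite cone_difE.
case: (H i' (j + 1) _) => y' z' /(congr1 snd) /= E.
have {E} : g i (j + 1 - 1) x = cx_dif D (j + 1 + 1 - 1) (j + 1 - 1) z + sgn e z'.
  apply: oppr_inj; rewrite E opprD; congr (_ + _); by case: (e); rewrite /= ?opprK.
move=> /(congr1 (cast2 D (j + 1 - 1) j)).
rewrite (cast_fam _ _ ej0) => ->; rewrite linearD sgn_linear (cast_cx_dif _ ej0).
rewrite cx_dif_cast //; lia.
Qed.
End QuasiIsoLift.

(** * Dualizing complexes *)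

Lemma fam_of_hom_boundary (R : pzRingType) (X Y : complex R) n (phi : hom_deg X Y n) :
  hom_boundary phi -> exists h : fam X Y, forall i j i' j1 (e : j = i + n),
    i = i' + 1 -> j1 = j + 1 -> forall x,
    phi i j e x = cx_dif Y j1 j (h i j1 x) + sgn (odd `|n|) (h i' j (cx_dif X i i' x)).
Proof.
move=> [psi psiE].
exists (fun i j => match pselect (j = i + (n + 1)) with
  | left e => psi i j e | right _ => \0 end) => i j i' j1 e ei ej1 x.
have e1 : j1 = i + (n + 1) by lia.
have e2 : j = i' + (n + 1) by lia.
rewrite (psiE i j1 i' j e e1 e2 ei) sgnE.
have -> : odd `|(n + 1)%R| = ~~ odd `|n| by lia.
rewrite sgnN opprK; case: pselect => // e1'; case: pselect => // e2'.
by rewrite (eq_irrelevance e1 e1') (eq_irrelevance e2 e2').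
Qed.

Lemma subr_swap (V : zmodType) (a b c d : V) : a - b = c - d -> a - c = b - d.
Proof.
by move=> e; rewrite -(subrK b a) e addrC -[c - d + b]addrA addKr addrC.
Qed.

Section Dualizing.
Variables (k : comPzRingType) (A : algType k).

Section BimoduleAction.
Variable B : bimodule A.

Fact bract_linear (a : A^c) : linear (fun x : B => ract x a).
Proof. by move=> c x y; rewrite ractDl lractA. Qed.

Definition bract : raction A^c B :=
  @RAction A A^c B (fun a x => ract x a) bract_linear
    (fun a b x => ractDr x a b) (fun a b x => ractA x b a) (@ract1 k A B).
End BimoduleAction.

Section HomComplex.
Variables (M : lmodType A) (X : bimod_complex A).

Definition hom_obj (v : int) : lmodType A^c := homm (bract (X v)) M.

Fact hom_dif_subproof i j (s : A^c) (y : X i) :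
  bc_dif X i j (bract (X i) s y) = bract (X j) s (bc_dif X i j y).
Proof. exact: bimod_fun_ract. Qed.

Definition hom_dif i j : {linear hom_obj i -> hom_obj j} :=
  @postcomp A A^c (X i) (bract (X i)) (X j) (bract (X j)) M (bc_dif X i j)
    (@hom_dif_subproof i j).

Lemma hom_difE i j f x : hom_app (hom_dif i j f) x = bc_dif X i j (hom_app f x).
Proof. by []. Qed.

Fact hom_shape i j : i <> j + 1 -> forall f, hom_dif i j f = 0.
Proof. by move=> ij f; apply: hom_ext => x; rewrite hom_difE bc_shape. Qed.

Fact hom_difK i j l f : hom_dif j l (hom_dif i j f) = 0.
Proof. by apply: hom_ext => x; rewrite !hom_difE bc_difK. Qed.

Definition hom_cx : complex A^c := Complex hom_shape hom_difK.
End HomComplex.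

Definition hom_pull (L M : lmodType A) (X : bimod_complex A) (p : {linear L -> M}) i :
  {linear hom_cx M X i -> hom_cx L X i} := precomp (bract (X i)) p.

Lemma hom_pull_dif (L M : lmodType A) (X : bimod_complex A) (p : {linear L -> M}) i j f :
  hom_pull X p j (cx_dif (hom_cx M X) i j f) = cx_dif (hom_cx L X) i j (hom_pull X p i f).
Proof. by apply: hom_ext. Qed.

Variable dc : dualizing_complex A.
Hypotheses (Rn : noeth A^o) (AC : condition_AC A).

Local Notation P := (dc_P dc).
Local Notation I := (dc_I dc).
Local Notation Pr := (right_cx P).
Local Notation Dr := (right_cx (dc_D dc)).
Local Notation Ir := (right_cx I).

Definition rpi v : {linear Pr v -> Dr v} := hom_right (dc_pi dc v).
Definition riota v : {linear Dr v -> Ir v} := hom_right (dc_iota dc v).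

Lemma rpi_chain : chain_map rpi.
Proof. by move=> i j x; apply/esym; apply: (bcm_comm (dc_pi dc)). Qed.
Lemma riota_chain : chain_map riota.
Proof. by move=> i j x; apply/esym; apply: (bcm_comm (dc_iota dc)). Qed.
Lemma riota_qis : is_quasi_iso riota.
Proof. exact: (dc_iota_qis dc). Qed.

Lemma Pr_proj v : projective (Pr v).
Proof. exact: (dc_P_proj dc v).2. Qed.
Lemma Ir_inj v : injective_module (Ir v).
Proof. exact: (dc_I_inj dc v).2. Qed.

(** The composite [P -> D -> I] as a two-index family, zero off the diagonal. *)
Definition rho i j : {linear Pr i -> Ir j} := riota j \o (rpi j \o cast2 Pr i j).

Fact lmul_linear (a : A) v : linear (fun x : Pr v => (a *: (x : P v) : Pr v)).
Proof.
move=> s x y.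
rewrite -[LHS]/(a *: (ract (x : P v) s + (y : P v))) scalerDr lractA.
by [].
Qed.
Definition lmul a v : {linear Pr v -> Pr v} := lin (@lmul_linear a v).

(** The dualizing complex controls maps [P -> D]; maps [P -> I] are reduced to these by
    [quasi_iso_lift]. For [n <> 0] the term in [a] vanishes and [chi] is null-homotopic. *)
Lemma homothety n (chi : fam Pr Ir) : fam_cycle n (odd `|n|) chi ->
  exists (a : A) (h : fam Pr Ir),
    fam_homotopy n (odd `|n|) (fun i j => chi i j \- (rho i j \o lmul a i)) h.
Proof.
move=> chiC; have [c Pc] := dc_P_bounded dc.
have [g [h [gC hE]]] := quasi_iso_lift riota_chain riota_qis Pr_proj Pc chiC.
pose phi : hom_deg Pr Dr n := fun i j _ => g i j.
have phiC : hom_cycle phi.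
  move=> i j i' j' e e' ei x; rewrite sgnE (gC i j i' j') //; last by lia.
  exact: subrr.
have [Hn _ H0] := dc_homothety_right dc.
suff [a [h' h'E]] : exists (a : A) (h' : fam Pr Dr),
    fam_homotopy n (odd `|n|) (fun i j => g i j \- (rpi j \o (cast2 Pr i j \o lmul a i))) h'.
  exists a, (fun i j => h i j \+ (riota j \o h' i j)) => i j i' j1 ej ei ej1 x.
  have h1 := hE i j i' j1 ej ei ej1 x; have h2 := h'E i j i' j1 ej ei ej1 x.
  rewrite /= in h1 h2 *; rewrite linearD riota_chain sgnD addrACA -h1.
  by rewrite -sgn_linear -linearD -h2 linearB addrA subrK.
have [n0|/eqP n0] := eqVneq n 0; last first.
  have [h' h'E] := fam_of_hom_boundary (Hn n n0 phi phiC).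
  exists 0, h' => i j i' j1 ej ei ej1 x.
  rewrite -(h'E i j i' j1 ej ei ej1 x).
  rewrite -[LHS]/(g i j x - rpi j (cast2 Pr i j (lmul 0 i x))).
  have -> : lmul 0 i x = 0 by exact: (scale0r (x : P i)).
  by rewrite (linear0 (cast2 Pr i j)) (linear0 (rpi j)) subr0.
subst n; have [a [beta [betaB phiE]]] := H0 phi phiC.
have [h' h'E] := fam_of_hom_boundary betaB.
exists a, h' => i j i' j1 ej ei ej1 x.
rewrite -(h'E i j i' j1 ej ei ej1 x).
have eji : j = i by lia.
rewrite eji in ej *; rewrite -[LHS]/(phi i i ej x - rpi i (cast2 Pr i i (lmul a i x))) phiE castxx.
have -> : rpi i (lmul a i x) = a *: (dc_pi dc i x : dc_D dc i).
  exact: (linearZ_LR (dc_pi dc i)).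
by rewrite addrAC subrr add0r.
Qed.

Lemma homothety_inj (a : A) (h : fam Pr Ir) :
  fam_homotopy 0 false (fun i j => rho i j \o lmul a i) h -> a = 0.
Proof.
move=> hE; have [c Pc] := dc_P_bounded dc.
pose g : fam Pr Dr := fun i j => rpi j \o (cast2 Pr i j \o lmul a i).
have gC : fam_cycle 0 false g.
  move=> i j i' j' ej ei ej' x.
  have eji : j = i by lia.
  have eji' : i' = j' by lia.
  rewrite -[LHS]/(cx_dif Dr j j' (rpi j (cast2 Pr i j (lmul a i x)))) rpi_chain.
  rewrite (cx_dif_cast _ _ (esym eji)).
  rewrite -[RHS]/(rpi j' (cast2 Pr i' j' (lmul a i' (cx_dif Pr i i' x)))) -eji' castxx.
  congr (rpi _ _); exact: (linearZ_LR (bc_dif P i i')).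
have [h' h'E] := quasi_iso_lift_homotopy riota_chain riota_qis Pr_proj Pc gC hE.
have [_ Hinj _] := dc_homothety_right dc.
apply: (Hinj a (fun i j _ => g i j)).
  move=> v e x; rewrite /g /= castxx.
  exact: (linearZ_LR (dc_pi dc v)).
exists (fun i j _ => h' i j) => i j i' j' e e1 e2 ei x.
rewrite (h'E i j' i' j) //; last by lia.
by rewrite scaleN1r opprK.
Qed.

Lemma Pl_proj v : projective (left_cx P v).
Proof. exact: (dc_P_proj dc v).1. Qed.

(** [b] is read off from [D] and [I] before [M] is chosen, so it serves all syzygies of a module at
    once. *)
Lemma hom_exact_range : exists b : int, forall M, ext_orth M ->
  forall v, b < v -> zero_homology (hom_cx M P) v.
Proof.
have piC : @chain_map A (left_cx P) (left_cx (dc_D dc)) (fun v => bimod_fun (dc_pi dc v)).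
  by move=> i j x; apply/esym; apply: (bcm_comm (dc_pi dc)).
have iotaC : @chain_map A (left_cx (dc_D dc)) (left_cx I) (fun v => bimod_fun (dc_iota dc v)).
  by move=> i j x; apply/esym; apply: (bcm_comm (dc_iota dc)).
have rq := quasi_iso_comp piC iotaC (dc_pi_qis dc) (dc_iota_qis dc).
have rC : @chain_map A (left_cx P) (left_cx I)
    (fun v => bimod_fun (dc_iota dc v) \o bimod_fun (dc_pi dc v)).
  by move=> i j x; rewrite /= -piC; apply: iotaC.
have [c Pc] := dc_P_bounded dc; have [n In] := dc_I_bounded dc.
have [n' Dn'] := dc_bounded dc.
(* Above [b] both [I] and the homology of [D] vanish; below [c'] both [P] and [I] do. *)
pose b : int := (n + n')%N; pose c' : int := if c <= - (n + 1)%N%:Z then c else - (n + 1)%N%:Z.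
exists b => M [Mfg M0] v bv phi phi0.
pose Q := free_resolution Rn Mfg.
have [||||||||||g gE] := @hom_exact A Rn AC (left_cx P) (left_cx I) _ rC rq c' b
  _ _ _ _ _ _ _ M Q Mfg _ _ v (hom_app phi) bv _.
- by move=> w wc; apply: Pc; move: wc; rewrite /c'; case: ifP; lia.
- by move=> w wc; apply: In; move: wc; rewrite /c'; case: ifP; lia.
- by move=> w wb; apply: In; lia.
- move=> w wb; apply: (quasi_iso_zero_homology (dc_pi_qis dc) piC); apply: Dn'; lia.
- by move=> w; apply: (quasi_iso_fin_gen (dc_pi_qis dc) piC); apply: (dc_fin_gen dc w).1.
- exact: Pl_proj.
- by move=> w; apply: (dc_I_inj dc w).1.
- by move=> i; apply/ext_zeroE; apply: M0.
- by move=> i; apply: free_resolution_fin_gen.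
- move=> x; rewrite -[LHS]/(hom_app (cx_dif (hom_cx M P) v (v - 1) phi) x) phi0.
  by [].
by exists (g : hom_cx M P (v + 1)); apply: hom_ext => x; rewrite gE.
Qed.

Fact rho_scale i j (s : A^c) (y : P i) : rho i j (bract (P i) s y) = s *: rho i j y.
Proof. exact: (linearZ_LR (rho i j)). Qed.

Definition hom_eval (M : lmodType A) (m : M) i j : {linear hom_cx M P i -> Ir j} :=
  lin (@heval_linear A A^c (P i) (bract (P i)) M (Ir j) (rho i j) m
    (fun y z => linearD (rho i j) y z) (@rho_scale i j)).

Lemma hom_evalE (M : lmodType A) (m : M) i j phi : hom_eval m i j phi = rho i j (hom_app phi m).
Proof. by []. Qed.

(** As [rho i j = 0] for [i <> j], when [n <> 0] this says that every cycle of
    degree [n] is a boundary. *)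
Definition eval_surj n (M : lmodType A) := forall chi : fam (hom_cx M P) Ir,
  fam_cycle n (odd `|n|) chi -> exists (m : M) (h : fam (hom_cx M P) Ir),
    fam_homotopy n (odd `|n|) (fun i j => chi i j \- hom_eval m i j) h.

Section Row.
Variable r : nat.
Local Notation F := ('rV[A]_r : lmodType A).

Fact row_coord_linear i (x : P i) (l : 'I_r) : linear (fun v : F => v 0 l *: x).
Proof. by move=> a v w; rewrite !mxE scalerDl scalerA. Qed.

Fact row_inj_linear i (l : 'I_r) :
  linear (fun x : Pr i => lin (row_coord_linear x l) : hom_cx F P i).
Proof.
move=> s x y; apply: hom_ext => v.
rewrite -[LHS]/(v 0 l *: (ract (x : P i) s + (y : P i))) scalerDr lractA.
by [].
Qed.
Definition row_inj i (l : 'I_r) : {linear Pr i -> hom_cx F P i} := lin (@row_inj_linear i l).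

Lemma row_inj_dif i j l x : cx_dif (hom_cx F P) i j (row_inj i l x) = row_inj j l (cx_dif Pr i j x).
Proof. by apply: hom_ext => v; apply: (linearZ_LR (bc_dif P i j)). Qed.

Fact row_eval_linear i (l : 'I_r) :
  linear (fun phi : hom_cx F P i => (hom_app phi (delta_mx 0 l) : Pr i)).
Proof. by []. Qed.
Definition row_eval i l : {linear hom_cx F P i -> Pr i} := lin (@row_eval_linear i l).

Lemma hom_sumE (M : lmodType A) i (G : 'I_r -> hom_cx M P i) x :
  hom_app (\sum_l G l) x = \sum_l hom_app (G l) x.
Proof.
apply: (big_rec2 (fun (f : hom_cx M P i) y => hom_app f x = y)) => //.
by move=> l f y _ <-.
Qed.

Lemma row_homE i (phi : hom_cx F P i) : phi = \sum_l row_inj i l (row_eval i l phi).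
Proof. by apply: hom_ext => v; rewrite hom_sumE [LHS](rowlE (hom_app phi)). Qed.

(** [Hom(F, P)] is a sum of [r] copies of [P], and [homothety] supplies one coordinate of [m] for
    each. *)
Lemma eval_surj_row n : eval_surj n F.
Proof.
move=> chi chiC.
have /choice[a] (l : 'I_r) : exists (a : A), exists (h : fam Pr Ir), fam_homotopy n (odd `|n|)
    (fun i j => (chi i j \o row_inj i l) \- (rho i j \o lmul a i)) h.
  apply: homothety => i j i' j' ej ei ej' x /=.
  by rewrite (chiC i j i' j') // -row_inj_dif.
move=> /choice[h hE].
pose hh (l : 'I_r) (i j : int) : {linear hom_cx F P i -> Ir j} := h l i j \o row_eval i l.
have sL i j : linear (fun phi => \sum_l hh l i j phi).
  move=> s x y; rewrite scaler_sumr -big_split; apply: eq_bigr => l _ /=.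
  exact: linearP.
exists (\row_l a l), (fun i j => lin (sL i j)) => i j i' j1 ej ei ej1 phi.
rewrite -[LHS]/(chi i j phi - rho i j (hom_app phi (\row_l a l))).
rewrite -[RHS]/(cx_dif Ir j1 j (\sum_l hh l i j1 phi) + sgn _ (\sum_l hh l i' j (cx_dif _ i i' phi))).
rewrite linear_sum -[sgn _ _]/(sgnl _ _ _) [sgnl _ _ _]linear_sum -big_split.
have -> : rho i j (hom_app phi (\row_l a l)) =
    \sum_l rho i j (lmul (a l) i (row_eval i l phi)).
  rewrite (rowlE (hom_app phi)) -[rowl _ _]/(\sum_l _ *: _).
  rewrite (raddf_sum (rho i j)); apply: eq_bigr => l _; by rewrite mxE.
rewrite {1}(row_homE phi) (linear_sum (chi i j)) -sumrB; apply: eq_bigr => l _.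
have := hE l i j i' j1 ej ei ej1 (row_eval i l phi) => /= ->.
by [].
Qed.

Lemma eval_row_inj (f : F) (h : fam (hom_cx F P) Ir) :
  fam_homotopy 0 false (fun i j => hom_eval f i j) h -> f = 0.
Proof.
move=> hE; apply/rowP => l; rewrite mxE.
apply: (@homothety_inj _ (fun i j => h i j \o row_inj i l)) => i j i' j1 ej ei ej1 x.
have := hE i j i' j1 ej ei ej1 (row_inj i l x).
by rewrite row_inj_dif.
Qed.
End Row.

(** The extension of maps from the syzygy is [Ext^1(M, P_v) = 0]; it makes [Hom(-, P)] exact on the
    presentation of [M]. *)
Lemma ext_orth_cover (M : lmodType A) : ext_orth M ->
  exists r (p : {linear 'rV[A]_r -> M}), [/\ forall m, exists v, p v = m,
    ext_orth (smT (ker p)) &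
    forall v (psi : {linear smT (ker p) -> P v}),
      exists phi : {linear 'rV[A]_r -> P v}, forall x, phi (smval _ x) = psi x].
Proof.
move=> [Mfg M0]; have [r [p pS]] := fin_gen_cover Mfg; exists r, p.
have Kfg : fin_gen (smT (ker p)).
  by apply/fg_smT/fin_gen_noeth => //; apply: row_fin_gen.
pose Q := free_resolution Rn Kfg; have [jI _ jE] := sexact_ker pS.
pose S := splice (@row_projective A r) jI pS jE Q.
have S0 i : ext_van S i.+1 A^o by apply/ext_zeroE.
split=> //.
  by split=> // i; exists Q; apply: (S0 i.+1).
move=> v psi; have [||g gE] := @ext_projective _ _ S _ 0 (left_cx P v) (S0 0) (@Pl_proj v) (psi \o res_aug Q).
- by case=> [|i]; [exact: row_fin_gen | exact: free_resolution_fin_gen].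
- by move=> x; change (psi (res_aug Q (res_dif Q 0 x)) = 0); rewrite res_aug_dif linear0.
exists g => x; have [y <-] := res_aug_surj Q x.
exact/esym/gE.
Qed.

(** * From a syzygy to the module *)

Section Induction.
Variables (M : lmodType A) (r : nat) (p : {linear 'rV[A]_r -> M}).
Hypothesis pS : forall m, exists v, p v = m.
Local Notation F := ('rV[A]_r : lmodType A).
Local Notation K := (smT (ker p) : lmodType A).
Hypothesis Kext : forall v (psi : {linear K -> P v}),
  exists phi : {linear F -> P v}, forall x, phi (smval _ x) = psi x.
Local Notation up := (hom_pull P p).
Local Notation dn := (hom_pull P (smval (ker p))).

Lemma dn_up i phi : dn i (up i phi) = 0.
Proof.
apply: hom_ext => x; rewrite -[LHS]/(hom_app phi (p (smval _ x))).
by rewrite (smvalP x) linear0.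
Qed.

Lemma dn_eq0 i phi : dn i phi = 0 -> exists psi, phi = up i psi.
Proof.
move=> phi0; have [|psi psiE] := fac_surj (f := hom_app phi) pS.
  move=> v /(smvalK (S := ker p))[x ->].
  by rewrite -[LHS]/(hom_app (dn i phi) x) phi0.
by exists (psi : hom_cx M P i); apply: hom_ext => v; apply/esym/psiE.
Qed.

Lemma dn_surj i psi : exists phi, dn i phi = psi.
Proof.
by have [phi phiE] := Kext (hom_app psi); exists (phi : hom_cx F P i); apply: hom_ext.
Qed.

Lemma up_inj i phi : up i phi = 0 -> phi = 0.
Proof.
move=> e; apply: hom_ext => m; have [v <-] := pS m.
by rewrite -[LHS]/(hom_app (up i phi) v) e.
Qed.

Lemma hom_eval_up i j (f : F) phi : hom_eval f i j (up i phi) = hom_eval (p f) i j phi.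
Proof. by []. Qed.

(** The failure of [chi] to be a cycle vanishes on [Hom(M, P)], so it comes from a
    cycle on [Hom(K, P)], of degree one less. *)
Lemma descend n e (chi : fam (hom_cx F P) Ir) :
  (forall i j i' j', j = i + n -> i = i' + 1 -> j = j' + 1 -> forall phi,
    cx_dif Ir j j' (chi i j (up i phi)) = sgn e (chi i' j' (cx_dif _ i i' (up i phi)))) ->
  exists delta : fam (hom_cx K P) Ir,
    (forall i j i' j', j = i + n -> i = i' + 1 -> j = j' + 1 -> forall phi,
      delta i j' (dn i phi) = cx_dif Ir j j' (chi i j phi) - sgn e (chi i' j' (cx_dif _ i i' phi))) /\
    fam_cycle (n - 1) (~~ e) delta.
Proof.
move=> chiC.
pose D i j' (d : {linear hom_cx K P i -> Ir j'}) := j' + 1 = i + n -> forall phi,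
  d (dn i phi) = cx_dif Ir (j' + 1) j' (chi i (j' + 1) phi) - sgn e (chi (i - 1) j' (cx_dif _ i (i - 1) phi)).
have [delta dE] : exists delta : fam (hom_cx K P) Ir, forall i j', D i j' (delta i j').
  apply: fam_choice => i j'.
  have [e1|ne] := eqVneq (j' + 1) (i + n); last by exists \0 => e1; move/eqP: ne.
  have [phi /dn_eq0[psi ->]|d dE] := @fac_surj _ _ _ _ (dn i)
      ((cx_dif Ir (j' + 1) j' \o chi i (j' + 1)) \-
       (sgnl e _ \o (chi (i - 1) j' \o cx_dif (hom_cx F P) i (i - 1)))) (@dn_surj i).
    by rewrite /= (chiC _ _ (i - 1) j') ?subrr //; lia.
  by exists d => _ phi; apply: dE.
have dE' i j i' j' : j = i + n -> i = i' + 1 -> j = j' + 1 -> forall phi,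
      delta i j' (dn i phi) = cx_dif Ir j j' (chi i j phi) - sgn e (chi i' j' (cx_dif _ i i' phi)).
  move=> ej ei ej' phi; have := dE i j' _ phi => ->; last by lia.
  have -> : i - 1 = i' by lia.
  by rewrite -ej'.
exists delta; split=> // i j i' j' ej ei ej' psi.
have [phi <-] := dn_surj psi; rewrite -hom_pull_dif.
rewrite (dE' i (j + 1) i' j) //; [|lia].
rewrite (dE' i' j (i' - 1) j') //; [|lia|lia].
rewrite linearB !cx_difK sub0r linear0 sgn0 subr0 sgn_linear sgnN.
by [].
Qed.

(** Extend [chi] to [Hom(F, P)] by injectivity of [I]. The failure of the extension to be a cycle
    lives on [Hom(K, P)] in degree [n - 1 < 0], where it is null-homotopic; corrected by that
    homotopy, the extension is a cycle on a free module, hence an evaluation up to homotopy. *)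
Lemma eval_surj_step n : eval_surj (n - 1) K -> n <= 0 -> eval_surj n M.
Proof.
move=> IH n0 chi chiC; set e := odd `|n| in chiC *.
have e' : odd `|(n - 1)%R| = ~~ e by rewrite /e; lia.
have [hat hatE] : exists hat : fam (hom_cx F P) Ir, forall i j phi, hat i j (up i phi) = chi i j phi.
  apply: (fam_choice (P := fun i j (g : {linear hom_cx F P i -> Ir j}) =>
    forall phi, g (up i phi) = chi i j phi)) => i j.
  by apply: (inj_fac (u := up i) (f := chi i j) (@Ir_inj j)) => phi /up_inj ->; apply: linear0.
have [|delta [dE dC]] := @descend n e hat.
  move=> i j i' j' ej ei ej' phi.
  by rewrite hatE -hom_pull_dif hatE; apply: chiC.
have [m [sigma sE]] := IH delta ltac:(by rewrite e'); rewrite e' in sE.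
pose tilde : fam (hom_cx F P) Ir := fun i j => hat i j \- (sigma i j \o dn i).
have tC : fam_cycle n e tilde.
  move=> i j i' j' ej ei ej' phi.
  have d1 := dE i j i' j' ej ei ej' phi.
  have := sE i j' i' j _ ei ej' (dn i phi) => /(_ ltac:(lia)) /=.
  have -> : hom_eval m i j' (dn i phi) = 0.
    rewrite hom_evalE -[rho _ _ _]/(riota j' (rpi j' (cast2 Pr i j' (hom_app (dn i phi) m)))).
    by rewrite cast2_neq ?linear0 //; lia.
  rewrite subr0 d1 -hom_pull_dif sgnN => d2.
  by rewrite /tilde /= linearB sgnB; apply: subr_swap.
have [f [tau tE]] := eval_surj_row tC.
exists (p f), (fun i j => tau i j \o up i) => i j i' j1 ej ei ej1 phi.
have := tE i j i' j1 ej ei ej1 (up i phi).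
rewrite /tilde /= hatE dn_up linear0 subr0 -hom_pull_dif.
by [].
Qed.

End Induction.

(** Induction upwards on the degree, from very negative degrees where every cycle is
    null-homotopic. *)
Lemma eval_surj_all n M : ext_orth M -> n <= 0 -> eval_surj n M.
Proof.
have [b bE] := hom_exact_range; have [N IN] := dc_I_bounded dc.
have base M' n' : ext_orth M' -> n' <= - N%:Z - `|b| - 1 -> eval_surj n' M'.
  move=> M'O n'b chi chiC.
  (* Degrees at most [b], where [Hom(M', P)] may fail to be exact, are sent below [- N], where [I]
     is zero. *)
  have [||||||h hE] := @fam_cycle_injective _ _ _ n' (odd `|n'|) (- N%:Z) N (b + 1) chi.
  - exact: Ir_inj.
  - by move=> j jN; apply: IN; lia.
  - by move=> j jN; apply: IN; lia.
  - by move=> i ib; apply: bE => //; lia.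
  - lia.
  - exact: chiC.
  exists 0, h => i j i' j1 ej ei ej1 phi.
  rewrite -(hE i j i' j1 ej ei ej1 phi) -[LHS]/(chi i j phi - rho i j (hom_app phi 0)).
  by rewrite (linear0 (hom_app phi)) (linear0 (rho i j)) subr0.
suff H (q : nat) : forall M n, ext_orth M -> n <= 0 -> n <= - N%:Z - `|b| - 1 + q%:Z -> eval_surj n M.
  by move=> MO n0; apply: (H (absz (- N%:Z - `|b| - 1)%R)) => //; lia.
elim: q => [|q IH] {}M {}n MO n0 nq; first by apply: base => //; lia.
have [r [p [pS KO Kext]]] := ext_orth_cover MO.
by apply: (eval_surj_step pS Kext) => //; apply: IH => //; lia.
Qed.

(** Injectivity of evaluation on [M] is extracted from surjectivity on the syzygy [K] and
    injectivity on the free module. Evaluation at a lift [f] of [t] vanishes on [Hom(M, P)], so it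
    descends to [Hom(K, P)], where it is homotopic to evaluation at some [m] in [K]; then [f = m],
    and [t = 0]. *)
Lemma dualizing_torsionless (M : lmodType A) : ext_orth M -> torsionless M.
Proof.
move=> MO t t0; have [r [p [pS KO Kext]]] := ext_orth_cover MO.
have [f fE] := pS t.
have tP i (phi : hom_cx M P i) : hom_app phi t = 0.
  have [n [f1 [f2 [fE1 _]]]] := projective_factor (hom_app phi) (@Pl_proj i) MO.1.
  rewrite fE1; suff -> : f1 t = 0 by apply: linear0.
  apply/rowP => l; rewrite mxE.
  have lL : linear (fun x : M => f1 x 0 l : A^o) by move=> a x y; rewrite linearP !mxE.
  exact: (t0 (lin lL)).
have chi0 i j phi : hom_eval f i j (hom_pull P p i phi) = 0.
  by rewrite hom_eval_up fE hom_evalE tP linear0.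
have [chi chiE] : exists chi : fam (hom_cx (smT (ker p)) P) Ir,
    forall i j phi, chi i j (hom_pull P (smval (ker p)) i phi) = hom_eval f i j phi.
  apply: (fam_choice (P := fun i j (g : {linear hom_cx (smT (ker p)) P i -> Ir j}) =>
    forall phi, g (hom_pull P (smval (ker p)) i phi) = hom_eval f i j phi)) => i j.
  apply: fac_surj; first exact: dn_surj.
  by move=> phi /(dn_eq0 pS)[psi ->].
have [|m [h hE]] := eval_surj_all KO (n := 0) isT (chi := chi).
  move=> i j i' j' ej ei ej' psi.
  have [phi <-] := dn_surj Kext psi.
  rewrite -hom_pull_dif !chiE !hom_evalE.
  have eji : j = i by lia.
  have eji' : j' = i' by lia.
  rewrite eji eji' -[rho i' i' _]/(riota i' (rpi i' (cast2 Pr i' i' (cx_dif Pr i i' (hom_app phi f))))).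
  rewrite castxx -rpi_chain -riota_chain.
  by rewrite -[rho i i _]/(riota i (rpi i (cast2 Pr i i (hom_app phi f)))) castxx.
suff f0 : f - smval _ m = 0.
  by rewrite -fE (subr0_eq f0); apply: (smvalP m).
apply: (@eval_row_inj _ _ (fun i j => h i j \o hom_pull P (smval (ker p)) i)).
move=> i j i' j1 ej ei ej1 phi.
have := hE i j i' j1 ej ei ej1 (hom_pull P (smval (ker p)) i phi).
rewrite -hom_pull_dif => <-.
rewrite hom_evalE linearB linearB -!hom_evalE -chiE.
by [].
Qed.
End Dualizing.

Theorem theoremC (k : comPzRingType) (A : algType k) :
  noetherian A ->
  inhabited (dualizing_complex A) \/ (forall x y : A, x * y = y * x) ->
  condition_AC A ->
  forall M : lmodType A,
    fin_gen M -> ~ zero_module M ->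
    (forall i : nat, (1 <= i)%N -> ext_zero i M A^o) ->
    Gdim0 M.
Proof.
move=> [/left_noetherianE Rn /left_noetherianE Rcn] H AC M Mfg M0 Mext.
have TL (N : lmodType A) : ext_orth N -> torsionless N.
  move=> NO; case: H => [[dc]|mulC]; first exact: (dualizing_torsionless dc).
  exact: comm_torsionless.
have MO : ext_orth M by split=> // i; apply: Mext.
exact: Gdim0_ext_orth.
Qed.
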